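(* Let $k$ be an algebraically closed field of characteristic $p=2$, and let $SL_2$ be the simple algebraic group over $k$. For all integers $m\ge 0$ and $n\ge 1$, $$\dim \mathrm{H}^n(SL_2,V(m))\le F(2n).$$
   Context: The dominant weights of $SL_2$ (with respect to a fixed torus $T$) are identified with the non-negative integers $\mathbb{N}$. For $m\in\mathbb{N}$, $V(m)$ denotes the Weyl module for $SL_2$ of highest weight $m$; $V(0)=k$ is the trivial module. $\mathrm{H}^n(SL_2,N)=\mathrm{Ext}^n_{SL_2}(k,N)$ is the $n$-th rational cohomology space of the algebraic group $SL_2$ with coefficients in the rational module $N$, and $\dim$ is the dimension as a $k$-vector space. $F(n)$ is the $n$-th Fibonacci number: $F(1)=F(2)=1$, $F(n)=F(n-1)+F(n-2)$ for $n\ge 3$, and $F(i)=0$ for all integers $i\le 0$. *)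

(* Defs.v *)
From HB Require Import structures.
From mathcomp Require Import all_boot all_order all_algebra.
From mathcomp Require Import mpoly.

Set Implicit Arguments.
Unset Strict Implicit.
Unset Printing Implicit Defensive.

Import GRing.Theory.
Local Open Scope ring_scope.

Section SL2.
Variable k : closedFieldType.

(* Over an algebraically closed field the (reduced) algebraic group SL_2 is
   determined by its group of points, with coordinate ring the ring of
   polynomial functions of the four matrix entries. *)
Record SL2 : predArgType := MkSL2 {
  SL2_val :> 'M[k]_2;
  SL2_valP : \det SL2_val == 1
}.

HB.instance Definition _ := [isSub for SL2_val].
HB.instance Definition _ := [Choice of SL2 by <:].

Fact SL2_one_subproof : \det (1%:M : 'M[k]_2) == 1.
Proof. by rewrite det1. Qed.

Fact SL2_mul_subproof (g h : SL2) : \det (val g *m val h) == 1.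
Proof. by rewrite det_mulmx (eqP (valP g)) (eqP (valP h)) mulr1. Qed.

Fact SL2_inv_subproof (g : SL2) : \det (invmx (val g)) == 1.
Proof. by rewrite det_inv (eqP (valP g)) invr1. Qed.

Fact SL2_unitmx (g : SL2) : val g \in unitmx.
Proof. by rewrite unitmxE (eqP (valP g)) unitr1. Qed.

Definition SL2_one : SL2 := MkSL2 SL2_one_subproof.
Definition SL2_mul (g h : SL2) : SL2 := MkSL2 (SL2_mul_subproof g h).
Definition SL2_inv (g : SL2) : SL2 := MkSL2 (SL2_inv_subproof g).

Fact SL2_mulA : associative SL2_mul.
Proof. by move=> x y z; apply: val_inj; rewrite /= mulmxA. Qed.

Fact SL2_mul1 : left_id SL2_one SL2_mul.
Proof. by move=> x; apply: val_inj; rewrite /= mul1mx. Qed.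

Fact SL2_mulr1 : right_id SL2_one SL2_mul.
Proof. by move=> x; apply: val_inj; rewrite /= mulmx1. Qed.

Fact SL2_mulV : left_inverse SL2_one SL2_inv SL2_mul.
Proof. by move=> x; apply: val_inj; rewrite /= mulVmx ?SL2_unitmx. Qed.

Fact SL2_mulrV : right_inverse SL2_one SL2_inv SL2_mul.
Proof. by move=> x; apply: val_inj; rewrite /= mulmxV ?SL2_unitmx. Qed.

HB.instance Definition _ := isGroup.Build SL2
  SL2_mulA SL2_mul1 SL2_mulr1 SL2_mulV SL2_mulrV.

Definition regular (f : SL2 -> k) : Prop :=
  exists P : {mpoly k[2 * 2]}, forall g : SL2, f g = P.@[mxvec (val g) 0].

(* [act_rational] says that every orbit map g |-> g v lies in M (x) k[SL_2],
   i.e. that the action comes from a k[SL_2]-comodule structure on M;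
   M need not be finite dimensional. *)
Record rational_module := RationalModule {
  carrier :> lmodType k;
  act : SL2 -> carrier -> carrier;
  act_linear : forall g, linear (act g);
  act1 : forall v, act 1%g v = v;
  actM : forall g h v, act (g * h)%g v = act g (act h v);
  act_rational : forall v, exists (n : nat) (f : 'I_n -> SL2 -> k)
    (w : 'I_n -> carrier),
    (forall i, regular (f i)) /\ forall g, act g v = \sum_(i < n) f i g *: w i
}.

Record rational_hom (M N : rational_module) := RationalHom {
  hom_fun :> {linear M -> N};
  hom_act : forall g v, hom_fun (act g v) = act g (hom_fun v)
}.

Definition trivial_act (g : SL2) (v : k^o) : k^o := v.

Fact trivial_act_linear g : linear (trivial_act g).
Proof. by []. Qed.

Fact trivial_act_rational (v : k^o) : exists (n : nat) (f : 'I_n -> SL2 -> k)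
  (w : 'I_n -> k^o),
  (forall i, regular (f i)) /\
  forall g, trivial_act g v = \sum_(i < n) f i g *: w i.
Proof.
exists 1%N, (fun _ _ => 1), (fun=> v); split; last first.
  by move=> g; rewrite big_ord1 scale1r.
by move=> _; exists 1 => g; rewrite meval1.
Qed.

Definition trivial_module : rational_module :=
  RationalModule trivial_act_linear (fun=> erefl) (fun _ _ _ => erefl)
    trivial_act_rational.

Definition injective_module (I : rational_module) : Prop :=
  forall (A B : rational_module) (i : rational_hom A B) (f : rational_hom A I),
  injective i -> exists h : rational_hom B I, forall a, h (i a) = f a.

Record injective_resolution (N : rational_module) := InjectiveResolution {
  res : nat -> rational_module;
  res_injective : forall n, injective_module (res n);
  res_aug : rational_hom N (res 0);
  res_diff : forall n, rational_hom (res n) (res n.+1);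
  res_aug_inj : injective res_aug;
  res_exact0 : forall x, res_diff 0 x = 0 <-> exists v, x = res_aug v;
  res_exact : forall n x,
    res_diff n.+1 x = 0 <-> exists y, x = res_diff n y
}.

Section Ext.
Variables (M N : rational_module) (I : injective_resolution N).

Definition cocycle n (f : rational_hom M (res I n)) : Prop :=
  forall v, res_diff I n (f v) = 0.

Definition coboundary n : rational_hom M (res I n) -> Prop :=
  if n is n'.+1 then
    fun f => exists h : rational_hom M (res I n'),
      forall v, f v = res_diff I n' (h v)
  else fun f => forall v, f v = 0.

End Ext.

(* dim Ext^n(M, N) <= d: the n-th cohomology (cocycles modulo coboundaries) of
   the complex Hom(M, I) is spanned by d classes, for every injective
   resolution I of N; it depends on I only up to isomorphism. *)
Definition Ext_dim_le (n : nat) (M N : rational_module) (d : nat) : Prop :=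
  forall I : injective_resolution N,
  exists e : 'I_d -> rational_hom M (res I n),
    (forall i, cocycle (e i)) /\
    forall f : rational_hom M (res I n), cocycle f ->
    exists (c : 'I_d -> k) (b : rational_hom M (res I n)),
      coboundary b /\ forall v, f v = \sum_(i < d) c i *: e i v + b v.

Definition H_dim_le (n : nat) (N : rational_module) (d : nat) : Prop :=
  Ext_dim_le n trivial_module N d.

(* H^0(m) = ind_B^G k_m, for B the lower triangular (negative) Borel subgroup
   and k_m the character diag(t, t^-1) |-> t^m of B. *)
Definition in_ind (m : nat) (f : SL2 -> k) : Prop :=
  regular f /\
  forall g b : SL2, val b 0 1 = 0 -> f (g * b)%g = (val b 0 0) ^- m * f g.

Definition is_induced_module (m : nat) (H : rational_module) : Prop :=
  exists iota : H -> SL2 -> k,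
  [/\ forall (a : k) (u v : H) x,
        iota (a *: u + v) x = a * iota u x + iota v x,
      forall g h x, iota (act g h) x = iota h (g^-1 * x)%g,
      forall h, (forall x, iota h x = 0) -> h = 0
    & forall f, in_ind m f <-> exists h, forall x, f x = iota h x].

(* V is isomorphic to the linear dual of H with (g phi)(h) = phi (g^-1 h). *)
Definition is_dual_module (V H : rational_module) : Prop :=
  exists beta : V -> {scalar H},
  [/\ forall (a : k) (u v : V) h,
        beta (a *: u + v) h = a * beta u h + beta v h,
      forall g v h, beta (act g v) h = beta v (act g^-1%g h),
      forall v, (forall h, beta v h = 0) -> v = 0
    & forall phi : {scalar H}, exists v, forall h, phi h = beta v h].

(* V(m) = H^0(- w_0 m)^*, and - w_0 = id for SL_2.  The Weyl module is thereby
   specified up to isomorphism. *)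
Definition is_weyl_module (m : nat) (V : rational_module) : Prop :=
  exists2 H : rational_module, is_induced_module m H & is_dual_module V H.

End SL2.

(* Indexed so that F(0) = 0 and F(1) = F(2) = 1. *)
Fixpoint fib (n : nat) : nat :=
  if n is n'.+1 then if n' is n''.+1 then (fib n' + fib n'')%N else 1%N
  else 0%N.

(* Main.v *)
Require Import Defs.
From HB Require Import structures.
From mathcomp Require Import all_boot all_order all_algebra.
From mathcomp Require Import boolp functions.
From mathcomp Require Import mpoly.
From mathcomp Require Import ring zify.

Set Implicit Arguments.
Unset Strict Implicit.
Unset Printing Implicit Defensive.

Import GRing.Theory.
Local Open Scope ring_scope.

(** Write E for the natural module of G = SL_2, M^F for the twist of M by the
    Frobenius map F, Nabla m for the space of binary forms of degree m and
    Delta m for its dual, so that the Weyl module of highest weight m is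
    Delta m. All dimensions come from two recursions along the exact sequences

      0 -> Nabla (2b) -> Tw (Nabla b) -> Nabla (2b + 2) -> 0,
      0 -> Delta (2b + 2) -> Tw (Delta b) -> Delta (2b) -> 0,

    where Tw M is E (x) E (x) M^F ([ses_nab], [ses_del]). A form of degree
    2b + 2 is a combination of the x_i x_j whose coefficients are forms of degree
    b in the squares of the variables, and squaring is equivariant up to F in
    characteristic 2. This gives the surjection in the first sequence; the second
    sequence is its dual.

    The functor Tw does not change cohomology ([Hle_tw]). It is exact, its
    invariants are the invariants of M times the determinant in E (x) E, and it
    maps coinduced modules to acyclic ones. The last point holds because the
    odd regular functions on G are spanned over the functions of F(x) by the
    four matrix entries ([preg_ospan]), freely ([frob_indep]): one row of
    entries makes E (x) k[G]^F a direct summand of k[G]. A module in which all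
    matrix coefficients are odd has no cohomology at all ([Hle_odd]), which
    settles odd m.

    For even m, write m = 2c. The first sequence and an induction show that
    Nabla m is acyclic for m > 0, invariants included ([Hle_Nabla]). The trivial
    module is acyclic in positive degrees as well ([Hle_trivial]): the
    successive cokernels of the tower k -> Tw k -> Tw (Tw k) -> ... come from
    Nabla 2 by iterating Tw, so the tower is injective on cohomology, while its
    union is the module of functions on G invariant under left translation by
    the torus, a direct summand of k[G]. The second sequence then bounds the
    dimension h(n, c) of the n-th cohomology of Delta (2c) by

      h(n, b + 1) <= h(n - 1, b) + h(n, b / 2),

    the last term being absent for odd b. Hence h(n, c) is at most the number of
    partitions of c + 1 into n + 1 powers of 2 ([Hle_Delta_even]), because such a
    partition either has a part 1, to be removed, or can be halved. For n > 0
    that number is at most F(2n) ([bp_le_fib]).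

    Here the orbit maps embed M in the coinduced module of regular maps G -> M,
    the cokernel is the module Q M of regular maps that vanish at 1, and the n-th
    cohomology is the quotient of the invariants of Q^n M by the principal
    cocycles ([Hle]). It bounds Ext, for any injective resolution, by dimension
    shifting ([Ext_of_Hle]). *)

(** * Regular functions on SL_2 *)

Section RegularFunctions.
Variable k : closedFieldType.
Local Notation G := (SL2 k).

Lemma regular_cst (c : k) : regular (fun _ : G => c).
Proof. by exists (mpolyC _ c) => g; rewrite mevalC. Qed.

Lemma regular_coord i j : regular (fun g : G => val g i j).
Proof.
by exists (mpolyX _ (mnm1 (mxvec_index i j))) => g; rewrite mevalXU mxvecE.
Qed.

Lemma regularD (f h : G -> k) :
  regular f -> regular h -> regular (fun g => f g + h g).
Proof. by move=> [P HP] [Q HQ]; exists (P + Q) => g; rewrite mevalD HP HQ. Qed.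

Lemma regularM (f h : G -> k) :
  regular f -> regular h -> regular (fun g => f g * h g).
Proof. by move=> [P HP] [Q HQ]; exists (P * Q) => g; rewrite mevalM HP HQ. Qed.

Lemma regular_ind (P : (G -> k) -> Prop) :
  (forall c, P (fun=> c)) -> (forall i j, P (fun g : G => val g i j)) ->
  (forall f h, P f -> P h -> P (fun g => f g + h g)) ->
  (forall f h, P f -> P h -> P (fun g => f g * h g)) ->
  forall f, regular f -> P f.
Proof.
move=> Pc Pv PD PM f [Q HQ].
have -> : f = fun g : G => meval (mxvec (val g) 0) Q by apply/funext.
elim/mpolyind: Q {HQ} => [|c m p _ _ IH].
  by rewrite (_ : (fun=> _) = fun=> 0) //; apply/funext => g; rewrite meval0.
rewrite (_ : (fun=> _) = fun g : G => c * \prod_i (mxvec (val g) 0 i) ^+ (m i)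
                     + meval (mxvec (val g) 0) p); last first.
  by apply/funext => g; rewrite mevalD mevalZ mevalX.
apply: (PD) => //; apply: (PM) => //.
elim: (index_enum _) => [|i r IHr].
  by rewrite (_ : (fun=> _) = fun=> 1) //; apply/funext => g; rewrite big_nil.
rewrite (_ : (fun=> _) = fun g : G => (mxvec (val g) 0 i) ^+ (m i) *
      \prod_(j <- r) (mxvec (val g) 0 j) ^+ (m j)); last first.
  by apply/funext => g; rewrite big_cons.
apply: (PM) => //.
elim: (m i : nat) => [|e IHe]; first exact: (Pc 1).
rewrite (_ : (fun=> _) = fun g : G => (mxvec (val g) 0 i) *
      (mxvec (val g) 0 i) ^+ e); last by apply/funext => g; rewrite exprS.
apply: (PM) => //; case/mxvec_indexP: i {IHr IHe} => i j.
by rewrite (_ : (fun=> _) = fun g : G => val g i j) //; apply/funext => g; rewrite mxvecE.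
Qed.

Lemma regular_sum (I : Type) (r : seq I) (f : I -> G -> k) :
  (forall i, regular (f i)) -> regular (fun g => \sum_(i <- r) f i g).
Proof.
move=> H; elim: r => [|i r IH].
  by rewrite (_ : (fun=> _) = fun=> 0);
    [exact: regular_cst|apply/funext => g; rewrite big_nil].
rewrite (_ : (fun=> _) = fun g => f i g + \sum_(j <- r) f j g).
  exact: regularD.
by apply/funext => g; rewrite big_cons.
Qed.

Lemma regular_comp (u : G -> G) :
  (forall i j, regular (fun g => val (u g) i j)) ->
  forall f : G -> k, regular f -> regular (fun g => f (u g)).
Proof.
move=> Hu; apply: regular_ind => [c|i j|f h|f h]; first exact: regular_cst.
- exact: Hu.
- exact: regularD.
- exact: regularM.
Qed.

Lemma SL2_valM (g h : G) : val (g * h)%g = val g *m val h. Proof. by []. Qed.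
Lemma SL2_val1 : val (1%g : G) = 1%:M. Proof. by []. Qed.
Lemma SL2_valM_entry (g h : G) i j :
  val (g * h)%g i j = \sum_l val g i l * val h l j.
Proof. by rewrite SL2_valM mxE. Qed.

Lemma sum_row_mul (V : lmodType k) (x g : G) i (A : 'I_2 -> V) :
  \sum_l val (x * g)%g i l *: A l = \sum_j val x i j *: \sum_l val g j l *: A l.
Proof.
under [RHS]eq_bigr do rewrite scaler_sumr; rewrite exchange_big /=.
apply: eq_bigr => l _; rewrite SL2_valM_entry scaler_suml.
by apply: eq_bigr => j _; rewrite scalerA.
Qed.

Lemma regular_mulr (h : G) (f : G -> k) :
  regular f -> regular (fun g => f (g * h)%g).
Proof.
apply: regular_comp => i j.
rewrite (_ : (fun=> _) = fun g : G => \sum_l val g i l * val h l j); last first.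
  by apply/funext => g; rewrite SL2_valM_entry.
by apply: regular_sum => l; apply: regularM; [exact: regular_coord|exact: regular_cst].
Qed.

Definition catf (T : Type) n m (a : 'I_n -> T) (c : 'I_m -> T) (i : 'I_(n + m)) : T :=
  match fintype.split i with inl l => a l | inr l => c l end.

Lemma catfl T n m (a : 'I_n -> T) (c : 'I_m -> T) l : catf a c (lshift m l) = a l.
Proof. by rewrite /catf -[lshift m l]/(unsplit (inl l)) unsplitK. Qed.

Lemma catfr T n m (a : 'I_n -> T) (c : 'I_m -> T) l : catf a c (rshift n l) = c l.
Proof. by rewrite /catf -[rshift n l]/(unsplit (inr l)) unsplitK. Qed.

Lemma catfP (T : Type) (P : T -> Prop) n m (a : 'I_n -> T) (c : 'I_m -> T) :
  (forall i, P (a i)) -> (forall i, P (c i)) -> forall i, P (catf a c i).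
Proof. by move=> Ha Hc i; rewrite /catf; case: (fintype.split i). Qed.

Lemma sum_catf (T U : Type) (V : nmodType) (op : T -> U -> V) n m
    (a : 'I_n -> T) (c : 'I_m -> T) (b : 'I_n -> U) (d : 'I_m -> U) :
  \sum_i op (catf a c i) (catf b d i) = \sum_i op (a i) (b i) + \sum_i op (c i) (d i).
Proof.
rewrite big_split_ord; congr (_ + _); apply: eq_bigr => i _; first by rewrite !catfl.
by rewrite !catfr.
Qed.

(** The comultiplication of the coordinate ring. It makes translation locally
    finite: all the translates of f lie in the span of the finitely many a i. *)
Lemma regular_comul (f : G -> k) : regular f ->
  exists (n : nat) (a b : 'I_n -> G -> k),
    [/\ forall i, regular (a i), forall i, regular (b i) &
        forall x g, f (x * g)%g = \sum_i a i x * b i g].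
Proof.
move: f; apply: regular_ind => [c|i j|f h|f h].
- exists 1%N, (fun _ _ => c), (fun _ _ => 1); split; [by move=> _; exact: regular_cst..|].
  by move=> x g; rewrite big_ord1 mulr1.
- exists 2%N, (fun l (x : G) => val x i l), (fun l (g : G) => val g l j).
  by split; [move=> l; exact: regular_coord..|move=> x g; exact: SL2_valM_entry].
- move=> [n [a [b [Ha Hb E]]]] [m [c [d [Hc Hd E']]]].
  exists (n + m)%N, (catf a c), (catf b d); split; [exact: catfP..|move=> x g].
  by rewrite (sum_catf (fun u v => u x * v g)) E E'.
- move=> [n [a [b [Ha Hb E]]]] [m [c [d [Hc Hd E']]]].
  pose pr (i : 'I_(n * m)) : 'I_n * 'I_m :=
    enum_val (cast_ord (esym (mxvec_cast n m)) i).
  exists (n * m)%N,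
    (fun i x => a (pr i).1 x * c (pr i).2 x),
    (fun i x => b (pr i).1 x * d (pr i).2 x).
  split; [by move=> i; exact: regularM..|move=> x g].
  rewrite E E' big_distrlr /= pair_bigA /=.
  rewrite (reindex pr) /=.
    by apply: eq_bigr => i _; rewrite mulrACA.
  exists (fun p : 'I_n * 'I_m => mxvec_index p.1 p.2) => [i _|p _].
    by case/mxvec_indexP: i => i j; rewrite /pr /mxvec_index cast_ordK enum_rankK.
  by case: p => i j; rewrite /pr /mxvec_index cast_ordK enum_rankK.
Qed.

(** ** Vector-valued regular maps *)

Section CoefficientMaps.
Variables (P : (G -> k) -> Prop) (M : lmodType k).
Implicit Types p q : G -> M.

(** For a space P of functions, the elements of the tensor product of P and M,
    kept as functions so that no tensor product has to be formed. *)
Definition vmap p :=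
  exists (n : nat) (f : 'I_n -> G -> k) (w : 'I_n -> M),
    (forall i, P (f i)) /\ forall g, p g = \sum_(i < n) f i g *: w i.

Lemma vmap_ext p q : vmap p -> p =1 q -> vmap q.
Proof. by move=> [n [f [w [Hf E]]]] pq; exists n, f, w; split=> // g; rewrite -pq. Qed.

Lemma vmap1 (f : G -> k) (w : M) : P f -> vmap (fun g => f g *: w).
Proof.
by move=> Hf; exists 1%N, (fun=> f), (fun=> w); split=> // g; rewrite big_ord1.
Qed.

Lemma vmapD p q : vmap p -> vmap q -> vmap (fun g => p g + q g).
Proof.
move=> [n [f [w [Hf E]]]] [m [h [v [Hh E']]]].
exists (n + m)%N, (catf f h), (catf w v); split; first exact: catfP.
by move=> g; rewrite (sum_catf (fun a u => a g *: u)) E E'.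
Qed.

Lemma vmap_comp (u : G -> G) : (forall f, P f -> P (fun g => f (u g))) ->
  forall p, vmap p -> vmap (fun g => p (u g)).
Proof.
move=> Hu p [n [f [w [Hf E]]]]; exists n, (fun i g => f i (u g)), w.
by split=> // i; exact: Hu.
Qed.

End CoefficientMaps.

Lemma vmap_lin (P : (G -> k) -> Prop) (M N : lmodType k) (L : {linear M -> N}) (p : G -> M) :
  vmap P p -> vmap P (fun g => L (p g)).
Proof.
move=> [n [f [w [Hf E]]]]; exists n, f, (fun i => L (w i)); split=> // g.
by rewrite E linear_sum; apply: eq_bigr => i _; rewrite linearZ.
Qed.

End RegularFunctions.

Notation rmap := (vmap (@regular _)).

Section RegularMaps.
Variable k : closedFieldType.
Local Notation G := (SL2 k).

Section Rmap.
Variable M : lmodType k.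
Implicit Types p q : G -> M.

Lemma rmap_cst (w : M) : rmap (fun=> w).
Proof. by apply: (vmap_ext (vmap1 w (regular_cst 1))) => g; rewrite scale1r. Qed.

Lemma rmapM (f : G -> k) p : regular f -> rmap p -> rmap (fun g => f g *: p g).
Proof.
move=> Hf [n [h [w [Hh E]]]]; exists n, (fun i g => f g * h i g), w.
split=> [i|g]; first exact: regularM.
by rewrite E scaler_sumr; apply: eq_bigr => i _; rewrite scalerA.
Qed.

Lemma rmapZ (c : k) p : rmap p -> rmap (fun g => c *: p g).
Proof. exact/rmapM/regular_cst. Qed.

Lemma rmap_sum (I : Type) (r : seq I) (p : I -> G -> M) :
  (forall i, rmap (p i)) -> rmap (fun g => \sum_(i <- r) p i g).
Proof.
move=> H; elim: r => [|i r IH].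
  by apply: (vmap_ext (rmap_cst 0)) => g; rewrite big_nil.
by apply: (vmap_ext (vmapD (H i) IH)) => g; rewrite big_cons.
Qed.

Lemma rmap_ind (P : (G -> M) -> Prop) :
  P (fun=> 0) -> (forall f w, regular f -> P (fun g => f g *: w)) ->
  (forall p q, P p -> P q -> P (fun g => p g + q g)) -> forall p, rmap p -> P p.
Proof.
move=> P0 P1 PD p [n [f [w [Hf E]]]].
rewrite (_ : p = fun g => \sum_(i < n) f i g *: w i); last exact/funext.
elim: (index_enum _) => [|i r IH].
  by rewrite (_ : (fun=> _) = fun=> 0) //; apply/funext => g; rewrite big_nil.
rewrite (_ : (fun=> _) = fun g => f i g *: w i + \sum_(j <- r) f j g *: w j).
  by apply: (PD) => //; exact: P1.
by apply/funext => g; rewrite big_cons.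
Qed.

(** The coefficients of a regular map with values in a subspace can be taken in
    that subspace: solve for the last coefficient at a point where its function
    is nonzero, and absorb it. *)
Lemma rmap_in (P : M -> Prop) :
  (forall a u v, P u -> P v -> P (a *: u + v)) ->
  forall p, rmap p -> (forall g, P (p g)) ->
  exists (n : nat) (f : 'I_n -> G -> k) (w : 'I_n -> M),
    [/\ forall i, regular (f i), forall i, P (w i) &
        forall g, p g = \sum_(i < n) f i g *: w i].
Proof.
move=> Plin p [n [f [w [Hf E]]]] Pp.
have P0 : P 0 by have := Plin (-1) _ _ (Pp 1%g) (Pp 1%g); rewrite scaleN1r addNr.
elim: n f w p Hf E Pp => [|n IH] f w p Hf E Pp.
  by exists 0%N, f, w; split=> // -[].
have [Hz|/existsNP[g0 /eqP Hg0]] := pselect (forall g, f ord_max g = 0).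
  apply: (IH (fun i => f (widen_ord (leqnSn n) i)) (fun i => w (widen_ord (leqnSn n) i))) => //.
  by move=> g; rewrite E big_ord_recr /= Hz scale0r addr0.
set c := (f ord_max g0)^-1.
pose q g := p g - (c * f ord_max g) *: p g0.
have [||g|m [h [v [Hh Pv Eq]]]] := IH
  (fun i g => f (widen_ord (leqnSn n) i) g +
     - (c * f ord_max g * f (widen_ord (leqnSn n) i) g0))
  (fun i => w (widen_ord (leqnSn n) i)) q.
- move=> i; apply: regularD => //.
  rewrite (_ : (fun=> _) = fun g => - (c * f (widen_ord (leqnSn n) i) g0) * f ord_max g).
    by apply: regularM => //; exact: regular_cst.
  by apply/funext => g; rewrite mulNr mulrAC.
- move=> g; rewrite /q E (E g0) !big_ord_recr /= scalerDr scalerA.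
  rewrite -mulrA [f ord_max g * _]mulrC mulrA /c mulVf // mul1r.
  rewrite opprD [- _ - _]addrC addrA addrK scaler_sumr -sumrB.
  by apply: eq_bigr => i _; rewrite scalerA scalerDl scaleNr.
- by rewrite /q addrC -scaleNr; exact: Plin.
exists m.+1, (fun i => match unlift ord_max i with Some j => h j
    | None => fun g => c * f ord_max g end),
  (fun i => match unlift ord_max i with Some j => v j | None => p g0 end).
split.
- move=> i; case: (unlift ord_max i) => [j|] //.
  by apply: regularM => //; exact: regular_cst.
- by move=> i; case: (unlift ord_max i).
move=> g; rewrite big_ord_recr /= unlift_none.
rewrite (eq_bigr (fun i => h i g *: v i)); last first.
  move=> i _; rewrite (_ : widen_ord _ i = lift ord_max i); first by rewrite liftK.
  by apply/val_inj; rewrite /= /bump leqNgt ltn_ord.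
by rewrite -Eq /q subrK.
Qed.

End Rmap.

End RegularMaps.

(** * Polynomial maps of one variable *)

Section PolynomialMaps.
Variables (k : closedFieldType) (M : lmodType k).

(** Coefficients in a vector space without a basis are separated by rescaling
    the variable. Nonzero parameters suffice, so that the lemma applies to the
    torus. *)
Lemma sum_pow_inj (n : nat) (c : nat -> M) :
  (forall t : k, t != 0 -> \sum_(i < n) t ^+ i *: c i = 0) ->
  forall i, (i < n)%N -> c i = 0.
Proof.
elim: n c => [//|n IH] c H.
have [u Hu] : exists u : k, u != 0 /\ forall i, (i < n)%N -> u ^+ i != u ^+ n.
  pose P : {poly k} := 'X * \prod_(i < n) ('X^i - 'X^n).
  have /closed_nonrootP[u] : P != 0.
    rewrite mulf_neq0 ?polyX_eq0 //; apply/prodf_neq0 => i _.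
    apply/eqP => /(congr1 (fun p : {poly k} => p`_i)) /eqP.
    by rewrite coefB !coefXn eqxx coef0 (ltn_eqF (ltn_ord i)) subr0 oner_eq0.
  rewrite /root /P hornerM hornerX mulf_eq0 negb_or => /andP[u0].
  rewrite horner_prod => /prodf_neq0 Hp; exists u; split=> // i Hi.
  by have := Hp (Ordinal Hi) isT; rewrite !hornerE subr_eq0.
have {Hu}[u0 Hu] := Hu.
(* The combination f(ut) - u^n f(t) has no term of degree n. *)
have Hlow i : (i < n)%N -> c i = 0.
  move=> Hi; have /(_ i Hi)/eqP : forall i, (i < n)%N -> (u ^+ i - u ^+ n) *: c i = 0.
    apply: IH => t t0.
    have : \sum_(j < n.+1) (t ^+ j *: ((u ^+ j - u ^+ n) *: c j)) = 0.
      transitivity (\sum_(j < n.+1) (u * t) ^+ j *: c j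
                    - u ^+ n *: \sum_(j < n.+1) t ^+ j *: c j).
        rewrite scaler_sumr -sumrB; apply: eq_bigr => j _.
        by rewrite !scalerA exprMn -scalerBl mulrBr mulrC [t ^+ j * u ^+ n]mulrC.
      by rewrite !H ?mulf_neq0 // scaler0 subr0.
    by rewrite big_ord_recr /= subrr scale0r scaler0 addr0.
  by rewrite scaler_eq0 subr_eq0 (negPf (Hu _ Hi)) => /eqP.
move=> i; rewrite ltnS leq_eqVlt => /orP[/eqP->|]; last exact: Hlow.
have := H 1 (oner_neq0 _); rewrite big_ord_recr /= expr1n scale1r big1 ?add0r // => j _.
by rewrite Hlow ?scaler0.
Qed.

Definition polyn (p : k -> M) :=
  exists (n : nat) (c : nat -> M), forall t, p t = \sum_(i < n) t ^+ i *: c i.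

Lemma polyn_pad p n (c : nat -> M) N :
  (forall t, p t = \sum_(i < n) t ^+ i *: c i) -> (n <= N)%N ->
  forall t, p t = \sum_(i < N) t ^+ i *: (if (i < n)%N then c i else 0).
Proof.
move=> E nN t; rewrite E (big_ord_widen N (fun i => t ^+ i *: c i) nN) big_mkcond.
by apply: eq_bigr => i _; case: ifP => //; rewrite scaler0.
Qed.

Lemma polyn_ext p q : polyn p -> p =1 q -> polyn q.
Proof. by move=> [n [c E]] pq; exists n, c => t; rewrite -pq. Qed.

Lemma polyn_cst w : polyn (fun=> w).
Proof. by exists 1%N, (fun=> w) => t; rewrite big_ord1 scale1r. Qed.

Lemma polynD p q : polyn p -> polyn q -> polyn (fun t => p t + q t).
Proof.
move=> [n [c E]] [m [d E']].
exists (maxn n m), (fun i => (if (i < n)%N then c i else 0) + (if (i < m)%N then d i else 0)).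
move=> t; rewrite (polyn_pad E (leq_maxl n m)) (polyn_pad E' (leq_maxr n m)) -big_split.
by apply: eq_bigr => i _; rewrite scalerDr.
Qed.

Lemma polynZ a p : polyn p -> polyn (fun t => a *: p t).
Proof.
move=> [n [c E]]; exists n, (fun i => a *: c i) => t.
by rewrite E scaler_sumr; apply: eq_bigr => i _; rewrite !scalerA mulrC.
Qed.

Lemma polynX p : polyn p -> polyn (fun t => t *: p t).
Proof.
move=> [n [c E]]; exists n.+1, (fun i => if i is j.+1 then c j else 0) => t.
rewrite big_ord_recl scaler0 add0r E scaler_sumr; apply: eq_bigr => i _.
by rewrite scalerA -exprS.
Qed.

Lemma polynXn e p : polyn p -> polyn (fun t => t ^+ e *: p t).
Proof.
move=> Hp; elim: e => [|e IH].
  by apply: (polyn_ext Hp) => t; rewrite scale1r.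
by apply: (polyn_ext (polynX IH)) => t; rewrite scalerA exprS.
Qed.

Lemma polyn_sum (I : Type) (r : seq I) (p : I -> k -> M) :
  (forall i, polyn (p i)) -> polyn (fun t => \sum_(i <- r) p i t).
Proof.
move=> H; elim: r => [|i r IH].
  by apply: (polyn_ext (polyn_cst 0)) => t; rewrite big_nil.
by apply: (polyn_ext (polynD (H i) IH)) => t; rewrite big_cons.
Qed.

Lemma polyn_horner (q : {poly k}) w : polyn (fun t => q.[t] *: w).
Proof.
exists (size q), (fun i => q`_i *: w) => t.
by rewrite horner_coef scaler_suml; apply: eq_bigr => i _; rewrite scalerA mulrC.
Qed.

(** The way in which the Frobenius map is exploited throughout: the row
    operation with parameter t changes x linearly in t, but changes the
    Frobenius image of x only through t^2. *)
Lemma even_odd_inj (p q : k -> M) : polyn p -> polyn q ->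
  (forall t, t != 0 -> p (t ^+ 2) + t *: q (t ^+ 2) = 0) ->
  forall t, p t = 0 /\ q t = 0.
Proof.
move=> [n [c E]] [m [d E']] H.
have {}E := polyn_pad E (leq_maxl n m); have {}E' := polyn_pad E' (leq_maxr n m).
set c' := fun i => if (i < n)%N then c i else 0; set d' := fun i => if (i < m)%N then d i else 0.
set N := maxn n m in E E'.
pose e i := if odd i then d' i./2 else c' i./2.
have Hsum L t : \sum_(i < L.*2) t ^+ i *: e i =
    \sum_(i < L) (t ^+ 2) ^+ i *: c' i + t *: \sum_(i < L) (t ^+ 2) ^+ i *: d' i.
  elim: L => [|L IH]; first by rewrite !big_ord0 scaler0 addr0.
  rewrite doubleS !big_ord_recr /= IH /e /= !odd_double /= doubleK uphalf_double.
  rewrite -!exprM mul2n scalerDr scalerA -exprS -!addrA; congr (_ + _).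
  by rewrite addrCA.
have He := @sum_pow_inj N.*2 e.
have {}He i : (i < N.*2)%N -> e i = 0.
  by apply: He => t t0; rewrite -[RHS](H t t0) Hsum E E'.
move=> t; rewrite E E'; split; apply: big1 => i _.
  have := He i.*2; rewrite /e odd_double doubleK ltn_double => /(_ (ltn_ord i)).
  by rewrite /c' => ->; rewrite scaler0.
have := He i.*2.+1; rewrite /e /= odd_double uphalf_double /= ltn_Sdouble => /(_ (ltn_ord i)).
by rewrite /d' => ->; rewrite scaler0.
Qed.

End PolynomialMaps.

Lemma sum_pow_injk (k : closedFieldType) (n : nat) (c : nat -> k) :
  (forall t : k, t != 0 -> \sum_(i < n) t ^+ i * c i = 0) ->
  forall i, (i < n)%N -> c i = 0.
Proof. exact: (@sum_pow_inj k k^o). Qed.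

(** * One-parameter subgroups and the Frobenius map *)

Section OneParameter.
Variable k : closedFieldType.
Local Notation G := (SL2 k).

Lemma ord2P (i : 'I_2) : i = 0 \/ i = 1.
Proof. by case: i => [[|[|//]] Hi]; [left|right]; apply/val_inj. Qed.

Lemma sum_ord2 (V : nmodType) (f : 'I_2 -> V) : \sum_i f i = f 0 + f 1.
Proof. by rewrite big_ord_recl big_ord1; congr (f _ + f _); apply/val_inj. Qed.

Definition other (i : 'I_2) : 'I_2 := 1 - i.

Lemma det2 (A : 'M[k]_2) : \det A = A 0 0 * A 1 1 - A 0 1 * A 1 0.
Proof.
rewrite (expand_det_row _ 0) sum_ord2 /cofactor !det_mx11 !mxE /=.
rewrite (_ : lift 0 0 = 1); last exact/val_inj.
rewrite (_ : lift 1 0 = 0); last exact/val_inj.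
by rewrite addn0 add0n expr0 expr1 mul1r mulN1r mulrN.
Qed.

Definition mx2 (a b c d : k) : 'M[k]_2 :=
  \matrix_(i, j) if i == 0 then (if j == 0 then a else b) else (if j == 0 then c else d).

Lemma det_mx2 a b c d : \det (mx2 a b c d) = a * d - b * c.
Proof. by rewrite det2 !mxE. Qed.

Lemma SL2_det (g : G) : val g 0 0 * val g 1 1 - val g 0 1 * val g 1 0 = 1.
Proof. by rewrite -det2 (eqP (valP g)). Qed.

Fact sl2_subproof a b c d : a * d - b * c = 1 -> \det (mx2 a b c d) == 1.
Proof. by rewrite det_mx2 => ->. Qed.

Definition sl2 a b c d (H : a * d - b * c = 1) : G := MkSL2 (sl2_subproof H).

Fact elem_subproof (i : 'I_2) (s : k) : \det (1%:M + s *: delta_mx i (other i)) == 1.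
Proof.
rewrite det2 !mxE /other; case: (ord2P i) => ->; rewrite ?subr0 ?subrr /=.
  by rewrite !mulr0 !addr0 mulr0 mulr1 subr0.
by rewrite !mulr0 !addr0 mul0r mulr1 subr0.
Qed.

(** The root subgroups: row operations adding a multiple of one row to the
    other. *)
Definition elem i s : G := MkSL2 (elem_subproof i s).

Lemma elem_mul i s (x : G) l : val (elem i s * x)%g i l = val x i l + s * val x (other i) l.
Proof.
rewrite SL2_valM /= mulmxDl mul1mx mxE -scalemxAl mxE; congr (_ + _ * _).
rewrite mxE (bigD1 (other i)) //= !mxE !eqxx mul1r big1 ?addr0 // => j Hj.
by rewrite !mxE (negPf Hj) andbF mul0r.
Qed.

Lemma elem_mul_other i s (x : G) l : val (elem i s * x)%g (other i) l = val x (other i) l.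
Proof.
rewrite SL2_valM /= mulmxDl mul1mx mxE -scalemxAl mxE mxE big1 ?mulr0 ?addr0 // => j _.
by rewrite !mxE (_ : other i == i = false) ?mul0r //; case: (ord2P i) => ->.
Qed.

Fact torus_subproof (t : k) : \det (mx2 (if t == 0 then 1 else t) 0 0
   (if t == 0 then 1 else t^-1)) == 1.
Proof. by rewrite det_mx2 mulr0 subr0; case: (eqVneq t 0) => [_|t0]; [rewrite mulr1|rewrite divff]. Qed.

(** The diagonal torus, extended by the value 1 at t = 0 to be total. *)
Definition torus (t : k) : G := MkSL2 (torus_subproof t).

Lemma torus_mul0 t (x : G) l : t != 0 -> val (torus t * x)%g 0 l = t * val x 0 l.
Proof. by move=> /negPf t0; rewrite SL2_valM_entry sum_ord2 /= !mxE /= t0 mul0r addr0. Qed.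

Lemma torus_mul1 t (x : G) l : t != 0 -> val (torus t * x)%g 1 l = t^-1 * val x 1 l.
Proof. by move=> /negPf t0; rewrite SL2_valM_entry sum_ord2 /= !mxE /= t0 mul0r add0r. Qed.

Lemma torus1 : torus 1 = 1%g.
Proof.
apply/val_inj; rewrite /= oner_eq0 invr1; apply/matrixP => i j; rewrite !mxE.
by case: (ord2P i) => ->; case: (ord2P j) => ->.
Qed.

Lemma regular_elem (f : G -> k) i x : regular f ->
  exists q : {poly k}, forall s, f (elem i s * x)%g = q.[s].
Proof.
move: f; apply: regular_ind => [c|a b|f h [q Hq] [r Hr]|f h [q Hq] [r Hr]].
- by exists c%:P => s; rewrite hornerC.
- have [->|->] : a = i \/ a = other i.
    by case: (ord2P i) => ->; case: (ord2P a) => ->; [left|right|right|left]; apply/val_inj.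
  + exists ((val x i b)%:P + 'X * (val x (other i) b)%:P) => s.
    by rewrite elem_mul !hornerE.
  + by exists (val x (other i) b)%:P => s; rewrite elem_mul_other hornerE.
- by exists (q + r) => s; rewrite hornerD Hq Hr.
- by exists (q * r) => s; rewrite hornerM Hq Hr.
Qed.

Lemma rmap_elem (M : lmodType k) (p : G -> M) i x : rmap p -> polyn (fun s => p (elem i s * x)%g).
Proof.
move: p; apply: rmap_ind => [|f w Hf|p q].
- exact: polyn_cst.
- have [q Hq] := regular_elem i x Hf.
  by apply: (polyn_ext (polyn_horner q w)) => t; rewrite Hq.
- exact: polynD.
Qed.

Hypothesis hk : 2%N \in [pchar k].

Lemma scale_char2 (M : lmodType k) (v : M) : v + v = 0.
Proof. by rewrite -mulr2n -scaler_nat (pcharf0 hk) scale0r. Qed.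

Lemma opp_char2 (M : lmodType k) (v : M) : - v = v.
Proof. by apply/eqP; rewrite eq_sym -subr_eq0 opprK scale_char2. Qed.

Lemma oppk_char2 (a : k) : - a = a. Proof. exact: (@opp_char2 k^o). Qed.

Lemma SL2_det_char2 (g : G) : val g 0 0 * val g 1 1 + val g 0 1 * val g 1 0 = 1.
Proof. by rewrite -[RHS](SL2_det g) oppk_char2. Qed.

Fact frob_subproof (g : G) : \det (map_mx (pFrobenius_aut hk) (val g)) == 1.
Proof. by rewrite det_map_mx (eqP (valP g)) rmorph1. Qed.

Definition frob (g : G) : G := MkSL2 (frob_subproof g).

Lemma frobE g i j : val (frob g) i j = val g i j ^+ 2.
Proof. by rewrite /= mxE pFrobenius_autE. Qed.

Lemma frobM g h : frob (g * h)%g = (frob g * frob h)%g.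
Proof. by apply/val_inj; rewrite /= map_mxM. Qed.

Lemma frob1 : frob 1%g = 1%g.
Proof. by apply/val_inj; rewrite /= map_mx1. Qed.

Lemma frob_elem i s : frob (elem i s) = elem i (s ^+ 2).
Proof.
apply/val_inj/matrixP => a b; rewrite frobE /= !mxE.
by rewrite -!(pFrobenius_autE hk) rmorphD rmorphM !rmorph_nat.
Qed.

Lemma sqrt_ex (a : k) : exists b, b ^+ 2 = a.
Proof.
have [b Hb] := @solve_monicpoly k 2 (nth 0 [:: a; 0]) isT.
by exists b; rewrite Hb !big_ord_recl big_ord0 /= expr0 mulr1 mul0r !addr0.
Qed.

Lemma sqr_inj_char2 (a b : k) : a ^+ 2 = b ^+ 2 -> a = b.
Proof. by rewrite -!(pFrobenius_autE hk); exact: fmorph_inj. Qed.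

Lemma frob_surj g : exists h, frob h = g.
Proof.
have [a Ha] := sqrt_ex (val g 0 0); have [b Hb] := sqrt_ex (val g 0 1).
have [c Hc] := sqrt_ex (val g 1 0); have [d Hd] := sqrt_ex (val g 1 1).
have H : a * d - b * c = 1.
  apply: sqr_inj_char2; rewrite expr1n -(pFrobenius_autE hk) rmorphB !rmorphM.
  by rewrite /= !(pFrobenius_autE hk) Ha Hb Hc Hd SL2_det.
exists (sl2 H); apply/val_inj/matrixP => i j; rewrite frobE /= mxE.
by case: (ord2P i) => ->; case: (ord2P j) => -> /=.
Qed.

Lemma regular_frob (f : G -> k) : regular f -> regular (fun g => f (frob g)).
Proof.
apply: regular_comp => i j.
rewrite (_ : (fun=> _) = fun g : G => val g i j * val g i j).
  by apply: regularM; exact: regular_coord.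
by apply/funext => g; rewrite frobE.
Qed.

Lemma rmap_frob (M : lmodType k) (p : G -> M) : rmap p -> rmap (fun g => p (frob g)).
Proof. exact: vmap_comp regular_frob _. Qed.

End OneParameter.

(** * Subspaces given by propositions *)

Section Subspaces.
Variables (k : closedFieldType) (V : lmodType k).

(** Membership in the subspaces below is an arbitrary proposition; a classical
    decision turns them into subtypes that carry a vector space structure. *)
Record subsp := Subsp {
  sp_pred :> V -> Prop;
  sp_pred0 : sp_pred 0;
  sp_lin : forall a u v, sp_pred u -> sp_pred v -> sp_pred (a *: u + v)
}.

Definition sp_mem (S : subsp) : {pred V} := fun v => `[< S v >].

Fact sp_closed S : submod_closed (sp_mem S).
Proof.
split; first exact/asboolP/sp_pred0.
by move=> a u v /asboolP Hu /asboolP Hv; apply/asboolP/sp_lin.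
Qed.

HB.instance Definition _ S := GRing.isSubmodClosed.Build k V (sp_mem S)
  (GRing.submod_closed_semi (sp_closed S)).

Definition subT (S : subsp) := {v : V | v \in sp_mem S}.

HB.instance Definition _ S := SubChoice.on (subT S).
HB.instance Definition _ S := [SubChoice_isSubLmodule of subT S by <:].

Section SubT.
Variable S : subsp.

Definition mksub v (H : S v) : subT S := exist _ v (asboolT H).

Lemma subP (u : subT S) : S (val u).
Proof. by case: u => v Hv; exact: (asboolW Hv). Qed.

Lemma sub_inj (u v : subT S) : val u = val v -> u = v.
Proof. exact: val_inj. Qed.

Lemma val_suml (I : Type) (r : seq I) (u : I -> subT S) :
  val (\sum_(i <- r) u i) = \sum_(i <- r) val (u i).
Proof. exact: raddf_sum. Qed.

End SubT.
End Subspaces.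

(** * Rational modules and their homomorphisms *)

Section Modules.
Variable k : closedFieldType.
Local Notation G := (SL2 k).
Local Notation ratmod := (rational_module k).

Section Act.
Variable M : ratmod.

Lemma actD (g : G) (u v : M) : act g (u + v) = act g u + act g v.
Proof. by have := act_linear g 1 u v; rewrite !scale1r. Qed.
Lemma act0 (g : G) : act g (0 : M) = 0.
Proof. by apply: (@addIr _ (act g 0)); rewrite -actD !add0r. Qed.
Lemma actZ (g : G) a (u : M) : act g (a *: u) = a *: act g u.
Proof. by have := act_linear g a u 0; rewrite !addr0 act0 addr0. Qed.
Lemma actN (g : G) (u : M) : act g (- u) = - act g u.
Proof. by rewrite -scaleN1r actZ scaleN1r. Qed.
Lemma actB (g : G) (u v : M) : act g (u - v) = act g u - act g v.
Proof. by rewrite actD actN. Qed.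
Lemma act_sum (g : G) (I : Type) (r : seq I) (u : I -> M) :
  act g (\sum_(i <- r) u i) = \sum_(i <- r) act g (u i).
Proof. by apply: (big_morph (act g)); [exact: actD|exact: act0]. Qed.

Lemma rmap_orbit (v : M) : rmap (fun g => act g v).
Proof. exact: act_rational. Qed.

Definition inv (v : M) := forall g : G, act g v = v.

End Act.

Section Build.
Variables (M N : ratmod).

Definition lin_of (U W : lmodType k) (f : U -> W) (Hf : linear f) : {linear U -> W} :=
  HB.pack f (GRing.isLinear.Build k U W _ f Hf).

Definition hom_of (f : M -> N) (Hf : linear f)
  (Ha : forall g v, f (act g v) = act g (f v)) : rational_hom M N :=
  @RationalHom k M N (lin_of Hf) Ha.

Lemma rel_uniq (U W : lmodType k) (R : U -> W -> Prop) :
  (forall a u v y z, R u y -> R v z -> R (a *: u + v) (a *: y + z)) ->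
  (forall y, R 0 y -> y = 0) -> forall v y z, R v y -> R v z -> y = z.
Proof.
move=> Rl R0 v y z Hy Hz.
have := R0 _ (eq_rect _ (R^~ (-1 *: y + z)) (Rl (-1) _ _ _ _ Hy Hz) 0 _).
rewrite !scaleN1r addNr => /(_ erefl) /eqP.
by rewrite addrC subr_eq0 => /eqP.
Qed.

(** The projections below come from decompositions of elements that exist but
    involve choices. Stated as a relation, linearity is immediate, and the choices
    are harmless once the decomposition of 0 is unique. *)
Lemma rel_lin (U W : lmodType k) (R : U -> W -> Prop) :
  (forall v, exists y, R v y) ->
  (forall a u v y z, R u y -> R v z -> R (a *: u + v) (a *: y + z)) ->
  (forall y, R 0 y -> y = 0) -> exists h : {linear U -> W}, forall v, R v (h v).
Proof.
move=> Rt Rl R0; pose f v := projT1 (cid (Rt v)).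
have Hf v : R v (f v) by rewrite /f; case: cid.
have Hl : linear f by move=> a u v; apply: (rel_uniq Rl R0 (Hf _)); exact: Rl.
by exists (lin_of Hl).
Qed.

Lemma rel_hom (R : M -> N -> Prop) :
  (forall v, exists y, R v y) ->
  (forall a u v y z, R u y -> R v z -> R (a *: u + v) (a *: y + z)) ->
  (forall y, R 0 y -> y = 0) ->
  (forall g v y, R v y -> R (act g v) (act g y)) ->
  exists h : rational_hom M N, forall v, R v (h v).
Proof.
move=> Rt Rl R0 Ra; have [h Hh] := rel_lin Rt Rl R0.
have Ha g v : h (act g v) = act g (h v).
  by apply: (rel_uniq Rl R0 (Hh _)); exact: Ra.
by exists (@RationalHom k M N h Ha).
Qed.

End Build.

Definition hom_id (M : ratmod) : rational_hom M M :=
  @hom_of M M id (fun _ _ _ => erefl) (fun _ _ => erefl).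

Section Comp.
Variables (L M N : ratmod) (b : rational_hom M N) (a : rational_hom L M).

Fact comp_linear : linear (fun v => b (a v)).
Proof. by move=> c u v; rewrite !linearP. Qed.
Fact comp_act g v : b (a (act g v)) = act g (b (a v)).
Proof. by rewrite !hom_act. Qed.
Definition hom_comp := hom_of comp_linear comp_act.
End Comp.

(** ** Coinduced modules *)

Lemma rmap_comul (N : lmodType k) (p : G -> N) : rmap p ->
  exists (n : nat) (b : 'I_n -> G -> k) (a : 'I_n -> G -> N),
    [/\ forall i, regular (b i), forall i, rmap (a i) &
        forall x g, p (x * g)%g = \sum_i b i g *: a i x].
Proof.
move: p; apply: rmap_ind => [|f w Hf|p q [n [b [a [Hb Ha E]]]] [m [d [c [Hd Hc E']]]]].
- exists 0%N, (fun _ _ => 0), (fun _ _ => 0); split=> [[]//|[]//|x g].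
  by rewrite big_ord0.
- have [n [a [b [Ha Hb E]]]] := regular_comul Hf.
  exists n, b, (fun i x => a i x *: w); split=> // [i|x g]; first exact: vmap1.
  by rewrite E scaler_suml; apply: eq_bigr => i _; rewrite scalerA mulrC.
exists (n + m)%N, (catf b d), (catf a c); split; [exact: catfP..|move=> x g].
by rewrite (sum_catf (fun u v => u g *: v x)) E E'.
Qed.

Lemma rmap_mulr (N : lmodType k) (g : G) (p : G -> N) :
  rmap p -> rmap (fun x => p (x * g)%g).
Proof. exact: vmap_comp (@regular_mulr k g) _. Qed.

Section Co.
Variable N : lmodType k.

Fact co_lin a (p q : G -> N) : rmap p -> rmap q -> rmap (a *: p + q).
Proof. by move=> Hp Hq; apply: vmapD => //; exact: rmapZ. Qed.

Definition co_sp : subsp (G -> N) := Subsp (rmap_cst 0) co_lin.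

Definition co_act (g : G) (f : subT co_sp) : subT co_sp :=
  mksub (S := co_sp) (rmap_mulr g (subP f)).

Fact co_act_linear g : linear (co_act g).
Proof. by move=> a u v; apply/sub_inj. Qed.
Fact co_act1 v : co_act 1%g v = v.
Proof. by apply/sub_inj/funext => x; rewrite /= mulg1. Qed.
Fact co_actM g h v : co_act (g * h)%g v = co_act g (co_act h v).
Proof. by apply/sub_inj/funext => x; rewrite /= mulgA. Qed.
Fact co_act_rational v : rmap (fun g => co_act g v).
Proof.
have [n [b [a [Hb Ha E]]]] := rmap_comul (subP v).
exists n, b, (fun i => mksub (S := co_sp) (Ha i)); split=> // g.
apply/sub_inj/funext => x; rewrite val_suml fct_sumE.
by rewrite /= E; apply: eq_bigr => i _.
Qed.

(** The module coinduced from a vector space. *)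
Definition coMod : ratmod :=
  RationalModule co_act_linear co_act1 co_actM co_act_rational.

Definition mkco (p : G -> N) (Hp : rmap p) : coMod := mksub (S := co_sp) Hp.
Definition coval (f : coMod) : G -> N := val (f : subT co_sp).

Lemma mkcoE (p : G -> N) (Hp : rmap p) x : coval (mkco Hp) x = p x. Proof. by []. Qed.
Lemma co_inj (f h : coMod) : coval f =1 coval h -> f = h.
Proof. by move=> H; apply/sub_inj/funext. Qed.
Lemma coP (f : coMod) : rmap (coval f). Proof. exact: (subP (f : subT co_sp)). Qed.
Lemma co_linE a (f h : coMod) x : coval (a *: f + h) x = a *: coval f x + coval h x.
Proof. by []. Qed.
Lemma co_actE g (f : coMod) x : coval (act g f) x = coval f (x * g)%g.
Proof. by []. Qed.

End Co.

Section Q.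
Variable M : ratmod.

Fact eta_linear : linear (fun v : M => mkco (rmap_orbit v)).
Proof. by move=> a u v; apply/co_inj => x; rewrite co_linE /coval /= actD actZ. Qed.
Fact eta_act g v : mkco (@rmap_orbit M (act g v)) = act g (mkco (rmap_orbit v)).
Proof. by apply/co_inj => x; rewrite co_actE /coval /= actM. Qed.
Definition eta : rational_hom M (coMod M) := hom_of eta_linear eta_act.
Lemma etaE v x : coval (eta v) x = act x v. Proof. by []. Qed.

Definition qpred (p : G -> M) := rmap p /\ p 1%g = 0.
Fact q_lin a p q : qpred p -> qpred q -> qpred (a *: p + q).
Proof.
move=> [Hp Ep] [Hq Eq]; split; first exact: co_lin.
by rewrite -[LHS]/(a *: p 1%g + q 1%g) Ep Eq scaler0 addr0.
Qed.
Definition q_sp : subsp (G -> M) := Subsp (conj (rmap_cst 0) erefl) q_lin.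

Fact q_act_subproof (g : G) (p : G -> M) : rmap p ->
  qpred (fun x => p (x * g)%g - act x (p g)).
Proof.
move=> Hp; split; last by rewrite mul1g act1 subrr.
apply: vmapD; first exact: rmap_mulr.
by apply: (vmap_ext (rmapZ (-1) (@rmap_orbit M (p g)))) => x; rewrite scaleN1r.
Qed.

(** The quotient action on regular maps modulo orbit maps, on the
    representatives that vanish at 1: translate, then subtract the orbit map of
    the value at 1. *)
Definition q_act g (f : subT q_sp) : subT q_sp :=
  mksub (S := q_sp) (q_act_subproof g (proj1 (subP f))).

Fact q_act_linear g : linear (q_act g).
Proof.
move=> a u v; apply/sub_inj/funext => x.
rewrite -[RHS]/(a *: (val u (x * g)%g - act x (val u g)) + (val v (x * g)%g - act x (val v g))).
rewrite -[LHS]/(a *: val u (x * g)%g + val v (x * g)%g - act x (a *: val u g + val v g)).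
by rewrite actD actZ scalerBr opprD addrACA.
Qed.
Fact q_act1 v : q_act 1%g v = v.
Proof.
apply/sub_inj/funext => x; rewrite /= mulg1.
by have [_ ->] := subP v; rewrite act0 subr0.
Qed.
Fact q_actM g h v : q_act (g * h)%g v = q_act g (q_act h v).
Proof.
apply/sub_inj/funext => x; rewrite /= mulgA actB -actM.
by rewrite opprB addrA subrK.
Qed.
Fact q_act_rational v : rmap (fun g => q_act g v).
Proof.
have [Hv v1] := subP v.
have [n [b [a [Hb Ha E]]]] := rmap_comul Hv.
have [m [f [w [Hf Ef]]]] := Hv.
have HA i : qpred (fun x => a i x - a i 1%g).
  split; last by rewrite subrr.
  by apply: vmapD => //; exact: rmap_cst.
have HB j : qpred (fun x => w j - act x (w j)).
  split; last by rewrite act1 subrr.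
  apply: vmapD; first exact: rmap_cst.
  by apply: (vmap_ext (rmapZ (-1) (@rmap_orbit M (w j)))) => x; rewrite scaleN1r.
exists (n + m)%N, (catf b f),
  (catf (fun i => mksub (S := q_sp) (HA i)) (fun j => mksub (S := q_sp) (HB j))).
split; first exact: catfP.
move=> g; apply/sub_inj/funext => x; rewrite val_suml fct_sumE big_split_ord /=.
transitivity (\sum_i b i g *: (a i x - a i 1%g) + \sum_j f j g *: (w j - act x (w j))).
  rewrite (eq_bigr (fun i => b i g *: a i x - b i g *: a i 1%g)); last first.
    by move=> i _; rewrite scalerBr.
  rewrite [X in _ = _ + X](eq_bigr (fun j => f j g *: w j - act x (f j g *: w j))); last first.
    by move=> j _; rewrite scalerBr actZ.
  by rewrite !sumrB -act_sum -!E -Ef mul1g addrA subrK.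
congr (_ + _); apply: eq_bigr => i _; first by rewrite !catfl.
by rewrite !catfr.
Qed.

(** The cokernel of [eta]. The maps that vanish at 1 represent it without
    forming a quotient, so that its elements can be evaluated. *)
Definition Q : ratmod := RationalModule q_act_linear q_act1 q_actM q_act_rational.

Definition mkq (p : G -> M) (Hp : rmap p) (p1 : p 1%g = 0) : Q :=
  mksub (S := q_sp) (conj Hp p1).
Definition qval (f : Q) : G -> M := val (f : subT q_sp).
Lemma mkqE (p : G -> M) (Hp : rmap p) (p1 : p 1%g = 0) x : qval (mkq Hp p1) x = p x.
Proof. by []. Qed.
Lemma q_inj (f h : Q) : qval f =1 qval h -> f = h.
Proof. by move=> H; apply/sub_inj/funext. Qed.
Lemma qP (f : Q) : rmap (qval f). Proof. exact: (proj1 (subP (f : subT q_sp))). Qed.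
Lemma q1 (f : Q) : qval f 1%g = 0. Proof. exact: (proj2 (subP (f : subT q_sp))). Qed.
Lemma q_linE a (f h : Q) x : qval (a *: f + h) x = a *: qval f x + qval h x.
Proof. by []. Qed.
Lemma q_actE g (f : Q) x : qval (act g f) x = qval f (x * g)%g - act x (qval f g).
Proof. by []. Qed.

Fact delta_subproof (v : M) : rmap (fun x => act x v - v).
Proof. by apply: vmapD; [exact: rmap_orbit|exact: rmap_cst]. Qed.
Fact delta1 (v : M) : act 1%g v - v = 0. Proof. by rewrite act1 subrr. Qed.
Fact delta_linear : linear (fun v : M => mkq (delta_subproof v) (delta1 v)).
Proof.
move=> a u v; apply/q_inj => x; rewrite q_linE /qval /= actD actZ scalerBr.
by rewrite opprD addrACA.
Qed.
(** An invariant of Q M is a crossed homomorphism f : G -> M, that is,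
    f (x g) = f x + x (f g); these are the principal ones. *)
Definition delta : {linear M -> Q} := lin_of delta_linear.
Lemma deltaE v x : qval (delta v) x = act x v - v. Proof. by []. Qed.

Lemma delta_eq0 v : delta v = 0 <-> inv v.
Proof.
split=> [E g|Hv]; last first.
  by apply/q_inj => x; rewrite deltaE Hv subrr.
apply/eqP; rewrite -subr_eq0 -deltaE E; exact/eqP.
Qed.

Lemma delta_inv v : inv (delta v).
Proof.
move=> g; apply/q_inj => x; rewrite q_actE !deltaE actB -actM.
by rewrite opprB addrC addrA subrK.
Qed.

Fact quo_subproof (f : coMod M) : rmap (fun x => coval f x - act x (coval f 1%g)).
Proof.
apply: vmapD; first exact: coP.
by apply: (vmap_ext (rmapZ (-1) (@rmap_orbit M (coval f 1%g)))) => x; rewrite scaleN1r.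
Qed.
Fact quo1 (f : coMod M) : coval f 1%g - act 1%g (coval f 1%g) = 0.
Proof. by rewrite act1 subrr. Qed.
Fact quo_linear : linear (fun f => mkq (quo_subproof f) (quo1 f)).
Proof.
move=> a u v; apply/q_inj => x; rewrite q_linE /qval /= !co_linE actD actZ scalerBr.
by rewrite opprD addrACA.
Qed.
Fact quo_act g f : mkq (quo_subproof (act g f)) (quo1 (act g f)) =
  act g (mkq (quo_subproof f) (quo1 f)).
Proof.
apply/q_inj => x; rewrite q_actE /qval /= !co_actE mul1g actB -actM.
by rewrite opprB addrA subrK.
Qed.
Definition quo : rational_hom (coMod M) Q := hom_of quo_linear quo_act.
Lemma quoE f x : qval (quo f) x = coval f x - act x (coval f 1%g). Proof. by []. Qed.

End Q.

Section Qmap.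
Variables (M N : ratmod) (a : rational_hom M N).

Fact qmap_subproof (f : Q M) : rmap (fun x => a (qval f x)).
Proof. exact/vmap_lin/qP. Qed.
Fact qmap1 (f : Q M) : a (qval f 1%g) = 0. Proof. by rewrite q1 linear0. Qed.
Fact qmap_linear : linear (fun f => mkq (qmap_subproof f) (qmap1 f)).
Proof. by move=> c u v; apply/q_inj => x; rewrite q_linE !mkqE q_linE linearP. Qed.
Fact qmap_act g f : mkq (qmap_subproof (act g f)) (qmap1 (act g f)) =
  act g (mkq (qmap_subproof f) (qmap1 f)).
Proof. by apply/q_inj => x; rewrite q_actE !mkqE q_actE linearB hom_act. Qed.
Definition qmap : rational_hom (Q M) (Q N) := hom_of qmap_linear qmap_act.
Lemma qmapE f x : qval (qmap f) x = a (qval f x). Proof. by []. Qed.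
Lemma qmap_delta v : qmap (delta M v) = delta N (a v).
Proof. by apply/q_inj => x; rewrite qmapE !deltaE linearB hom_act. Qed.
End Qmap.

End Modules.

(** * Dimension bounds for subquotients *)

Section Spans.
Variable k : closedFieldType.

Section OneSpace.
Variable W : lmodType k.

(** The image of Z in E / B is contained in a space of dimension at most d. Only
    the first d vectors of the sequence matter; sequences over the natural numbers
    avoid changing the index type in inductions on d. *)
Definition spans (E Z B : W -> Prop) (d : nat) :=
  exists e : nat -> W, (forall i, E (e i)) /\
    forall z, Z z -> exists c : nat -> k, B (z - \sum_(i < d) c i *: e i).

(** An extension of a space of dimension at most [d2] by one of dimension at
    most [d1]. The quotient is only seen through a linear relation [R] between
    vectors and coordinates. *)
Lemma spans_ext (E K B : W -> Prop) d1 d2 (Z : W -> Prop) (R : W -> (nat -> k) -> Prop) :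
  spans E K B d1 -> (forall z, Z z -> E z) ->
  (forall a u v, Z u -> Z v -> Z (a *: u + v)) ->
  (forall a u v c d, R u c -> R v d -> R (a *: u + v) (fun i => a * c i + d i)) ->
  (forall z, Z z -> exists c, R z c) ->
  (forall z c, Z z -> R z c -> (forall i, (i < d2)%N -> c i = 0) -> K z) ->
  spans E Z B (d1 + d2).
Proof.
move=> HK; elim: d2 Z R => [|d2 IH] Z R ZE Zl Rl Rt RK.
  have [e [He HKe]] := HK; rewrite addn0; exists e; split=> // z Hz.
  by have [c Hc] := Rt _ Hz; apply: HKe; apply: RK Hz Hc _.
pose Z0 z := Z z /\ exists c, R z c /\ c d2 = 0.
pose R0 z c := R z c /\ c d2 = 0.
have R0l a u v c d : R0 u c -> R0 v d -> R0 (a *: u + v) (fun i => a * c i + d i).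
  by move=> [Hc c0] [Hd d0]; split; [exact: Rl|rewrite c0 d0 mulr0 addr0].
have [|||z c [Hz _] [Hc c0] Hi|e [He HZe]] := IH Z0 R0 _ _ R0l.
- by move=> z [/ZE].
- move=> a u v [Hu [c Hc]] [Hv [d Hd]]; split; first exact: Zl.
  by exists (fun i => a * c i + d i); exact: R0l.
- by move=> z [_].
- by apply: RK Hz Hc _ => i; rewrite ltnS leq_eqVlt => /orP[/eqP->|/Hi].
rewrite addnS.
have [HZ|/existsNP[z0 /not_implyP[Hz0 Hz0']]] := pselect (forall z, Z z -> Z0 z).
  exists e; split=> // z /HZ /HZe [c Hc].
  exists (fun i => if (i < d1 + d2)%N then c i else 0).
  rewrite big_ord_recr /= ltnn scale0r addr0.
  by rewrite (eq_bigr (fun i : 'I_(d1 + d2) => c i *: e i)) // => i _; rewrite ltn_ord.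
(* z0 has a nonzero last coordinate, so it is the missing generator. *)
exists (fun i => if (i < d1 + d2)%N then e i else z0); split.
  by move=> i; case: ifP => // _; exact: ZE.
have [c0 Hc0] := Rt _ Hz0.
have c00 : c0 d2 != 0 by apply/eqP => E0; apply: Hz0'; split=> //; exists c0.
move=> z Hz; have [c Hc] := Rt _ Hz.
set b := c d2 / c0 d2.
have [c' Hc'] : exists c' : nat -> k, B ((- b *: z0 + z) - \sum_(i < d1 + d2) c' i *: e i).
  apply: HZe; split; first exact: Zl.
  exists (fun i => - b * c0 i + c i); split; first exact: Rl.
  by rewrite /b mulNr divfK // addNr.
exists (fun i => if (i < d1 + d2)%N then c' i else b).
rewrite big_ord_recr /= ltnn.
rewrite (eq_bigr (fun i : 'I_(d1 + d2) => c' i *: e i)); last first.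
  by move=> i _; rewrite ltn_ord.
by move: Hc'; rewrite scaleNr [- _ + z]addrC opprD addrA -[z - _ - _]addrA [- (b *: z0) - _]addrC addrA.
Qed.

Lemma sub_lincomb a (u v : W) d (c c' : nat -> k) (e : nat -> W) :
  a *: u + v - \sum_(i < d) (a * c i + c' i) *: e i =
  a *: (u - \sum_(i < d) c i *: e i) + (v - \sum_(i < d) c' i *: e i).
Proof.
rewrite scalerBr addrACA -opprD scaler_sumr -big_split /=; congr (_ - _).
by apply: eq_bigr => i _; rewrite scalerDl scalerA.
Qed.

Lemma spans_le (E Z B : W -> Prop) d d' : (d <= d')%N -> spans E Z B d -> spans E Z B d'.
Proof.
move=> dd' [e [He HZ]]; exists e; split=> // z /HZ [c Hc].
exists (fun i => if (i < d)%N then c i else 0).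
rewrite (big_ord_widen d' (fun i => c i *: e i) dd') big_mkcond in Hc.
rewrite (eq_bigr (fun i : 'I_d' => if (i < d)%N then c i *: e i else 0)) // => i _.
by case: ifP => //; rewrite scale0r.
Qed.

Lemma spans0P (E Z B : W -> Prop) : E 0 -> (spans E Z B 0 <-> (forall z, Z z -> B z)).
Proof.
move=> E0; split=> [[e [_ H]] z /H [c]|H]; first by rewrite big_ord0 subr0.
by exists (fun=> 0); split=> // z /H; exists (fun=> 0); rewrite big_ord0 subr0.
Qed.

Lemma spans_sub (E Z Z' B B' : W -> Prop) d :
  spans E Z B d -> (forall z, Z' z -> Z z) -> (forall z, B z -> B' z) -> spans E Z' B' d.
Proof.
by move=> [e [He H]] HZ HB; exists e; split=> // z /HZ /H [c Hc]; exists c; exact: HB.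
Qed.

End OneSpace.

(** Dimensions decrease along a map that is injective on the subquotients. The
    generators of the target need not be in the image: the map only provides
    the coordinates used in [spans_ext]. *)
Lemma spans_inj (W W' : lmodType k) (f : {linear W -> W'}) (Z B : W -> Prop)
    (Z' B' : W' -> Prop) d :
  Z 0 -> (forall a u v, Z u -> Z v -> Z (a *: u + v)) ->
  (forall a u v, B' u -> B' v -> B' (a *: u + v)) ->
  (forall z, Z z -> Z' (f z)) -> (forall z, Z z -> B' (f z) -> B z) ->
  spans Z' Z' B' d -> spans Z Z B d.
Proof.
move=> Z0 Zl Bl ZZ BB [e [He HZ]]; rewrite -[d]add0n.
apply: (@spans_ext _ Z (fun z => Z z /\ B z) B 0 d Z
  (fun z c => B' (f z - \sum_(i < d) c i *: e i))) => //.
- by apply/spans0P => // z [].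
- by move=> a u v c c' Hu Hv; rewrite linearP sub_lincomb; exact: Bl.
- by move=> z /ZZ /HZ.
move=> z c Hz + Hi; rewrite big1 ?subr0 => [H|i _]; last by rewrite Hi ?scale0r.
by split=> //; exact: BB.
Qed.

End Spans.

(** * Cohomology *)

Section Cohomology.
Variable k : closedFieldType.
Local Notation G := (SL2 k).
Local Notation ratmod := (rational_module k).

Fixpoint Qn (n : nat) (M : ratmod) : ratmod := if n is m.+1 then Q (Qn m M) else M.

Fixpoint qn n (M N : ratmod) (a : rational_hom M N) : rational_hom (Qn n M) (Qn n N) :=
  if n is m.+1 then qmap (qn m a) else a.

Arguments Qn : simpl never.
Arguments qn : simpl never.

Lemma qn_ext n (M N : ratmod) (a b : rational_hom M N) :
  (forall v, a v = b v) -> forall z, qn n a z = qn n b z.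
Proof. by move=> H; elim: n => [|n IH] z //; apply/q_inj => x; rewrite !qmapE IH. Qed.

Lemma qn_comp n (L M N : ratmod) (c : rational_hom L N) (b : rational_hom M N)
    (a : rational_hom L M) :
  (forall v, c v = b (a v)) -> forall z, qn n c z = qn n b (qn n a z).
Proof. by move=> H; elim: n => [|n IH] z //; apply/q_inj => x; rewrite !qmapE IH. Qed.

Lemma qn_id n (M : ratmod) (a : rational_hom M M) :
  (forall v, a v = v) -> forall z, qn n a z = z.
Proof. by move=> H; elim: n => [|n IH] z //; apply/q_inj => x; rewrite !qmapE IH. Qed.

Lemma qn_0 n (M N : ratmod) (a : rational_hom M N) :
  (forall v, a v = 0) -> forall z, qn n a z = 0.
Proof. by move=> H; elim: n => [|n IH] z //; apply/q_inj => x; rewrite !qmapE IH. Qed.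

Definition cob n (M : ratmod) : Qn n M -> Prop :=
  match n with
  | 0 => fun z => z = 0
  | m.+1 => fun z => exists w, z = delta (Qn m M) w
  end.

(** The n-th cohomology of M has dimension at most d. By dimension shifting
    along 0 -> M -> coMod M -> Q M -> 0, for n > 0 it is the quotient of the invariants of
    [Qn n M] by the image of the invariants of coMod (Qn (n - 1) M), which are the
    constant maps; [delta] is minus that image. *)
Definition Hle n (M : ratmod) d := spans (@inv k (Qn n M)) (@inv k (Qn n M)) (@cob n M) d.

Lemma inv0 (M : ratmod) : inv (0 : M). Proof. by move=> g; rewrite act0. Qed.
Lemma inv_lin (M : ratmod) a (u v : M) : inv u -> inv v -> inv (a *: u + v).
Proof. by move=> Hu Hv g; rewrite actD actZ Hu Hv. Qed.
Lemma inv_hom (M N : ratmod) (a : rational_hom M N) v : inv v -> inv (a v).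
Proof. by move=> H g; rewrite -hom_act H. Qed.

Lemma cob_lin n (M : ratmod) a (u v : Qn n M) : cob u -> cob v -> cob (a *: u + v).
Proof.
case: n u v => [|n] u v; first by move=> -> ->; rewrite scaler0 addr0.
by move=> [w ->] [y ->]; exists (a *: w + y); rewrite linearP.
Qed.
Lemma cob_hom n (M N : ratmod) (a : rational_hom M N) (z : Qn n M) : cob z -> cob (qn n a z).
Proof.
case: n z => [|n] z; first by move=> ->; rewrite linear0.
by move=> [w ->]; exists (qn n a w); rewrite -qmap_delta.
Qed.

Lemma Hle0P n (M : ratmod) : Hle n M 0 <-> (forall z : Qn n M, inv z -> cob z).
Proof. by apply: spans0P; exact: inv0. Qed.

Lemma Hle_le n (M : ratmod) d d' : (d <= d')%N -> Hle n M d -> Hle n M d'.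
Proof. exact: spans_le. Qed.

Lemma Hle_retract n (M N : ratmod) (a : rational_hom M N) (b : rational_hom N M) d :
  (forall v, b (a v) = v) -> Hle n N d -> Hle n M d.
Proof.
move=> H; apply: (spans_inj (f := qn n a)).
- exact: inv0.
- exact: inv_lin.
- exact: cob_lin.
- by move=> z; exact: inv_hom.
move=> z _ /(cob_hom b).
by rewrite -(qn_comp (c := hom_id M)) ?qn_id.
Qed.

(** ** Short exact sequences *)

Record ses (A B C : ratmod) (a : rational_hom A B) (p : rational_hom B C) : Prop := Ses {
  ses_inj : forall v, a v = 0 -> v = 0;
  ses_surj : forall z, exists b, p b = z;
  ses_ker : forall b, p b = 0 -> exists v, a v = b;
  ses_comp : forall v, p (a v) = 0
}.

Lemma hom_inj (A B : ratmod) (a : rational_hom A B) :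
  (forall v, a v = 0 -> v = 0) -> forall u v, a u = a v -> u = v.
Proof.
move=> H u v E; apply/eqP; rewrite -subr_eq0; apply/eqP/H.
by rewrite linearB E subrr.
Qed.

Lemma qmap_lift (M N : ratmod) (a : rational_hom M N) (f : Q N) n (h : 'I_n -> G -> k)
    (w : 'I_n -> M) :
  (forall i, regular (h i)) -> (forall x, qval f x = \sum_i h i x *: a (w i)) ->
  exists f', qmap a f' = f.
Proof.
move=> Hh E.
have Hr : rmap (fun x => \sum_i (h i x *: w i - h i 1%g *: w i)).
  apply: rmap_sum => i; apply: vmapD; [exact: vmap1|exact: rmap_cst].
have H1 : \sum_i (h i 1%g *: w i - h i 1%g *: w i) = 0.
  by apply: big1 => i _; rewrite subrr.
exists (mkq Hr H1); apply/q_inj => x; rewrite qmapE mkqE linear_sum.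
rewrite (eq_bigr (fun i => h i x *: a (w i) - h i 1%g *: a (w i))).
  by rewrite sumrB -!E q1 subr0.
by move=> i _; rewrite linearB !linearZ.
Qed.

(** A regular map has finitely many coefficients, so it lifts if they do. For
    exactness in the middle they first have to be chosen in the kernel, by
    [rmap_in]. *)
Lemma ses_q (A B C : ratmod) (a : rational_hom A B) (p : rational_hom B C) :
  ses a p -> ses (qmap a) (qmap p).
Proof.
move=> [ai ps pk pc]; split.
- move=> f Ef; apply/q_inj => x; apply: ai.
  by rewrite -qmapE Ef.
- move=> z; have [n [h [w [Hh E]]]] := qP z.
  have [v Hv] := choice (fun i => ps (w i)).
  by apply: (qmap_lift (w := v) Hh) => x; rewrite E; apply: eq_bigr => i _; rewrite Hv.
- move=> f Ef.
  have [|x|n [h [w [Hh Hw E]]]] := rmap_in (P := fun v => p v = 0) _ (qP f).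
  + by move=> c u v Hu Hv; rewrite linearP Hu Hv scaler0 addr0.
  + by rewrite -qmapE Ef.
  have [v Hv] := choice (fun i => pk _ (Hw i)).
  by apply: (qmap_lift (w := v) Hh) => x; rewrite E; apply: eq_bigr => i _; rewrite Hv.
- by move=> f; apply/q_inj => x; rewrite !qmapE pc.
Qed.

Lemma ses_qn n (A B C : ratmod) (a : rational_hom A B) (p : rational_hom B C) :
  ses a p -> ses (qn n a) (qn n p).
Proof. by move=> H; elim: n => [|n IH] //=; exact: ses_q. Qed.

(** The cokernel of the map induced on invariants by an equivariant map; for a
    short exact sequence it is the kernel of the map induced on the next
    cohomology. *)
Definition Cle n (B C : ratmod) (p : rational_hom B C) d :=
  spans (@inv k (Qn n C)) (@inv k (Qn n C)) (fun z => exists b, inv b /\ z = qn n p b) d.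

Section LES.
Variables (A B C : ratmod) (a : rational_hom A B) (p : rational_hom B C).
Hypothesis H : ses a p.

Lemma LES_inv d : Hle 0 B d -> Hle 0 A d.
Proof.
apply: (spans_inj (f := a)).
- exact: inv0.
- exact: inv_lin.
- exact: (@cob_lin 0 B).
- by move=> z; exact: inv_hom.
by move=> z _; exact: (ses_inj H).
Qed.

(** A class of A is determined by its image in the cohomology of B up to the
    image of the connecting map, whose source is a cokernel of dimension at most
    d1. *)
Lemma LES_left n d1 d2 : Cle n p d1 -> Hle n.+1 B d2 -> Hle n.+1 A (d1 + d2).
Proof.
have Hn := ses_qn n H; have Hn1 := ses_qn n.+1 H.
move=> [e [He HC]] [e' [He' HB]].
have [et Het] := choice (fun i => ses_surj Hn (e i)).
have Hz i : exists y, qn n.+1 a y = delta _ (et i).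
  by apply: (ses_ker Hn1); rewrite qmap_delta Het; apply/delta_eq0.
have [zt Hzt] := choice Hz.
apply: (@spans_ext _ _ _ (fun z => inv z /\ exists w, qn n.+1 a z = delta _ w) _ d1 d2 _
  (fun z c => cob (qn n.+1 a z - \sum_(i < d2) c i *: e' i))).
- exists zt; split.
    move=> i g; apply: (hom_inj (ses_inj Hn1)).
    by rewrite hom_act Hzt delta_inv.
  move=> z [zi [w Hw]].
  have pw : inv (qn n p w).
    by apply/delta_eq0; rewrite -qmap_delta -Hw; exact: (ses_comp Hn1).
  have [c [b [bi Hb]]] := HC _ pw.
  have [|y Hy] := ses_ker Hn (b := w - \sum_(i < d1) c i *: et i - b).
    rewrite !linearB linear_sum -Hb; apply/eqP; rewrite subr_eq0; apply/eqP.
    by congr (_ - _); apply: eq_bigr => i _; rewrite linearZ Het.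
  exists c; exists y; apply: (hom_inj (ses_inj Hn1)).
  rewrite qmap_delta Hy !linearB -Hw (proj2 (delta_eq0 b) bi) subr0 !linear_sum.
  by congr (_ + _); apply: eq_bigr => i _; congr (- _); rewrite !linearZ Hzt.
- by [].
- exact: inv_lin.
- by move=> c u v x y Hu Hv; rewrite linearP sub_lincomb; exact: cob_lin.
- by move=> z zi; apply: HB; exact: inv_hom.
move=> z c zi + Hi; rewrite big1 ?subr0 => [|i _]; last by rewrite Hi ?scale0r.
by move=> Hw; split.
Qed.

(** The connecting map embeds the cokernel on invariants into the next
    cohomology of A. *)
Lemma LES_right n d : Hle n.+1 A d -> Cle n p d.
Proof.
have Hn := ses_qn n H; have Hn1 := ses_qn n.+1 H.
move=> [e [He HA]]; rewrite /Cle -[d]add0n.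
pose R z (c : nat -> k) := exists b y, qn n p b = z /\
  delta _ b = qn n.+1 a (\sum_(i < d) c i *: e i + delta _ y).
apply: (@spans_ext _ _ _ (fun z => exists b, inv b /\ z = qn n p b) _ 0 d _ R).
- apply: (proj2 (spans0P _ _ _)) => //; exact: inv0.
- by [].
- exact: inv_lin.
- move=> x u v c c' [b [y [Hb Hy]]] [b' [y' [Hb' Hy']]].
  exists (x *: b + b'), (x *: y + y'); rewrite linearP Hb Hb'; split=> //.
  rewrite [LHS]linearP Hy Hy' -[LHS]linearP; congr (qn n.+1 a _).
  rewrite linearP scalerDr addrACA scaler_sumr -big_split /=; congr (_ + _).
  by apply: eq_bigr => i _; rewrite scalerDl scalerA.
- move=> z zi; have [b Hb] := ses_surj Hn z.
  have [|y Hy] := ses_ker Hn1 (b := delta _ b).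
    by rewrite qmap_delta Hb; apply/delta_eq0.
  have yi : inv y.
    by move=> g; apply: (hom_inj (ses_inj Hn1)); rewrite hom_act Hy delta_inv.
  have [c [w Hw]] := HA _ yi.
  exists c, b, w; split=> //.
  by rewrite -Hw addrC subrK Hy.
move=> z c zi [b [y [Hb Hy]]] Hi.
exists (b - qn n a y); split; last first.
  by rewrite linearB Hb (ses_comp Hn) subr0.
apply/delta_eq0; rewrite linearB -qmap_delta Hy big1 ?add0r ?subrr // => i _.
by rewrite Hi ?scale0r.
Qed.

Lemma cob_lift n (z : Qn n C) : cob z -> exists b, inv b /\ z = qn n p b.
Proof.
case: n z => [|n] z; first by move=> ->; exists 0; split; [exact: inv0|rewrite linear0].
move=> [w ->]; have [b <-] := ses_surj (ses_qn n H) w.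
by exists (delta _ b); rewrite -qmap_delta; split=> //; exact: delta_inv.
Qed.

(** The connecting map kills the coboundaries. *)
Lemma Cle_of_Hle n d : Hle n C d -> Cle n p d.
Proof. by move=> HC; apply: (spans_sub HC) => // z; exact: cob_lift. Qed.

Lemma Hle_of_Cle n d : Hle n.+1 B 0 -> Cle n.+1 p d -> Hle n.+1 C d.
Proof.
move=> /Hle0P HB HC; apply: (spans_sub HC) => // z [b [bi ->]].
exact/(@cob_hom n.+1)/HB.
Qed.

(** The kernel of the map on cohomology comes from the preceding cohomology of
    the cokernel. *)
Lemma LES_cob n (z : Qn n.+1 A) : Hle n C 0 -> inv z -> cob (qn n.+1 a z) -> cob z.
Proof.
move=> /Hle0P HC zi [w Hw].
have Hn := ses_qn n H; have Hn1 := ses_qn n.+1 H.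
have [b [bi Hb]] : exists b, inv b /\ qn n p w = qn n p b.
  apply/cob_lift/HC/delta_eq0; rewrite -qmap_delta -Hw; exact: (ses_comp Hn1).
have [|y Hy] := ses_ker Hn (b := w - b); first by rewrite linearB Hb subrr.
exists y; apply: (hom_inj (ses_inj Hn1)).
by rewrite qmap_delta Hy linearB (proj2 (delta_eq0 b) bi) subr0 -Hw.
Qed.

End LES.

(** ** Relatively injective modules *)

(** Injectivity relative to the underlying vector spaces. It implies acyclicity
    and, unlike injectivity, is evident for the modules constructed below. *)
Definition relinj (M : ratmod) :=
  exists r : rational_hom (coMod M) M, forall v, r (eta M v) = v.

Lemma ses_eta (M : ratmod) : ses (eta M) (quo M).
Proof.
split.
- by move=> v /(congr1 (fun f => coval f 1%g)); rewrite etaE act1.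
- move=> z; exists (mkco (qP z)); apply/q_inj => x.
  by rewrite quoE /coval /= q1 act0 subr0.
- move=> f Hf; exists (coval f 1%g); apply/co_inj => x.
  by apply/eqP; rewrite etaE eq_sym -subr_eq0 -quoE Hf.
- by move=> v; apply/q_inj => x; rewrite quoE !etaE act1 subrr.
Qed.

Lemma relinj_retract (M N : ratmod) (a : rational_hom M N) (b : rational_hom N M) :
  (forall v, b (a v) = v) -> relinj N -> relinj M.
Proof.
move=> H [r Hr].
have Hs (f : coMod M) : rmap (fun x => a (coval f x)) by apply: vmap_lin; exact: coP.
have Hl : linear (fun f => b (r (mkco (Hs f)))).
  move=> c u v.
  have -> : mkco (Hs (c *: u + v)) = c *: mkco (Hs u) + mkco (Hs v).
    by apply/co_inj => x; rewrite co_linE /coval /= linearP.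
  by rewrite !linearP.
have Ha g f : b (r (mkco (Hs (act g f)))) = act g (b (r (mkco (Hs f)))).
  by rewrite -!hom_act; congr (b (r _)); apply/co_inj.
exists (hom_of Hl Ha) => v; rewrite -[RHS]H; congr (b _).
rewrite -[RHS]Hr; congr (r _).
by apply/co_inj => x; rewrite etaE -hom_act.
Qed.

(** Evaluation at 1 in the inner variable retracts the orbit map. *)
Lemma relinj_co (N : lmodType k) : relinj (coMod N).
Proof.
have ev_linear : linear (fun f : coMod N => coval f 1%g) by move=> c u v.
have Hs (F : coMod (coMod N)) : rmap (fun x => coval (coval F x) 1%g).
  exact: (vmap_lin (lin_of ev_linear) (coP F)).
have Hl : linear (fun F => mkco (Hs F)).
  by move=> c u v; apply/co_inj => x; rewrite co_linE !mkcoE !co_linE.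
have Ha g F : mkco (Hs (act g F)) = act g (mkco (Hs F)).
  by apply/co_inj => x; rewrite co_actE !mkcoE.
exists (hom_of Hl Ha) => f; apply/co_inj => x.
by rewrite -[LHS]/(coval f (1 * x)%g) mul1g.
Qed.

(** A retraction of [eta] splits the sequence 0 -> M -> coMod M -> Q M -> 0, so
    Q M is a direct summand of a coinduced module. *)
Lemma relinj_Q (M : ratmod) : relinj M -> relinj (Q M).
Proof.
move=> [r Hr].
have Hl : linear (fun f : Q M => mkco (qP f) - eta M (r (mkco (qP f)))).
  move=> c u v.
  have -> : mkco (qP (c *: u + v)) = c *: mkco (qP u) + mkco (qP v) by apply/co_inj.
  by rewrite (linearP (hom_fun r)) (linearP (hom_fun (eta M))) scalerBr opprD addrACA.
have Ha g f : mkco (qP (act g f)) - eta M (r (mkco (qP (act g f)))) =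
   act g (mkco (qP f) - eta M (r (mkco (qP f)))).
  have -> : mkco (qP (act g f)) = act g (mkco (qP f)) - eta M (qval f g).
    by apply/co_inj.
  by rewrite (linearB (hom_fun r)) Hr (linearB (hom_fun (eta M))) opprB addrA subrK actB !hom_act.
apply: (relinj_retract (a := hom_of Hl Ha) (b := quo M)); last exact: relinj_co.
move=> f; rewrite -[hom_of Hl Ha f]/(mkco (qP f) - eta M (r (mkco (qP f)))).
rewrite (linearB (hom_fun (quo M))) (ses_comp (ses_eta M)) subr0.
by apply/q_inj => x; rewrite quoE /coval /= q1 act0 subr0.
Qed.

Lemma relinj_acyclic (M : ratmod) n : relinj M -> Hle n.+1 M 0.
Proof.
move=> HM; apply/Hle0P => z zi.
have [r Hr] : relinj (Qn n M) by elim: (n) => [|m IH] //; exact: relinj_Q.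
(* A cocycle, seen in the coinduced module, is invariant modulo constants. *)
have E g : act g (mkco (qP z)) = eta _ (qval z g) + mkco (qP z).
  apply/co_inj => x; rewrite co_actE; apply/eqP.
  rewrite -[X in _ == X]/(act x (qval z g) + qval z x) addrC -subr_eq -q_actE zi.
  exact/eqP.
exists (r (mkco (qP z))); apply/q_inj => x.
by rewrite deltaE -hom_act E linearD Hr addrK.
Qed.

(** * Comparison with injective resolutions *)

Section SubModule.
Variables (M : ratmod) (S : subsp M).
Hypothesis HS : forall g v, S v -> S (act g v).

Definition sub_act (g : G) (v : subT S) : subT S := mksub (HS g (subP v)).
Fact sub_act_linear g : linear (sub_act g).
Proof. by move=> a u v; apply/sub_inj; rewrite /= actD actZ. Qed.
Fact sub_act1 v : sub_act 1%g v = v.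
Proof. by apply/sub_inj; rewrite /= act1. Qed.
Fact sub_actM g h v : sub_act (g * h)%g v = sub_act g (sub_act h v).
Proof. by apply/sub_inj; rewrite /= actM. Qed.
Fact sub_act_rational v : rmap (fun g => sub_act g v).
Proof.
have [n [f [w [Hf Hw E]]]] := rmap_in (@sp_lin _ _ S) (rmap_orbit (val v))
  (fun g => HS g (subP v)).
exists n, f, (fun i => mksub (Hw i)); split=> // g.
by apply/sub_inj; rewrite val_suml /= E.
Qed.
Definition subMod : ratmod :=
  RationalModule sub_act_linear sub_act1 sub_actM sub_act_rational.

Fact incl_linear : linear (fun v : subMod => val (v : subT S)). Proof. by []. Qed.
Definition incl : rational_hom subMod M := @hom_of _ subMod M _ incl_linear (fun _ _ => erefl).
Lemma incl_inj u v : incl u = incl v -> u = v. Proof. exact: sub_inj. Qed.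
Lemma inclP v : S (incl v). Proof. exact: subP. Qed.
Lemma incl_onto v : S v -> exists u, incl u = v. Proof. by move=> H; exists (mksub H). Qed.

Lemma factor (N : ratmod) (a : rational_hom N M) : (forall v, S (a v)) ->
  exists b : rational_hom N subMod, forall v, incl (b v) = a v.
Proof.
move=> Ha.
have Hl : linear (fun v => mksub (Ha v) : subMod).
  by move=> c u v; apply/incl_inj; rewrite [RHS]linearP /= linearP.
have Hc g v : mksub (Ha (act g v)) = act g (mksub (Ha v) : subMod).
  by apply/incl_inj; rewrite [RHS]hom_act /= hom_act.
by exists (hom_of Hl Hc).
Qed.

End SubModule.

Lemma relinj_injective (M : ratmod) : injective_module M -> relinj M.
Proof.
move=> HM; have [|r Hr] := HM _ _ (eta M) (hom_id M); last by exists r.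
exact/hom_inj/(ses_inj (ses_eta M)).
Qed.

Section Kernel.
Variables (M N : ratmod) (a : rational_hom M N).
Fact ker0 : a 0 = 0. Proof. exact: linear0. Qed.
Fact ker_lin c u v : a u = 0 -> a v = 0 -> a (c *: u + v) = 0.
Proof. by move=> Hu Hv; rewrite linearP Hu Hv scaler0 addr0. Qed.
Definition ker_sp : subsp M := Subsp ker0 ker_lin.
Fact ker_act g v : ker_sp v -> ker_sp (act g v).
Proof. by rewrite /= => H; rewrite hom_act H act0. Qed.
Definition kerMod := subMod ker_act.
End Kernel.

Lemma rel_inverse (M N : ratmod) (a : rational_hom M N) :
  (forall v, a v = 0 -> v = 0) -> (forall z, exists v, a v = z) ->
  exists b : rational_hom N M, (forall v, b (a v) = v) /\ forall z, a (b z) = z.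
Proof.
move=> ai asurj.
have [||||b Hb] := @rel_hom _ N M (fun z v => a v = z).
- by [].
- by move=> c u v y z <- <-; rewrite linearP.
- by move=> y /ai.
- by move=> g v y <-; rewrite hom_act.
by exists b; split=> // v; apply: (hom_inj ai).
Qed.

Lemma point_hom (M : ratmod) (x : M) : inv x ->
  exists f : rational_hom (trivial_module k) M, forall c : k, f c = c *: x.
Proof.
move=> Hx.
have Hl : linear (fun c : k^o => c *: x).
  by move=> a u v; rewrite scalerDl scalerA.
have Ha (g : G) (v : trivial_module k) : (act g v : k^o) *: x = act g ((v : k^o) *: x).
  by rewrite actZ Hx.
by exists (@hom_of _ (trivial_module k) M _ Hl Ha).
Qed.

(** Dimension shifting along the given resolution. Its kernels K j are linked by
    0 -> K j -> res j -> K (j + 1) -> 0 with acyclic middle terms, and K 0 is V.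
    At the end of the shift, an invariant of K (n + 1) is the same as a cocycle,
    since homomorphisms from the trivial module are invariants. *)
Lemma Ext_of_Hle n d (V : ratmod) : Hle n.+1 V d -> H_dim_le n.+1 V d.
Proof.
move=> HV I.
pose K j := kerMod (res_diff I j).
pose inc j : rational_hom (K j) (res I j) := incl (@ker_act _ _ (res_diff I j)).
have Hk j (v : K j) : res_diff I j (inc j v) = 0 := subP v.
have Hp j : exists p : rational_hom (res I j) (K j.+1), forall v, inc j.+1 (p v) = res_diff I j v.
  by apply: factor => v; apply/res_exact; exists v.
pose p j := projT1 (cid (Hp j)).
have Hpj j v : inc j.+1 (p j v) = res_diff I j v by rewrite /p; case: cid.
have Hses j : ses (inc j) (p j).
  split.
  - by move=> v Ev; apply: incl_inj; rewrite linear0.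
  - move=> z; have /res_exact[y Hy] := inclP z.
    by exists y; apply: incl_inj; rewrite [LHS]Hpj.
  - move=> b Hb; apply: incl_onto; rewrite /= -Hpj Hb linear0 //.
  - by move=> v; apply: incl_inj; rewrite [LHS]Hpj linear0 Hk.
have Hrel : forall i, relinj (res I i).
  by move=> i; exact: relinj_injective (@res_injective _ _ I i).
have HK0 : Hle n.+1 (K 0%N) d.
  have [|a Ha] := @factor _ _ (@ker_act _ _ (res_diff I 0)) V (res_aug I).
    by move=> w; apply: (proj2 (res_exact0 _)); exists w.
  have [||b [_ Hb]] := rel_inverse (a := a).
  - move=> v Ev; apply: (@res_aug_inj _ _ I); rewrite -Ha Ev !linear0 //.
  - move=> z; have /res_exact0[v Hv] := inclP z.
    by exists v; apply: incl_inj; rewrite Ha.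
  exact: Hle_retract Hb HV.
have HK j : (j <= n)%N -> Hle (n - j).+1 (K j) d.
  elim: j => [|j IH] Hj; first by rewrite subn0.
  have := IH (ltnW Hj); rewrite -(subnSK Hj) => H1.
  apply: Hle_of_Cle _ (LES_right (Hses j) H1).
  exact: relinj_acyclic.
have := LES_right (Hses n) (n := 0) (d := d).
have := HK n (leqnn n); rewrite subnn => H1 /(_ H1) [e [He HC]].
have [f Hf] := choice (fun i : nat => point_hom (inv_hom (inc n.+1) (He i))).
exists (fun i => f i); split.
  by move=> i v; rewrite Hf linearZ Hk; exact: scaler0.
move=> h Hh.
have hv (v : k) : h v = v *: h (1 : k^o).
  by rewrite -linearZ; congr (h _); rewrite /GRing.scale /= mulr1.
have [z Hz] := incl_onto (@ker_act _ _ (res_diff I n.+1)) (v := h (1 : k^o)) (Hh _).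
have zi : inv z.
  move=> g; apply: incl_inj; rewrite hom_act Hz -hom_act //.
have [c [b [bi Hb]]] := HC z zi.
have [y Hy] := point_hom (inv_hom (res_diff I n) bi).
have [y' Hy'] := point_hom bi.
exists (fun i => c i), y; split.
  by exists y' => v; rewrite Hy Hy' linearZ.
move=> v; rewrite hv -Hz Hy -(Hpj n b).
have -> : z = \sum_(i < d) c i *: e i + p n b by rewrite -[p n b]Hb addrC subrK.
rewrite (linearD (hom_fun (inc n.+1))) (linear_sum (hom_fun (inc n.+1))) scalerDr scaler_sumr; congr (_ + _).
apply: eq_bigr => i _.
by rewrite (linearZ_LR (hom_fun (inc n.+1))) Hf !scalerA mulrC.
Qed.

End Cohomology.

(** * Parity *)

Section Parity.
Variable k : closedFieldType.
Local Notation G := (SL2 k).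

(** The characters of the center of SL_2 as a grading of the regular functions,
    odd for [true]. In characteristic 2 the center is infinitesimal and has no
    nontrivial point, so the parity of a function cannot be tested by translating
    it; it is read off from the degrees of polynomials representing it. *)
Inductive preg : bool -> (G -> k) -> Prop :=
| preg_cst c : preg false (fun=> c)
| preg_coord i j : preg true (fun g => val g i j)
| preg_add b f h : preg b f -> preg b h -> preg b (fun g => f g + h g)
| preg_mul b c f h : preg b f -> preg c h -> preg (b (+) c) (fun g => f g * h g).

Lemma preg_ext b (f h : G -> k) : preg b f -> f =1 h -> preg b h.
Proof. by move=> Hf /funext <-. Qed.

Lemma preg0 b : preg b (fun=> 0).
Proof.
case: b; last exact: preg_cst.
by apply: (preg_ext (preg_mul (preg_cst 0) (preg_coord 0 0))) => g; rewrite mul0r.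
Qed.

Lemma preg_scale c b f : preg b f -> preg b (fun g => c * f g).
Proof. exact: (preg_mul (preg_cst c)). Qed.

Lemma preg_regular b f : preg b f -> regular f.
Proof.
elim=> [c|i j|{}b g h _ Hg _ Hh|{}b c g h _ Hg _ Hh].
- exact: regular_cst.
- exact: regular_coord.
- exact: regularD.
- exact: regularM.
Qed.

Lemma regular_split f : regular f -> exists f0 f1,
  [/\ preg false f0, preg true f1 & forall g, f g = f0 g + f1 g].
Proof.
move: f; apply: regular_ind => [c|i j|f h|f h].
- exists (fun=> c), (fun=> 0); split; [exact: preg_cst|exact: preg0|].
  by move=> g; rewrite addr0.
- exists (fun=> 0), (fun g : G => val g i j).
  by split; [exact: preg0|exact: preg_coord|move=> g; rewrite add0r].
- move=> [f0 [f1 [H0 H1 E]]] [h0 [h1 [H0' H1' E']]].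
  exists (fun g => f0 g + h0 g), (fun g => f1 g + h1 g).
  by split; [exact: preg_add|exact: preg_add|move=> g; rewrite E E' addrACA].
- move=> [f0 [f1 [H0 H1 E]]] [h0 [h1 [H0' H1' E']]].
  exists (fun g => f0 g * h0 g + f1 g * h1 g), (fun g => f0 g * h1 g + f1 g * h0 g).
  split.
  + by apply: preg_add; [exact: (preg_mul H0 H0')|exact: (preg_mul H1 H1')].
  + by apply: preg_add; [exact: (preg_mul H0 H1')|exact: (preg_mul H1 H0')].
  by move=> g; rewrite E E' mulrDl !mulrDr [f1 g * _ + _]addrC addrACA.
Qed.

Lemma preg_comp (u : G -> G) : (forall i j, preg true (fun g => val (u g) i j)) ->
  forall b f, preg b f -> preg b (fun g => f (u g)).
Proof.
move=> Hu b f; elim=> [c|i j|{}b g h _ Hg _ Hh|{}b c g h _ Hg _ Hh].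
- exact: preg_cst.
- exact: Hu.
- exact: (preg_add Hg Hh).
- exact: (preg_mul Hg Hh).
Qed.

Lemma preg_mulr h b f : preg b f -> preg b (fun g => f (g * h)%g).
Proof.
apply: preg_comp => i j.
apply: (@preg_ext _ (fun g : G => val h 0 j * val g i 0 + val h 1 j * val g i 1)).
  by apply: preg_add; apply: preg_scale; exact: preg_coord.
by move=> g; rewrite SL2_valM_entry sum_ord2 !(mulrC (val h _ _)).
Qed.

Lemma preg_mull h b f : preg b f -> preg b (fun g => f (h * g)%g).
Proof.
apply: preg_comp => i j.
apply: (@preg_ext _ (fun g : G => val h i 0 * val g 0 j + val h i 1 * val g 1 j)).
  by apply: preg_add; apply: preg_scale; exact: preg_coord.
by move=> g; rewrite SL2_valM_entry sum_ord2.
Qed.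

(** The torus multiplies one row by t and the other by its inverse, and the
    exponents 1 and -1 are both odd. The factor t^(2N) clears the
    denominators. *)
Lemma preg_torus b f x : preg b f -> exists (N : nat) (q : {poly k}),
  forall t, t != 0 -> t ^+ (N.*2) * f (torus t * x)%g = t ^+ b * q.[t ^+ 2].
Proof.
elim=> [c|i j|{}b g h _ [N [q Hq]] _ [N' [q' Hq']]|{}b c g h _ [N [q Hq]] _ [N' [q' Hq']]].
- by exists 0%N, c%:P => t _; rewrite hornerC !mul1r.
- case: (ord2P i) => ->.
    by exists 0%N, (val x 0 j)%:P => t t0; rewrite hornerC torus_mul0 // mul1r.
  exists 1%N, (val x 1 j)%:P => t t0.
  by rewrite hornerC torus_mul1 // expr2 mulrA mulfK.
- exists (N + N')%N, ('X^N' * q + 'X^N * q') => t t0.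
  rewrite doubleD exprD mulrDr mulrAC Hq // -[X in _ + X]mulrA Hq' //.
  rewrite hornerD !hornerM !hornerXn -!exprM !mul2n mulrDr; congr (_ + _).
    by rewrite -mulrA [q.[_] * _]mulrC.
  by rewrite mulrCA.
- exists (N + N')%N, ('X^(b && c) * (q * q')) => t t0.
  rewrite doubleD exprD mulrACA Hq // Hq' // mulrACA !hornerM hornerXn [RHS]mulrA; congr (_ * _).
  by case: (b); case: (c); rewrite /= ?expr0 ?expr1 ?mul1r ?mulr1.
Qed.

End Parity.

Notation prmap b := (vmap (preg b)).

Section ParityMaps.
Variable k : closedFieldType.
Local Notation G := (SL2 k).
Local Notation ratmod := (rational_module k).

Section Prmap.
Variable M : lmodType k.
Implicit Types (f : G -> k) (p q : G -> M).

Lemma prmap0 b : prmap b ((fun=> 0) : G -> M).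
Proof. by apply: (vmap_ext (vmap1 0 (preg0 k b))) => g; rewrite scaler0. Qed.

Lemma prmap_cst (w : M) : prmap false (fun=> w).
Proof. by apply: (vmap_ext (vmap1 w (preg_cst 1))) => g; rewrite scale1r. Qed.

Lemma prmapM b c f p : preg b f -> prmap c p -> prmap (b (+) c) (fun g => f g *: p g).
Proof.
move=> Hf [n [h [w [Hh E]]]]; exists n, (fun i g => f g * h i g), w.
split=> [i|g]; first exact: preg_mul.
by rewrite E scaler_sumr; apply: eq_bigr => i _; rewrite scalerA.
Qed.

Lemma prmapZ b c p : prmap b p -> prmap b (fun g => c *: p g).
Proof. exact: (prmapM (preg_cst c)). Qed.

Lemma prmap_rmap b p : prmap b p -> rmap p.
Proof. by move=> [n [f [w [Hf E]]]]; exists n, f, w; split=> // i; exact: preg_regular. Qed.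

Lemma prmap_mulr h b p : prmap b p -> prmap b (fun g => p (g * h)%g).
Proof. exact: vmap_comp (preg_mulr h (b := b)) _. Qed.

Lemma prmap_mull h b p : prmap b p -> prmap b (fun g => p (h * g)%g).
Proof. exact: vmap_comp (preg_mull h (b := b)) _. Qed.

Lemma rmap_split p : rmap p -> exists p0 p1,
  [/\ prmap false p0, prmap true p1 & forall g, p g = p0 g + p1 g].
Proof.
move: p; apply: rmap_ind => [|f w Hf|p q].
- exists (fun=> 0), (fun=> 0); split; [exact: prmap0..|by move=> g; rewrite addr0].
- have [f0 [f1 [H0 H1 E]]] := regular_split Hf.
  exists (fun g => f0 g *: w), (fun g => f1 g *: w).
  by split; [exact: vmap1..|move=> g; rewrite E scalerDl].
move=> [p0 [p1 [H0 H1 E]]] [q0 [q1 [H0' H1' E']]].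
exists (fun g => p0 g + q0 g), (fun g => p1 g + q1 g).
by split; [exact: vmapD..|move=> g; rewrite E E' addrACA].
Qed.

Lemma prmap_torus b p x : prmap b p -> exists (N : nat) (q : k -> M),
  polyn q /\ forall t, t != 0 -> t ^+ (N.*2) *: p (torus t * x)%g = t ^+ b *: q (t ^+ 2).
Proof.
move=> [n [f [w [Hf E]]]].
rewrite (_ : p = fun g => \sum_(i < n) f i g *: w i); last exact/funext.
elim: (index_enum _) => [|i r [N [q [Hq Eq]]]].
  exists 0%N, (fun=> 0); split; first exact: polyn_cst.
  by move=> t _; rewrite big_nil !scaler0.
have [N' [q' Hq']] := preg_torus x (Hf i).
exists (N + N')%N, (fun r => r ^+ N *: (q'.[r] *: w i) + r ^+ N' *: q r); split.
  by apply: polynD; apply: polynXn => //; exact: polyn_horner.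
move=> t t0; have E1 : t ^+ (N + N').*2 = t ^+ N.*2 * t ^+ N'.*2 by rewrite doubleD exprD.
rewrite big_cons !scalerDr; congr (_ + _).
  by rewrite !scalerA E1 -(mulrA _ (t ^+ N'.*2)) Hq' // -exprM mul2n mulrCA.
by rewrite E1 mulrC -scalerA Eq // !scalerA -exprM mul2n mulrC.
Qed.

(** Along the torus an even map involves even powers of the parameter, and an
    odd map odd powers; this makes the grading by parity well defined. *)
Lemma prmap_uniq p q : prmap false p -> prmap true q -> (forall g, p g + q g = 0) ->
  forall g, p g = 0 /\ q g = 0.
Proof.
move=> Hp Hq E x.
have [N [P [HP EP]]] := prmap_torus x Hp; have [N' [P' [HP' EP']]] := prmap_torus x Hq.
have H := @even_odd_inj k M (fun r => r ^+ N' *: P r) (fun r => r ^+ N *: P' r)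
  (polynXn N' HP) (polynXn N HP').
have [|H0 H1] := H _ (1 ^+ 2).
  move=> t t0; have := congr1 (fun v => t ^+ N'.*2 *: (t ^+ N.*2 *: v)) (E (torus t * x)%g).
  rewrite !scaler0 !scalerDr EP // scale1r.
  rewrite [X in _ + X](_ : _ = t ^+ N.*2 *: (t ^+ N'.*2 *: q (torus t * x)%g)).
    by rewrite EP' // expr1 -!exprM !mul2n !scalerA mulrC.
  by rewrite !scalerA mulrC.
have := EP 1 (oner_neq0 _); have := EP' 1 (oner_neq0 _).
move: H0 H1; rewrite !expr1n !scale1r torus1 mul1g => -> ->.
by split.
Qed.

End Prmap.

(** ** The even part of a module *)

(** The orbit map of v determines the components of v: y is the value at 1 of
    its even part. *)
Definition even_rel (M : ratmod) (v y : M) := exists p0 p1,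
  [/\ prmap false p0, prmap true p1, forall g, act g v = p0 g + p1 g & y = p0 1%g].

Lemma even_rel_lin (M : ratmod) a (u v y z : M) :
  even_rel u y -> even_rel v z -> even_rel (a *: u + v) (a *: y + z).
Proof.
move=> [p0 [p1 [H0 H1 E ->]]] [q0 [q1 [H0' H1' E' ->]]].
exists (fun g => a *: p0 g + q0 g), (fun g => a *: p1 g + q1 g).
split=> //; [by apply: vmapD => //; exact: prmapZ..|move=> g].
by rewrite actD actZ E E' scalerDr addrACA.
Qed.

Lemma even_rel0 (M : ratmod) (y : M) : even_rel 0 y -> y = 0.
Proof.
move=> [p0 [p1 [H0 H1 E ->]]].
by have [] := prmap_uniq H0 H1 (fun g => etrans (esym (E g)) (act0 _ g)) 1%g.
Qed.

Lemma even_rel_act (M : ratmod) g (v y : M) : even_rel v y -> even_rel (act g v) (act g y).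
Proof.
move=> [p0 [p1 [H0 H1 E ->]]].
exists (fun x => p0 (x * g)%g), (fun x => p1 (x * g)%g).
split; [exact: prmap_mulr..|by move=> h; rewrite -actM|rewrite mul1g].
(* Both sides of x(yv) = (xy)v split into parts even and odd in y. *)
have [||x|H _] := @prmap_uniq M (fun y => act g (p0 y) - p0 (g * y)%g)
    (fun y => act g (p1 y) - p1 (g * y)%g) _ _ _ 1%g.
- apply: vmapD; first exact: (vmap_lin (lin_of (@act_linear k M g))).
  apply: (vmap_ext (prmapZ (-1) (prmap_mull g H0))) => z; exact: scaleN1r.
- apply: vmapD; first exact: (vmap_lin (lin_of (@act_linear k M g))).
  apply: (vmap_ext (prmapZ (-1) (prmap_mull g H1))) => z; exact: scaleN1r.
- by rewrite addrACA -opprD -E -actD -E actM subrr.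
by apply/eqP; rewrite -subr_eq0 -[X in _ - p0 X]mulg1 H.
Qed.

Lemma even_part_ex (M : ratmod) : exists h : rational_hom M M, forall v, even_rel v (h v).
Proof.
apply: rel_hom; [|exact: even_rel_lin|exact: even_rel0|exact: even_rel_act].
move=> v; have [p0 [p1 [H0 H1 E]]] := rmap_split (rmap_orbit v).
by exists (p0 1%g), p0, p1.
Qed.

Definition even_part (M : ratmod) := projT1 (cid (even_part_ex M)).

Lemma even_partP (M : ratmod) v : even_rel v (even_part M v).
Proof. by rewrite /even_part; case: cid. Qed.

Lemma even_rel_uniq (M : ratmod) (v y : M) : even_rel v y -> even_part M v = y.
Proof. exact: (rel_uniq (@even_rel_lin M) (@even_rel0 M) (@even_partP M v)). Qed.

Lemma even_part_nat (M N : ratmod) (a : rational_hom M N) v :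
  even_part N (a v) = a (even_part M v).
Proof.
apply: even_rel_uniq; have [p0 [p1 [H0 H1 E ->]]] := even_partP v.
exists (fun g => a (p0 g)), (fun g => a (p1 g)).
by split=> // [||g]; [exact: vmap_lin..|rewrite -hom_act E linearD].
Qed.

Lemma even_part_inv (M : ratmod) (v : M) : inv v -> even_part M v = v.
Proof.
move=> Hv; apply: even_rel_uniq; exists (fun=> v), (fun=> 0).
split=> [||g|] //; [exact: prmap_cst|exact: prmap0|by rewrite addr0].
Qed.

(** The projection to the even part is the identity on invariants, since their
    orbit maps are constant; being natural, it commutes with dimension shifting,
    so it is the identity on all cohomology. *)
Lemma even_part_cob n (M : ratmod) (z : Qn n M) :
  inv z -> cob (z - qn n (even_part M) z).
Proof.
elim: n M z => [|n IH] M z zi.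
  by rewrite -[qn 0 _ z]/(even_part M z) even_part_inv // subrr.
have H := ses_eta M; have Hn := ses_qn n H; have Hn1 := ses_qn n.+1 H.
have [w Hw] := (proj1 (Hle0P _ _) (relinj_acyclic n (relinj_co M))) _ (inv_hom (qn n.+1 (eta M)) zi).
set e := even_part.
have pw : inv (qn n (quo M) w).
  by apply/delta_eq0; rewrite -qmap_delta -Hw; exact: (ses_comp Hn1).
have Enat m (N N' : ratmod) (a : rational_hom N N') (y : Qn m N) :
    qn m (e N') (qn m a y) = qn m a (qn m (e N) y).
  rewrite -(qn_comp (c := hom_comp (e N') a)) // -(qn_comp (c := hom_comp a (e N))) //.
  by apply: qn_ext => v; exact: even_part_nat.
have [b [bi Hb]] : exists b, inv b /\ qn n (quo M) (w - qn n (e _) w) = qn n (quo M) b.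
  by have := IH _ _ pw; rewrite Enat -(linearB (hom_fun (qn n (quo M)))) => /(cob_lift H).
have [|y Hy] := ses_ker Hn (b := (w - qn n (e _) w) - b).
  by rewrite (linearB (hom_fun (qn n (quo M))) _ b) Hb subrr.
exists y; apply: (hom_inj (ses_inj Hn1)).
rewrite qmap_delta Hy (linearB (hom_fun (qn n.+1 (eta M)))) -Enat Hw.
rewrite (linearB (delta (Qn n (coMod M))) _ b) (proj2 (delta_eq0 b) bi) subr0.
by rewrite (linearB (delta (Qn n (coMod M)))) -qmap_delta.
Qed.

Definition odd_module (M : ratmod) := forall v : M, prmap true (fun g => act g v).

Lemma Hle_odd (M : ratmod) n : odd_module M -> Hle n M 0.
Proof.
move=> HM; apply/Hle0P => z /even_part_cob.
rewrite qn_0 ?subr0 // => v; apply: even_rel_uniq.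
exists (fun=> 0), (fun g => act g v).
by split=> // [|g]; [exact: prmap0|rewrite add0r].
Qed.

End ParityMaps.

(** * Tensoring with the natural module *)

Section Natural.
Variable k : closedFieldType.
Local Notation G := (SL2 k).
Local Notation ratmod := (rational_module k).

Lemma rmap_pi (N : lmodType k) (p : G -> 'I_2 -> N) :
  (forall i, rmap (fun g => p g i)) -> rmap p.
Proof.
move=> Hp.
pose d (i : 'I_2) (w : N) : 'I_2 -> N := fun l => if l == i then w else 0.
have dl i : linear (d i).
  move=> a u w; apply/funext => l; rewrite -[RHS]/(a *: d i u l + d i w l) /d.
  by case: eqP; rewrite // scaler0 addr0.
apply: (vmap_ext (vmapD (vmap_lin (lin_of (dl 0)) (Hp 0)) (vmap_lin (lin_of (dl 1)) (Hp 1)))).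
move=> g; apply/funext => l; rewrite -[LHS]/(d 0 (p g 0) l + d 1 (p g 1) l) /d.
by case: (ord2P l) => -> /=; rewrite ?addr0 ?add0r.
Qed.

Section Emod.
Variable M : ratmod.

(** The tensor product of M with the natural module E, as pairs of elements
    of M. *)
Definition e_act (g : G) (n : 'I_2 -> M) : 'I_2 -> M :=
  fun i => \sum_j val g i j *: act g (n j).

Fact e_act_linear g : linear (e_act g).
Proof.
move=> a u v; apply/funext => i.
rewrite -[RHS]/(a *: e_act g u i + e_act g v i) scaler_sumr -big_split.
by apply: eq_bigr => j _ /=; rewrite actD actZ scalerDr !scalerA mulrC.
Qed.
Fact e_act1 v : e_act 1%g v = v.
Proof.
apply/funext => i; rewrite /e_act (bigD1 i) //= big1 => [|j Hj].
  by rewrite mxE eqxx scale1r act1 addr0.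
by rewrite mxE eq_sym (negPf Hj) scale0r.
Qed.
Fact e_actM g h v : e_act (g * h)%g v = e_act g (e_act h v).
Proof.
apply/funext => i; rewrite /e_act sum_row_mul; apply: eq_bigr => j _.
by rewrite act_sum; congr (_ *: _); apply: eq_bigr => l _; rewrite actZ actM.
Qed.
Fact e_act_rational v : rmap (fun g => e_act g v).
Proof.
apply: rmap_pi => i; apply: rmap_sum => j; apply: rmapM; first exact: regular_coord.
exact: rmap_orbit.
Qed.

Definition Emod : ratmod :=
  @RationalModule k ('I_2 -> M) e_act e_act_linear e_act1 e_actM e_act_rational.

Lemma e_actE g (n : Emod) i : act g n i = \sum_j val g i j *: act g (n j : M).
Proof. by []. Qed.
Lemma e_linE a (u v : Emod) i : (a *: u + v) i = a *: (u i : M) + (v i : M).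
Proof. by []. Qed.
End Emod.

Lemma e_inj (M : ratmod) (u v : Emod M) : (forall i, u i = v i :> M) -> u = v.
Proof. by move=> H; apply/funext. Qed.

Section Emap.
Variables (M N : ratmod) (a : rational_hom M N).
Fact emap_linear : linear (fun (n : Emod M) => (fun i => a (n i)) : Emod N).
Proof. by move=> c u v; apply/e_inj => i; rewrite [RHS]e_linE -linearP. Qed.
Fact emap_act g (n : Emod M) : (fun i => a (act g n i)) = act g ((fun i => a (n i)) : Emod N).
Proof.
apply: (@e_inj N) => i; rewrite [RHS]e_actE [act g n i]e_actE linear_sum.
by apply: eq_bigr => j _; rewrite linearZ hom_act.
Qed.
Definition emap : rational_hom (Emod M) (Emod N) := hom_of emap_linear emap_act.
Lemma emapE n i : emap n i = a (n i). Proof. by []. Qed.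
End Emap.

Lemma ses_E (A B C : ratmod) (a : rational_hom A B) (p : rational_hom B C) :
  ses a p -> ses (emap a) (emap p).
Proof.
move=> [ai ps pk pc]; split.
- by move=> v Ev; apply: e_inj => i; apply: ai; rewrite -emapE Ev.
- move=> z; have [v Hv] := choice (fun i => ps (z i)).
  by exists v; apply: e_inj.
- move=> b Eb; have H i : p (b i) = 0 by rewrite -emapE Eb.
  have [v Hv] := choice (fun i => pk _ (H i)).
  by exists v; apply: e_inj.
- by move=> v; apply: e_inj => i; rewrite !emapE pc.
Qed.

(** The entries of the inverse matrix. *)
Definition ivc (x : G) (i j : 'I_2) : k :=
  if i == j then val x (other i) (other i) else - val x i j.

Lemma ivcE (x : G) i l : \sum_j ivc x i j * val x j l = (i == l)%:R.
Proof.
have D := SL2_det x; rewrite sum_ord2 /ivc /other.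
case: (ord2P i) => ->; case: (ord2P l) => ->; rewrite ?subr0 ?subrr /= ?mulNr.
- by rewrite mulrC.
- by rewrite [_ * val x 0 1]mulrC subrr.
- by rewrite addrC [X in X - _]mulrC subrr.
- by rewrite addrC [X in _ - X]mulrC.
Qed.

Lemma ivcE' (x : G) i l : \sum_j val x i j * ivc x j l = (i == l)%:R.
Proof.
have D := SL2_det x; rewrite sum_ord2 /ivc /other.
case: (ord2P i) => ->; case: (ord2P l) => ->; rewrite ?subr0 ?subrr /= ?mulrN.
- by [].
- by rewrite addrC [X in X - _]mulrC subrr.
- by rewrite [X in X - _]mulrC subrr.
- by rewrite addrC [X in _ - X]mulrC [X in X - _]mulrC.
Qed.

Lemma regular_ivc i j : regular (fun x : G => ivc x i j).
Proof.
rewrite /ivc; case: eqP => _; first exact: regular_coord.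
rewrite (_ : (fun=> _) = fun x : G => -1 * val x i j).
  by apply: regularM; [exact: regular_cst|exact: regular_coord].
by apply/funext => x; rewrite mulN1r.
Qed.

Lemma sum_row_inv (V : lmodType k) (a : 'I_2 -> k) (b : 'I_2 -> 'I_2 -> k) m (A : 'I_2 -> V) :
  (forall l, \sum_j a j * b j l = (m == l)%:R) -> \sum_j a j *: \sum_l b j l *: A l = A m.
Proof.
move=> H; under eq_bigr do rewrite scaler_sumr; rewrite exchange_big /= (bigD1 m) //= [X in _ + X]big1.
  by under eq_bigr do rewrite scalerA; rewrite -scaler_suml H eqxx scale1r addr0.
move=> j Hj; under eq_bigr do rewrite scalerA; rewrite -scaler_suml H.
by rewrite eq_sym (negPf Hj) scale0r.
Qed.

Lemma ivc_solve (N : lmodType k) (x : G) (A : 'I_2 -> N) :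
  (forall i, \sum_j val x i j *: A j = 0) -> forall j, A j = 0.
Proof.
move=> H m; rewrite -[LHS](sum_row_inv A (ivcE x m)).
by apply: big1 => i _; rewrite H scaler0.
Qed.

(** The tensor identity: twisting by the universal matrix makes the action on
    the natural factor trivial. *)
Lemma relinj_E_co (N : lmodType k) : relinj (Emod (coMod N)).
Proof.
have Hs (n : Emod (coMod N)) :
    rmap (fun x => (fun i => \sum_j val x i j *: coval (n j) x) : 'I_2 -> N).
  apply: rmap_pi => i; apply: rmap_sum => j; apply: rmapM; first exact: regular_coord.
  exact: coP.
have Hl : linear (fun n => mkco (Hs n)).
  move=> a u v; apply/co_inj => x; rewrite co_linE !mkcoE; apply/funext => i.
  rewrite -[RHS]/(a *: (\sum_j val x i j *: coval (u j) x) + \sum_j val x i j *: coval (v j) x).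
  rewrite scaler_sumr -big_split; apply: eq_bigr => j _ /=.
  rewrite -[LHS]/(val x i j *: (a *: coval (u j) x + coval (v j) x)).
  by rewrite scalerDr !scalerA mulrC.
have Ha g n : mkco (Hs (act g n)) = act g (mkco (Hs n)).
  apply/co_inj => x; rewrite co_actE !mkcoE; apply/funext => i.
  have E j : coval (act g n j) x = \sum_l val g j l *: coval (n l) (x * g)%g.
    rewrite sum_ord2 -[RHS]/(coval (val g j 0 *: act g (n 0) + val g j 1 *: act g (n 1)) x).
    by rewrite e_actE sum_ord2.
  by rewrite sum_row_mul; apply: eq_bigr => j _; rewrite E.
have [||b [Hb _]] := rel_inverse (a := hom_of Hl Ha).
- move=> n En; apply: e_inj => i; apply/co_inj => x.
  apply: (@ivc_solve N x (fun j => coval (n j) x)) => l.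
  by have := congr1 (fun f => coval f x l) En.
- move=> f.
  have Hr i : rmap (fun x => \sum_j ivc x i j *: coval f x j).
    apply: rmap_sum => j; apply: rmapM; first exact: regular_ivc.
    have evl : linear (fun n : 'I_2 -> N => n j) by [].
    exact: (vmap_lin (lin_of evl) (coP f)).
  exists ((fun i => mkco (Hr i)) : Emod (coMod N)).
  apply/co_inj => x; rewrite mkcoE; apply/funext => i.
  under eq_bigr do rewrite mkcoE.
  exact: (sum_row_inv (coval f x) (ivcE' x i)).
by apply: (relinj_retract Hb); exact: relinj_co.
Qed.

Lemma relinj_E (M : ratmod) : relinj M -> relinj (Emod M).
Proof.
move=> [r Hr]; apply: (relinj_retract (a := emap (eta M)) (b := emap r)).
  by move=> v; apply: e_inj => i; rewrite !emapE Hr.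
exact: relinj_E_co.
Qed.

(** * Frobenius twist *)

Hypothesis hk : 2%N \in [pchar k].
Local Notation frob := (frob hk).

Section Frmod.
Variable M : ratmod.

Definition fr_act (g : G) (v : M) : M := act (frob g) v.
Fact fr_act_linear g : linear (fr_act g). Proof. exact: act_linear. Qed.
Fact fr_act1 v : fr_act 1%g v = v. Proof. by rewrite /fr_act frob1 act1. Qed.
Fact fr_actM g h v : fr_act (g * h)%g v = fr_act g (fr_act h v).
Proof. by rewrite /fr_act frobM actM. Qed.
Fact fr_act_rational v : rmap (fun g => fr_act g v).
Proof. exact: rmap_frob (rmap_orbit v). Qed.
Definition Frmod : ratmod := RationalModule fr_act_linear fr_act1 fr_actM fr_act_rational.
Lemma fr_actE g (v : Frmod) : act g v = act (frob g) (v : M). Proof. by []. Qed.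
End Frmod.

Section Frmap.
Variables (M N : ratmod) (a : rational_hom M N).
Fact frmap_linear : linear (fun v : Frmod M => a v : Frmod N). Proof. exact: linearP. Qed.
Fact frmap_act g (v : Frmod M) : (a (act g v) : Frmod N) = act g (a v : Frmod N).
Proof. by rewrite !fr_actE hom_act. Qed.
Definition frmap : rational_hom (Frmod M) (Frmod N) := hom_of frmap_linear frmap_act.
End Frmap.

Lemma ses_Fr (A B C : ratmod) (a : rational_hom A B) (p : rational_hom B C) :
  ses a p -> ses (frmap a) (frmap p).
Proof. by move=> [ai ps pk pc]; split. Qed.

End Natural.

(** * Odd regular functions over the Frobenius subalgebra *)

Section OddFunctions.
Variable k : closedFieldType.
Local Notation G := (SL2 k).
Local Notation ratmod := (rational_module k).
Hypothesis hk : 2%N \in [pchar k].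
Local Notation frob := (frob hk).

Lemma elem0 i : elem i 0 = 1%g :> G.
Proof. by apply/val_inj; rewrite /= scale0r addr0. Qed.

Lemma frob_elem_mul i s (x : G) : frob (elem i s * x)%g = (elem i (s ^+ 2) * frob x)%g.
Proof. by rewrite frobM frob_elem. Qed.

Section Independence.
Variable N : lmodType k.
Implicit Types A C : 'I_2 -> G -> N.

(** Add t times the row other than i to row i and compare the odd powers of t:
    the Frobenius image of x changes through t^2 only. *)
Lemma frob_relation_other i A C : (forall j, rmap (A j)) -> (forall j, rmap (C j)) ->
  (forall x : G, \sum_j val x i j *: A j (frob x) +
             \sum_j val x (other i) j *: C j (frob x) = 0) ->
  forall x : G, \sum_j val x (other i) j *: A j (frob x) = 0.
Proof.
move=> HA HC H x.
pose P r := \sum_j val x i j *: A j (elem i r * frob x)%g +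
            \sum_j val x (other i) j *: C j (elem i r * frob x)%g.
pose R r := \sum_j val x (other i) j *: A j (elem i r * frob x)%g.
have HP : polyn P.
  by apply: polynD; apply: polyn_sum => j; apply: polynZ; exact: rmap_elem.
have HR : polyn R by apply: polyn_sum => j; apply: polynZ; exact: rmap_elem.
have [t _|_] := even_odd_inj HP HR _ 0; last by rewrite /R elem0 mul1g.
rewrite -[RHS](H (elem i t * x)%g) /P /R frob_elem_mul addrAC; congr (_ + _).
  rewrite scaler_sumr -big_split; apply: eq_bigr => j _ /=.
  by rewrite elem_mul scalerDl scalerA.
by apply: eq_bigr => j _; rewrite elem_mul_other.
Qed.

Lemma other_other i : other (other i) = i.
Proof. by rewrite /other opprB addrC subrK. Qed.

(** By row operations the coefficients A satisfy the same linear relation with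
    each of the two rows, and the matrix x is invertible. *)
Lemma frob_indep i A C : (forall j, rmap (A j)) -> (forall j, rmap (C j)) ->
  (forall x : G, \sum_j val x i j *: A j (frob x) +
             \sum_j val x (other i) j *: C j (frob x) = 0) ->
  forall j x, A j x = 0.
Proof.
move=> HA HC H j y; have [x <-] := frob_surj hk y.
have H1 := frob_relation_other HA HC H.
have H2 : forall x : G, \sum_j val x i j *: A j (frob x) = 0.
  have := @frob_relation_other (other i) A (fun _ _ => 0) HA (fun _ => rmap_cst 0).
  rewrite other_other; apply=> z; rewrite H1 add0r.
  by apply: big1 => l _; rewrite scaler0.
apply: (@ivc_solve k N x (fun j => A j (frob x))) => l.
have [->|->] : l = i \/ l = other i; last by exact: H1.
  by case: (ord2P i) => ->; case: (ord2P l) => ->; [left|right|right|left]; apply/val_inj.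
exact: H2.
Qed.

End Independence.

(** The span of the matrix entries over the functions of F(x). The next lemmas
    show that it contains all odd regular functions, by reducing the products of
    three entries to single entries with squares as coefficients. *)
Definition ospan (f : G -> k) := exists a : 'I_2 * 'I_2 -> G -> k,
  (forall u, regular (a u)) /\ forall x, f x = \sum_u val x u.1 u.2 * a u (frob x).

Lemma ospan_ext f h : ospan f -> f =1 h -> ospan h.
Proof. by move=> Hf /funext <-. Qed.

Lemma ospan_gen r j (a : G -> k) : regular a -> ospan (fun x : G => val x r j * a (frob x)).
Proof.
move=> Ha; exists (fun u x => if u == (r, j) then a x else 0); split.
  by move=> u; case: eqP => // _; exact: regular_cst.
move=> x; rewrite (bigD1 (r, j)) //= eqxx big1 ?addr0 // => u /negPf ->.
by rewrite mulr0.
Qed.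

Lemma ospan_coord r j : ospan (fun x : G => val x r j).
Proof.
by apply: (ospan_ext (ospan_gen r j (regular_cst 1))) => x; rewrite mulr1.
Qed.

Lemma ospanD f h : ospan f -> ospan h -> ospan (fun x => f x + h x).
Proof.
move=> [a [Ha E]] [b [Hb E']]; exists (fun u x => a u x + b u x); split.
  by move=> u; exact: regularD.
by move=> x; rewrite E E' -big_split; apply: eq_bigr => u _; rewrite mulrDr.
Qed.

Lemma ospan0 : ospan (fun=> 0).
Proof.
by apply: (ospan_ext (ospan_gen 0 0 (regular_cst 0))) => x; rewrite mulr0.
Qed.

Lemma ospan_sum (I : Type) (r : seq I) (f : I -> G -> k) :
  (forall i, ospan (f i)) -> ospan (fun x => \sum_(i <- r) f i x).
Proof.
move=> H; elim: r => [|i r IH].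
  by apply: (ospan_ext ospan0) => x; rewrite big_nil.
by apply: (ospan_ext (ospanD (H i) IH)) => x; rewrite big_cons.
Qed.

Lemma ospanM f (a : G -> k) : ospan f -> regular a -> ospan (fun x => f x * a (frob x)).
Proof.
move=> [b [Hb E]] Ha; exists (fun u x => b u x * a x); split.
  by move=> u; exact: regularM.
by move=> x; rewrite E mulr_suml; apply: eq_bigr => u _; rewrite mulrA.
Qed.

Let opp (u : 'I_2 * 'I_2) := (other u.1, other u.2).
Let X (u : 'I_2 * 'I_2) (x : G) : k := val x u.1 u.2.

Lemma ospan_sqr u v : ospan (fun x => X u x * X u x * X v x).
Proof.
apply: (ospan_ext (ospan_gen v.1 v.2 (@regular_coord k u.1 u.2))) => x.
by rewrite frobE expr2 mulrC.
Qed.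

Lemma det_opp u (x : G) : X u x * X (opp u) x + X (u.1, other u.2) x * X (other u.1, u.2) x = 1.
Proof.
rewrite -(SL2_det_char2 hk x) /X /opp /other.
case: u => i j /=; case: (ord2P i) => ->; case: (ord2P j) => -> /=; rewrite ?subr0 ?subrr.
- by [].
- by rewrite addrC.
- by rewrite addrC mulrC [X in _ + X]mulrC.
- by rewrite mulrC [X in _ + X]mulrC.
Qed.

(** If v is not on the diagonal of u and [opp u], then it is on the other one,
    and the determinant exchanges the products of the two diagonals up to
    1. *)
Lemma ospan_opp u v : ospan (fun x => X u x * X (opp u) x * X v x).
Proof.
have [->|uv] := eqVneq v u.
  by apply: (ospan_ext (ospan_sqr u (opp u))) => x; rewrite mulrAC.
have [->|uv'] := eqVneq v (opp u).
  by apply: (ospan_ext (ospan_sqr (opp u) u)) => x; rewrite mulrAC -mulrA mulrC.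
set w := opp v; have E x : X u x * X (opp u) x = 1 + X v x * X w x.
  apply/eqP; rewrite -subr_eq (opp_char2 hk (_ : k^o)); apply/eqP.
  rewrite -(det_opp u x); congr (_ + _).
  move: uv uv'; rewrite /w /X /opp /other {w}; case: u => a b; case: v => c d /=.
  by case: (ord2P a) => ->; case: (ord2P b) => ->; case: (ord2P c) => ->;
    case: (ord2P d) => -> //=; rewrite ?subr0 ?subrr // mulrC.
apply: (ospan_ext (ospanD (ospan_coord v.1 v.2) (ospan_sqr v w))) => x.
by rewrite E mulrDl mul1r mulrAC.
Qed.

(** Among three positions in a square matrix of size 2, two coincide or are
    diagonally opposite. *)
Lemma ospan_tri u w t : ospan (fun x => X u x * X w x * X t x).
Proof.
have : [|| w == u, t == u, t == w, w == opp u, t == opp u | t == opp w].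
  rewrite /opp /other; case: u => a b; case: w => c d; case: t => e f.
  by case: (ord2P a) => ->; case: (ord2P b) => ->; case: (ord2P c) => ->;
    case: (ord2P d) => ->; case: (ord2P e) => ->; case: (ord2P f) => ->.
case/or4P => [/eqP->|/eqP->|/eqP->|/or3P[]/eqP->].
- exact: ospan_sqr.
- by apply: (ospan_ext (ospan_sqr u w)) => x; rewrite mulrAC.
- by apply: (ospan_ext (ospan_sqr w u)) => x; rewrite mulrC mulrA.
- exact: ospan_opp.
- by apply: (ospan_ext (ospan_opp u w)) => x; rewrite mulrAC.
- by apply: (ospan_ext (ospan_opp w u)) => x; rewrite mulrC mulrA.
Qed.

Lemma ospan_pair u w f : ospan f -> ospan (fun x => X u x * X w x * f x).
Proof.
move=> [a [Ha E]].
apply: (ospan_ext (ospan_sum (f := fun t x => X u x * X w x * X t x * a t (frob x)) _ _)).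
  by move=> t; apply: ospanM; [exact: ospan_tri|].
by move=> x; rewrite E mulr_sumr; apply: eq_bigr => t _; rewrite mulrA.
Qed.

Lemma ospan_mul3 f h o : ospan f -> ospan h -> ospan o -> ospan (fun x => f x * h x * o x).
Proof.
move=> [a [Ha E]] [b [Hb E']] Ho.
apply: (ospan_ext (ospan_sum (f := fun u x => \sum_w
    X u x * X w x * o x * (a u (frob x) * b w (frob x))) _ _)).
  move=> u; apply: ospan_sum => w.
  by apply: (@ospanM _ (fun x => a u x * b w x)); [exact: ospan_pair|exact: regularM].
move=> x; rewrite E E' big_distrlr mulr_suml; apply: eq_bigr => u _ /=.
rewrite mulr_suml; apply: eq_bigr => w _; rewrite /X; ring.
Qed.

(** The odd part is reached only together with the statement that even
    functions preserve the span. *)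
Lemma preg_ospan b f : preg b f -> if b then ospan f else forall o, ospan o -> ospan (fun x => f x * o x).
Proof.
elim=> [c|i j|{}b g h _ Hg _ Hh|{}b c g h _ Hg _ Hh].
- move=> o [a [Ha E]]; exists (fun u x => c * a u x); split.
    by move=> u; apply: regularM => //; exact: regular_cst.
  by move=> x; rewrite E mulr_sumr; apply: eq_bigr => u _; rewrite mulrCA.
- exact: ospan_coord.
- case: b Hg Hh => [|Hg Hh o Ho]; first exact: ospanD.
  by apply: (ospan_ext (ospanD (Hg o Ho) (Hh o Ho))) => x; rewrite mulrDl.
case: b Hg; case: c Hh => /= Hh Hg.
- by move=> o Ho; exact: ospan_mul3.
- by apply: (ospan_ext (Hh _ Hg)) => x; rewrite mulrC.
- exact: Hg.
- by move=> o Ho; apply: (ospan_ext (Hg _ (Hh _ Ho))) => x; rewrite mulrA.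
Qed.

(** ** A relatively injective twist *)

Section Decomposition.
Variable N : lmodType k.

Lemma fr_co_actE g (n : Emod (Frmod hk (coMod N))) j x :
  coval (act g n j : coMod N) x = \sum_l val g j l *: coval (n l : coMod N) (x * frob g)%g.
Proof.
rewrite sum_ord2 -[RHS]/(coval (val g j 0 *: act (frob g) (n 0 : coMod N)
  + val g j 1 *: act (frob g) (n 1 : coMod N)) x).
by rewrite e_actE sum_ord2.
Qed.

(** The coordinate ring is the sum of its even part and of the spans of the two
    rows over the functions of F(x). Right translations respect these three
    summands, because they combine the entries of a row; n collects the
    coefficients of f in the span of row 0. *)
Definition odd_rel (f : coMod N) (n : Emod (Frmod hk (coMod N))) :=
  exists (e : G -> N) (m : 'I_2 -> G -> N), [/\ prmap false e, forall j, rmap (m j) &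
    forall x, coval f x = e x + \sum_j val x 0 j *: coval (n j : coMod N) (frob x)
                        + \sum_j val x 1 j *: m j (frob x)].

Lemma rmap_odd (p : G -> N) : rmap p -> exists (e : G -> N) (n m : 'I_2 -> G -> N),
  [/\ prmap false e, forall j, rmap (n j), forall j, rmap (m j) &
    forall x, p x = e x + \sum_j val x 0 j *: n j (frob x) + \sum_j val x 1 j *: m j (frob x)].
Proof.
move: p; apply: rmap_ind => [|f w Hf|p q].
- exists (fun=> 0), (fun _ _ => 0), (fun _ _ => 0).
  split; [exact: prmap0|by move=> _; exact: rmap_cst|by move=> _; exact: rmap_cst|move=> x].
  by rewrite !big1 ?addr0 // => j _; rewrite scaler0.
- have [f0 [f1 [H0 H1 E]]] := regular_split Hf.
  have [a [Ha Ea]] := preg_ospan H1.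
  exists (fun x => f0 x *: w), (fun j x => a (0, j) x *: w), (fun j x => a (1, j) x *: w).
  split; [exact: vmap1|by move=> j; exact: vmap1|by move=> j; exact: vmap1|move=> x].
  rewrite E Ea scalerDl -addrA; congr (_ + _).
  have -> : \sum_u val x u.1 u.2 * a u (frob x) = \sum_i \sum_j val x i j * a (i, j) (frob x).
    by rewrite pair_bigA; apply: eq_bigr => -[].
  rewrite sum_ord2 scalerDl !scaler_suml.
  by congr (_ + _); apply: eq_bigr => j _; rewrite scalerA.
move=> [e [n [m [He Hn Hm E]]]] [e' [n' [m' [He' Hn' Hm' E']]]].
exists (fun x => e x + e' x), (fun j x => n j x + n' j x), (fun j x => m j x + m' j x).
split; [exact: vmapD|by move=> j; exact: vmapD|by move=> j; exact: vmapD|move=> x].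
rewrite E E' addrACA; congr (_ + _); last first.
  by rewrite -big_split; apply: eq_bigr => j _; rewrite scalerDr.
rewrite addrACA; congr (_ + _).
by rewrite -big_split; apply: eq_bigr => j _; rewrite scalerDr.
Qed.

Lemma prmap_frob (p : G -> N) : rmap p -> prmap false (fun x => p (frob x)) .
Proof.
have H f : regular f -> preg false (fun x => f (frob x)).
  move: f; apply: regular_ind => [c|i j|f h|f h].
  - exact: preg_cst.
  - apply: (preg_ext (preg_mul (preg_coord k i j) (preg_coord k i j))) => x.
    by rewrite frobE.
  - exact: preg_add.
  - exact: (@preg_mul k false false).
move=> [n [f [w [Hf E]]]]; exists n, (fun i x => f i (frob x)), w.
by split=> // i; exact: H.
Qed.

Lemma odd_rel0 (n : Emod (Frmod hk (coMod N))) : odd_rel 0 n -> n = 0.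
Proof.
move=> [e [m [He Hm E]]].
have Ho (A : 'I_2 -> G -> N) i : (forall j, rmap (A j)) ->
    prmap true (fun x => \sum_j val x i j *: A j (frob x)).
  move=> HA; apply: (vmap_ext (p := fun x => val x i 0 *: A 0 (frob x) + val x i 1 *: A 1 (frob x))).
    by apply: vmapD; apply: (@prmapM _ _ true false);
      [exact: preg_coord|exact: prmap_frob|exact: preg_coord|exact: prmap_frob].
  by move=> x; rewrite sum_ord2.
have Hn j : rmap (coval (n j : coMod N)) by exact: coP.
have H := prmap_uniq He (vmapD (Ho _ 0 Hn) (Ho _ 1 Hm)).
have {}H (x : G) : \sum_j val x 0 j *: coval (n j : coMod N) (frob x)
    + \sum_j val x 1 j *: m j (frob x) = 0.
  by have [] // := H _ x => g; rewrite addrA -E.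
apply: e_inj => j; apply: (@co_inj _ N) => x.
apply: (@frob_indep N 0 (fun j => coval (n j : coMod N)) m) => // y.
by rewrite -[RHS](H y) /other subr0.
Qed.

Lemma odd_rel_lin a u v y z : odd_rel u y -> odd_rel v z -> odd_rel (a *: u + v) (a *: y + z).
Proof.
move=> [e [m [He Hm E]]] [e' [m' [He' Hm' E']]].
exists (fun x => a *: e x + e' x), (fun j x => a *: m j x + m' j x).
split; [by apply: vmapD => //; exact: prmapZ|by move=> j; apply: vmapD => //; exact: rmapZ|].
move=> x; rewrite co_linE E E' !scalerDr addrACA; congr (_ + _); last first.
  rewrite scaler_sumr -big_split; apply: eq_bigr => j _ /=.
  by rewrite scalerDr !scalerA mulrC.
rewrite addrACA; congr (_ + _).
rewrite scaler_sumr -big_split; apply: eq_bigr => j _.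
rewrite -[RHS]/(val x 0 j *: (a *: coval (y j : coMod N) (frob x) + coval (z j : coMod N) (frob x))).
by rewrite scalerDr !scalerA mulrC.
Qed.

Lemma odd_rel_act g f n : odd_rel f n -> odd_rel (act g f) (act g n).
Proof.
move=> [e [m [He Hm E]]].
exists (fun x => e (x * g)%g), (fun j x => \sum_l val g j l *: m l (x * frob g)%g).
split.
- exact: prmap_mulr.
- by move=> j; apply: rmap_sum => l; apply: rmapZ; exact: rmap_mulr.
move=> x; rewrite co_actE E; congr (_ + _ + _).
  by rewrite frobM sum_row_mul; apply: eq_bigr => j _; rewrite fr_co_actE.
by rewrite frobM sum_row_mul.
Qed.

(** For p = 2 the natural module is the Steinberg module, and its tensor
    product with a twisted coinduced module is the span of one row of entries over
    the functions of F(x), a direct summand of the coordinate ring. *)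
Lemma relinj_E_Fr_co : relinj (Emod (Frmod hk (coMod N))).
Proof.
have [r Hr] : exists h : rational_hom (coMod N) (Emod (Frmod hk (coMod N))),
    forall v, odd_rel v (h v).
  apply: rel_hom; [|exact: odd_rel_lin|exact: odd_rel0|exact: odd_rel_act].
  move=> f; have [e [n [m [He Hn Hm E]]]] := rmap_odd (coP f).
  exists ((fun j => mkco (Hn j)) : Emod (Frmod hk (coMod N))), e, m.
  by split.
have Hs (n : Emod (Frmod hk (coMod N))) :
    rmap (fun x => \sum_j val x 0 j *: coval (n j : coMod N) (frob x)).
  apply: rmap_sum => j; apply: rmapM; first exact: regular_coord.
  exact/rmap_frob/coP.
have Hrel n : odd_rel (mkco (Hs n)) n.
  exists (fun=> 0), (fun _ _ => 0); split; [exact: prmap0|by move=> _; exact: rmap_cst|move=> x].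
  by rewrite mkcoE add0r [X in _ + X]big1 ?addr0 // => j _; rewrite scaler0.
have uniq := rel_uniq odd_rel_lin (@odd_rel0).
have Hl : linear (fun n => mkco (Hs n)).
  move=> a u v; apply/co_inj => x; rewrite co_linE !mkcoE.
  rewrite scaler_sumr -big_split; apply: eq_bigr => j _ /=.
  rewrite -[LHS]/(val x 0 j *: (a *: coval (u j : coMod N) (frob x) + coval (v j : coMod N) (frob x))).
  by rewrite scalerDr !scalerA mulrC.
have Ha g n : mkco (Hs (act g n)) = act g (mkco (Hs n)).
  apply/co_inj => x; rewrite co_actE !mkcoE.
  by rewrite frobM sum_row_mul; apply: eq_bigr => j _; rewrite fr_co_actE.
apply: (relinj_retract (a := hom_of Hl Ha) (b := r)); last exact: relinj_co.
by move=> n; exact: uniq (Hr _) (Hrel n).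
Qed.

End Decomposition.

(** * The functor E (x) E (x) M^F *)

Definition Tw (M : ratmod) : ratmod := Emod (Emod (Frmod hk M)).
Definition tw (M N : ratmod) (a : rational_hom M N) : rational_hom (Tw M) (Tw N) :=
  emap (emap (frmap hk a)).

Lemma ses_tw (A B C : ratmod) (a : rational_hom A B) (p : rational_hom B C) :
  ses a p -> ses (tw a) (tw p).
Proof. by move=> H; do 2!apply: ses_E; exact: ses_Fr. Qed.

Lemma tw_actE (M : ratmod) g (n : Tw M) i j :
  (act g n) i j = \sum_a \sum_b (val g i a * val g j b) *: act (frob g) (n a b : M) :> M.
Proof.
rewrite e_actE sum_ord2.
rewrite -[LHS]/(val g i 0 *: (act g (n 0 : Emod (Frmod hk M)) j : M)
  + val g i 1 *: (act g (n 1 : Emod (Frmod hk M)) j : M)).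
rewrite !e_actE [RHS]sum_ord2; congr (_ + _); rewrite scaler_sumr;
  by apply: eq_bigr => b _; rewrite scalerA.
Qed.

Lemma relinj_tw_co (N : lmodType k) : relinj (Tw (coMod N)).
Proof. exact/relinj_E/relinj_E_Fr_co. Qed.

Lemma tw_inj (M : ratmod) (n n' : Tw M) : (forall i j, n i j = n' i j :> M) -> n = n'.
Proof. by move=> H; apply: e_inj => i; apply: e_inj => j; exact: H. Qed.

(** The product of v with the determinant in E (x) E. It is a symmetric tensor
    without signs, as the characteristic is 2. *)
Definition sym (M : ratmod) (v : M) : Tw M := fun i j => if i == j then 0 else v.

Lemma sym_inv (M : ratmod) (v : M) : inv v -> inv (sym v).
Proof.
move=> Hv g; apply: tw_inj => i j.
have D := SL2_det_char2 hk g.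
rewrite tw_actE !sum_ord2 /sym /= !act0 !scaler0 add0r addr0 Hv -scalerDl.
case: (ord2P i) => ->; case: (ord2P j) => -> /=.
- by rewrite mulrC -mulr2n (mulrn_pchar hk) scale0r.
- by rewrite D scale1r.
- by rewrite addrC mulrC [X in _ + X]mulrC D scale1r.
- by rewrite mulrC -mulr2n (mulrn_pchar hk) scale0r.
Qed.

(** Under the root subgroups the invariance equations are polynomial in the
    parameter, and M^F only contributes even powers. The odd powers kill the
    diagonal components; the rest is the multiple of the determinant by an
    element invariant under F(g), hence under all of G, as F is surjective. *)
Lemma tw_inv (M : ratmod) (n : Tw M) : inv n ->
  inv (n 0 1 : M) /\ n = sym (n 0 1 : M).
Proof.
move=> Hn.
have Hq (v : M) i : polyn (fun r => act (elem i r) v).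
  apply: (polyn_ext (rmap_elem i 1%g (rmap_orbit v))) => r; by rewrite mulg1.
have other_neq i : (other i == i) = false by case: (ord2P i) => ->.
have el i s : [/\ val (elem i s) i i = 1 :> k, val (elem i s) i (other i) = s,
    val (elem i s) (other i) i = 0 & val (elem i s) (other i) (other i) = 1].
  rewrite /= !mxE !eqxx other_neq eq_sym other_neq /=.
  by rewrite mulr0 mulr1 !addr0 add0r.
have sum_oth (f : 'I_2 -> M) i : \sum_j f j = f i + f (other i).
  rewrite sum_ord2 /other; case: (ord2P i) => ->; rewrite ?subr0 ?subrr //.
  by rewrite addrC.
have diag i : (n (other i) (other i) : M) = 0.
  have [||t _|_ H] := even_odd_inj (p := fun r => act (elem i r) (n i (other i) : M) - n i (other i))
     (q := fun r => act (elem i r) (n (other i) (other i) : M)) _ _ _ 0.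
  - by apply: polynD; [exact: Hq|exact: polyn_cst].
  - exact: Hq.
  - have := congr1 (fun m : Tw M => m i (other i) : M) (Hn (elem i t)).
    rewrite tw_actE (sum_oth _ i) !(sum_oth _ i); have [-> -> -> ->] := el i t.
    rewrite !mulr0 !mulr1 !scale0r !add0r scale1r frob_elem => E.
    by rewrite addrAC E subrr.
  - by move: H; rewrite elem0 act1.
have d0 : (n 0 0 : M) = 0 by have := diag 1; rewrite /other subrr.
have d1 : (n 1 1 : M) = 0 by have := diag 0; rewrite /other subr0.
have s01 : (n 1 0 : M) = n 0 1.
  have := congr1 (fun m : Tw M => m 0 0 : M) (Hn (elem 0 1)).
  rewrite tw_actE !sum_ord2; have := el 0 1; rewrite /other subr0 => -[-> -> _ _].
  rewrite d0 d1 !mulr1 !act0 !scaler0 add0r addr0 !scale1r -actD -[RHS](act0 M (frob (elem 0 1))).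
  move=> /(congr1 (act (frob (elem 0 1))^-1%g)); rewrite -!actM mulVg !act1 => /eqP.
  by rewrite addrC addr_eq0 (opp_char2 hk) => /eqP.
split.
  move=> g; have [h <-] := frob_surj hk g.
  have := congr1 (fun m : Tw M => m 0 1 : M) (Hn h).
  rewrite tw_actE !sum_ord2 d0 d1 s01 !act0 !scaler0 add0r addr0 -scalerDl.
  by rewrite (SL2_det_char2 hk h) scale1r.
apply: tw_inj => i j; rewrite /sym.
by case: (ord2P i) => ->; case: (ord2P j) => -> /=.
Qed.

Fact tw01_linear (M : ratmod) : linear (fun n : Tw M => n 0 1 : M).
Proof. by []. Qed.

(** Tw is exact, makes coinduced modules acyclic and does not change invariants,
    so dimension shifting applies on both sides. *)
Lemma Hle_tw (M : ratmod) n d : Hle n M d -> Hle n (Tw M) d.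
Proof.
elim: n M => [|n IH] M HM.
  apply: (spans_inj (f := lin_of (@tw01_linear M)) _ _ _ _ _ HM).
  - exact: inv0.
  - exact: inv_lin.
  - exact: (@cob_lin _ 0 M).
  - by move=> z /tw_inv[].
  - move=> z /tw_inv[_ ->] /= H; apply: tw_inj => i j.
    by rewrite /sym; case: eqP => //; move: H; rewrite /sym /=.
have H := LES_right (ses_eta M) HM.
have Htw := ses_tw (ses_eta M).
have Hacyc m : Hle m.+1 (Tw (coMod M)) 0 by apply/relinj_acyclic/relinj_tw_co.
suff HC : Cle n (tw (quo M)) d by have := LES_left Htw HC (Hacyc n); rewrite addn0.
case: n IH H {HM Hacyc} => [|n] IH H; last first.
  apply: (Cle_of_Hle Htw); apply: IH.
  by apply: Hle_of_Cle H; apply/relinj_acyclic/relinj_co.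
apply: (spans_inj (f := lin_of (@tw01_linear (Q M))) _ _ _ _ _ H).
- exact: inv0.
- exact: inv_lin.
- move=> c u v [b [bi ->]] [b' [bi' ->]]; exists (c *: b + b').
  by split; [exact: inv_lin|rewrite [RHS]linearP].
- by move=> z /tw_inv[].
- move=> z /tw_inv[_ Ez] [b [bi Hb]]; exists (sym b); split; first exact: sym_inv.
  rewrite Ez; apply: tw_inj => i j.
  rewrite -[RHS]/(quo M (sym b i j : coMod M)) /sym; case: eqP => _; first by rewrite linear0.
  exact: Hb.
Qed.

End OddFunctions.

(** * Symmetric powers of the natural module *)

Section SymmetricPowers.
Variable k : closedFieldType.
Local Notation G := (SL2 k).
Local Notation ratmod := (rational_module k).

Definition lform (a c : k) : {poly k} := a *: 'X + c%:P.

Definition hform m (p : {poly k}) (v : 'rV[k]_2) : k :=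
  \sum_(j < m.+1) p`_j * (v 0 0 ^+ j * v 0 1 ^+ (m - j)).

Lemma coef_lform_mul a c (p : {poly k}) j :
  (lform a c * p)`_j = a * (if j is i.+1 then p`_i else 0) + c * p`_j.
Proof.
rewrite /lform mulrDl coefD -scalerAl coefZ coefXM coefCM; congr (_ * _ + _).
by case: j.
Qed.

Lemma hform_lform m a c (p : {poly k}) v : (size p <= m.+1)%N ->
  hform m.+1 (lform a c * p) v = (a * v 0 0 + c * v 0 1) * hform m p v.
Proof.
move=> Hp; rewrite /hform.
under eq_bigr do rewrite coef_lform_mul mulrDl.
rewrite big_split /= mulrDl; congr (_ + _).
  rewrite big_ord_recl /= mulr0 mul0r add0r mulr_sumr; apply: eq_bigr => j _.
  by rewrite /bump /= add1n subSS exprS; ring.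
rewrite big_ord_recr /= (nth_default 0 Hp) mulr0 mul0r addr0 mulr_sumr; apply: eq_bigr => j _.
rewrite subSn -1?ltnS // exprS; ring.
Qed.

Lemma size_lform a c : (size (lform a c) <= 2)%N.
Proof.
apply: leq_trans (size_polyD _ _) _; rewrite geq_max.
rewrite (leq_trans (size_scale_leq _ _)) ?size_polyX //=.
by rewrite (leq_trans (size_polyC_leq1 _)).
Qed.

Lemma size_lform_exp a c i : (size (lform a c ^+ i) <= i.+1)%N.
Proof.
apply: leq_trans (size_poly_exp_leq _ _) _; rewrite ltnS.
by have := size_lform a c; case: (size _) => [|[|[|s]]] //= _; rewrite ?mul0n ?mul1n.
Qed.

Lemma hform_prod i j a c b d v :
  hform (i + j) (lform a c ^+ i * lform b d ^+ j) v =
    (a * v 0 0 + c * v 0 1) ^+ i * (b * v 0 0 + d * v 0 1) ^+ j.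
Proof.
elim: i => [|i IH].
  rewrite add0n !mul1r; elim: j => [|j IH].
    by rewrite /hform big_ord1 coef1 !expr0 !mul1r.
  by rewrite exprS hform_lform ?size_lform_exp // IH exprS.
rewrite addSn exprS -mulrA hform_lform ?IH ?exprS ?mulrA //.
apply: leq_trans (size_polyMleq _ _) _.
have := size_lform_exp a c i; have := size_lform_exp b d j; lia.
Qed.

Definition mon m (v : 'rV[k]_2) : 'cV[k]_m.+1 := \col_i (v 0 0 ^+ i * v 0 1 ^+ (m - i)).

(** The matrix of a substitution on the binary monomials of degree m. *)
Definition subst m (A : 'M[k]_2) : 'M[k]_m.+1 :=
  \matrix_(i, j) (lform (A 0 0) (A 1 0) ^+ i * lform (A 0 1) (A 1 1) ^+ (m - i))`_j.

Lemma substE m A v : subst m A *m mon m v = mon m (v *m A).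
Proof.
apply/colP => i; rewrite !mxE !sum_ord2.
have Hi : (i <= m)%N by rewrite -ltnS.
have := hform_prod i (m - i) (A 0 0) (A 1 0) (A 0 1) (A 1 1) v; rewrite subnKC // => E.
rewrite [v 0 0 * A 0 0]mulrC [v 0 1 * A 1 0]mulrC [v 0 0 * _]mulrC [v 0 1 * _]mulrC -E.
by apply: eq_bigr => j _; rewrite !mxE.
Qed.

Definition rv (t : k) : 'rV[k]_2 := \row_j (if j == 0 then t else 1).

Lemma mon_rv m t i : mon m (rv t) i 0 = t ^+ i.
Proof. by rewrite !mxE /= expr1n mulr1. Qed.

(** Forms are determined by their values on the affine line x_1 = 1. This
    makes the identities between matrices below identities between forms. *)
Lemma mon_sep0 p m (X : 'M[k]_(p, m.+1)) : (forall t, X *m mon m (rv t) = 0) -> X = 0.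
Proof.
move=> H; apply/matrixP => i j; rewrite mxE.
have := @sum_pow_injk k m.+1 (fun q => X i (inord q)) _ j (ltn_ord j); rewrite inord_val; apply.
move=> t _; have := congr1 (fun Y : 'cV_p => Y i 0) (H t); rewrite !mxE => E; rewrite -[RHS]E.
by apply: eq_bigr => q _; rewrite mon_rv inord_val mulrC.
Qed.

Lemma mon_sep p m (X Y : 'M[k]_(p, m.+1)) :
  (forall v, X *m mon m v = Y *m mon m v) -> X = Y.
Proof.
move=> H; apply/eqP; rewrite -subr_eq0; apply/eqP/mon_sep0 => t.
by rewrite mulmxBl H subrr.
Qed.

Lemma substM m A B : subst m (A *m B) = subst m B *m subst m A.
Proof. by apply: mon_sep => v; rewrite -mulmxA !substE mulmxA. Qed.

Lemma subst1 m : subst m 1%:M = 1%:M.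
Proof. by apply: mon_sep => v; rewrite substE mulmx1 mul1mx. Qed.

Lemma preg_sum (I : Type) (r : seq I) b (f : I -> G -> k) :
  (forall i, preg b (f i)) -> preg b (fun g => \sum_(i <- r) f i g).
Proof.
move=> H; elim: r => [|i r IH].
  by apply: (preg_ext (preg0 k b)) => g; rewrite big_nil.
by apply: (preg_ext (preg_add (H i) IH)) => g; rewrite big_cons.
Qed.

Lemma preg_subst m (u : G -> 'M[k]_2) : (forall i j, preg true (fun g => u g i j)) ->
  forall i j, preg (odd m) (fun g => subst m (u g) i j).
Proof.
move=> Hu.
pose pp b (P : G -> {poly k}) := forall j, preg b (fun g => (P g)`_j).
have ppM b c P P' : pp b P -> pp c P' -> pp (b (+) c) (fun g => P g * P' g).
  move=> HP HP' j; apply: (preg_ext (f := fun g => \sum_(i < j.+1) (P g)`_i * (P' g)`_(j - i))).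
    by apply: preg_sum => i; exact: preg_mul.
  by move=> g; rewrite coefM.
have ppl (a c : G -> k) : preg true a -> preg true c -> pp true (fun g => lform (a g) (c g)).
  move=> Ha Hc j; apply: (preg_ext (f := fun g => (j == 1%N)%:R * a g + (j == 0%N)%:R * c g)).
    by apply: preg_add; exact: preg_scale.
  move=> g; rewrite /lform coefD coefZ coefX coefC mulrC; congr (_ + _).
  by case: eqP => _; rewrite ?mul1r ?mul0r.
have ppX (P : G -> {poly k}) i : pp true P -> pp (odd i) (fun g => P g ^+ i).
  move=> HP; elim: i => [|i IH] j.
    by apply: (preg_ext (preg_cst ((j == 0%N)%:R))) => g; rewrite expr0 coef1.
  by apply: (preg_ext (ppM _ _ _ _ HP IH j)) => g; rewrite exprS.
move=> i j.
have Hi : (i <= m)%N by rewrite -ltnS.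
rewrite (_ : odd m = odd i (+) odd (m - i)); last by rewrite oddB // addbC addbK.
apply: (preg_ext (ppM _ _ _ _ (ppX _ i (ppl _ _ (Hu 0 0) (Hu 1 0)))
  (ppX _ (m - i)%N (ppl _ _ (Hu 0 1) (Hu 1 1))) j)) => g.
by rewrite mxE.
Qed.

Lemma prmap_mx b p q (f : G -> 'M[k]_(p, q)) :
  (forall i j, preg b (fun g => f g i j)) -> prmap b f.
Proof.
move=> Hf; have Hsum (I : Type) (r : seq I) (h : I -> G -> 'M[k]_(p, q)) :
    (forall i, prmap b (h i)) -> prmap b (fun g => \sum_(i <- r) h i g).
  move=> H; elim: r => [|i r IH].
    by apply: (vmap_ext (prmap0 _ b)) => g; rewrite big_nil.
  by apply: (vmap_ext (vmapD (H i) IH)) => g; rewrite big_cons.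
apply: (vmap_ext (p := fun g => \sum_i \sum_j (f g i j *: delta_mx i j))).
  by apply: (Hsum) => i; apply: (Hsum) => j; exact: vmap1.
by move=> g; rewrite -matrix_sum_delta.
Qed.

Section Modules.
Variable m : nat.

Definition nab_act (g : G) (c : 'rV[k]_m.+1) := c *m subst m (val g).
Fact nab_act_linear g : linear (nab_act g).
Proof. by move=> a u v; rewrite /nab_act mulmxDl scalemxAl. Qed.
Fact nab_act1 v : nab_act 1%g v = v.
Proof. by rewrite /nab_act subst1 mulmx1. Qed.
Fact nab_actM g h v : nab_act (g * h)%g v = nab_act g (nab_act h v).
Proof. by rewrite /nab_act SL2_valM substM mulmxA. Qed.
Lemma nab_parity v : prmap (odd m) (fun g => nab_act g v).
Proof.
apply: prmap_mx => i j.
apply: (preg_ext (f := fun g => \sum_l v i l * subst m (val g) l j)); last by move=> g; rewrite !mxE.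
by apply: preg_sum => l; apply: preg_scale; apply: preg_subst => a b; exact: preg_coord.
Qed.

(** Homogeneous polynomials of degree m in two variables: the module induced
    from the weight m. *)
Definition Nabla : ratmod :=
  RationalModule nab_act_linear nab_act1 nab_actM (fun v => prmap_rmap (nab_parity v)).

Definition del_act (g : G) (x : 'cV[k]_m.+1) := subst m (val g)^T *m x.
Fact del_act_linear g : linear (del_act g).
Proof. by move=> a u v; rewrite /del_act mulmxDr scalemxAr. Qed.
Fact del_act1 v : del_act 1%g v = v.
Proof. by rewrite /del_act SL2_val1 trmx1 subst1 mul1mx. Qed.
Fact del_actM g h v : del_act (g * h)%g v = del_act g (del_act h v).
Proof. by rewrite /del_act SL2_valM trmx_mul substM mulmxA. Qed.
Lemma del_parity v : prmap (odd m) (fun g => del_act g v).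
Proof.
apply: prmap_mx => i j.
apply: (preg_ext (f := fun g : G => \sum_l v l j * subst m (val g)^T i l)).
  apply: preg_sum => l; apply: preg_scale; apply: (preg_subst (u := fun g : G => (val g)^T)) => a b.
  by apply: (preg_ext (preg_coord k b a)) => g; rewrite mxE.
by move=> g; rewrite mxE; apply: eq_bigr => l _; rewrite mulrC.
Qed.

(** The Weyl module of highest weight m, as the dual of the space of forms on
    which g acts by the substitution of its transposed inverse. *)
Definition Delta : ratmod :=
  RationalModule del_act_linear del_act1 del_actM (fun v => prmap_rmap (del_parity v)).

Lemma nab_actE g (c : Nabla) : act g c = (c : 'rV_m.+1) *m subst m (val g). Proof. by []. Qed.
Lemma del_actE g (x : Delta) : act g x = subst m (val g)^T *m (x : 'cV_m.+1). Proof. by []. Qed.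

Lemma Hle_Nabla_odd n : odd m -> Hle n Nabla 0.
Proof. by move=> Hm; apply: Hle_odd => v; rewrite -Hm; exact: nab_parity. Qed.
Lemma Hle_Delta_odd n : odd m -> Hle n Delta 0.
Proof. by move=> Hm; apply: Hle_odd => v; rewrite -Hm; exact: del_parity. Qed.

End Modules.

End SymmetricPowers.

(** * The translation sequences *)

Section Translation.
Variable k : closedFieldType.
Local Notation G := (SL2 k).
Hypothesis hk : 2%N \in [pchar k].
Local Notation fr := (map_mx (pFrobenius_aut hk)).

Section Degree.
Variable b : nat.

Definition shift (i j : 'I_2) : nat := (i == 0) + (j == 0).

(** Multiplication by x_i x_j after squaring the variables, in the bases of
    monomials. *)
Definition Bmx (i j : 'I_2) : 'M[k]_(b.+1, (2 * b).+3) :=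
  \matrix_(p, q) ((q : nat) == 2 * p + shift i j)%N%:R.

(** The coefficients a_ij in the expansion of x_i' f, for f of degree 2b, as
    the sum of the x_j a_ij(x_0^2, x_1^2); here i' is the index other than i. *)
Definition Amx (i j : 'I_2) : 'M[k]_((2 * b).+1, b.+1) :=
  \matrix_(q, p) (q.+1 == 2 * p + shift i j)%N%:R.

Lemma frE m n (v : 'M[k]_(m, n)) i j : fr v i j = v i j ^+ 2.
Proof. by rewrite mxE pFrobenius_autE. Qed.

Lemma Bmx_mon i j (v : 'rV[k]_2) : Bmx i j *m mon (2 * b).+2 v = (v 0 i * v 0 j) *: mon b (fr v).
Proof.
apply/colP => p; rewrite !mxE.
have Hp : (2 * p + shift i j < (2 * b).+3)%N.
  by have := ltn_ord p; rewrite /shift; case: (i == 0); case: (j == 0) => /=; lia.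
rewrite (bigD1 (Ordinal Hp)) //= big1 ?addr0 => [|q Hq]; last first.
  by rewrite mxE (_ : (_ == _) = false) ?mul0r //; apply: contraNF Hq => /eqP E; apply/eqP/val_inj.
rewrite !mxE eqxx mul1r /= !(pFrobenius_autE hk) -!exprM.
have Hb : (p <= b)%N by rewrite -ltnS.
rewrite /shift; case: (ord2P i) => ->; case: (ord2P j) => -> /=.
- rewrite (_ : (_ - _ = 2 * (b - p))%N); last by lia.
  by rewrite exprD; ring.
- rewrite (_ : (_ - _ = 2 * (b - p) + 1)%N); last by lia.
  by rewrite !exprD; ring.
- rewrite (_ : (_ - _ = 2 * (b - p) + 1)%N); last by lia.
  by rewrite !exprD; ring.
- rewrite (_ : (_ - _ = 2 * (b - p) + 2)%N); last by lia.
  by rewrite !exprD; ring.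
Qed.

Lemma Amx_mon i (v : 'rV[k]_2) :
  \sum_j v 0 j *: (Amx i j *m mon b (fr v)) = v 0 (other i) *: mon (2 * b) v.
Proof.
apply/colP => q; rewrite summxE.
have Hq : (q <= 2 * b)%N by rewrite -ltnS.
have pick1 i' j (p : 'I_b.+1) : q.+1 = (2 * p + shift i' j)%N ->
    (Amx i' j *m mon b (fr v)) q 0 = v 0 0 ^+ (2 * p) * v 0 1 ^+ (2 * (b - p)).
  move=> E; rewrite mxE (bigD1 p) //= big1 ?addr0 => [|r Hr].
    by rewrite !mxE E eqxx mul1r !(pFrobenius_autE hk) -!exprM.
  rewrite mxE E (_ : (_ == _) = false) ?mul0r //; apply: contraNF Hr => /eqP H.
  by apply/eqP/val_inj => /=; lia.
have pick0 i' j : (forall p : 'I_b.+1, q.+1 != 2 * p + shift i' j)%N ->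
    (Amx i' j *m mon b (fr v)) q 0 = 0.
  by move=> H; rewrite mxE big1 // => r _; rewrite mxE (negPf (H r)) mul0r.
rewrite sum_ord2 [X in X + _]mxE [X in _ + X]mxE [RHS]mxE [mon _ _ q 0]mxE.
have [oq|eq] := boolP (odd q).
  case: (ord2P i) => Ei.
    have H : (q./2 < b.+1)%N by lia.
    rewrite Ei (@pick1 0 0 (Ordinal H)) /=; last by rewrite /shift /=; lia.
    rewrite pick0; last by move=> p; apply/eqP; rewrite /shift /=; lia.
    rewrite mulr0 addr0 /other subr0.
    rewrite [in RHS](_ : (q : nat) = 2 * q./2 + 1)%N; last by lia.
    rewrite (_ : (2 * (b - q./2) = (2 * b - (2 * q./2 + 1)) + 1)%N); last by lia.
    by rewrite !exprD; ring.
  have H : (q./2.+1 < b.+1)%N by lia.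
  rewrite Ei pick0; last by move=> p; apply/eqP; rewrite /shift /=; lia.
  rewrite (@pick1 1 1 (Ordinal H)) /=; last by rewrite /shift /=; lia.
  rewrite mulr0 add0r /other subrr.
  rewrite [in RHS](_ : (q : nat) = 2 * q./2 + 1)%N; last by lia.
  rewrite (_ : (2 * b - (2 * q./2 + 1) = (2 * (b - q./2.+1)) + 1)%N); last by lia.
  rewrite (_ : (2 * q./2.+1 = 2 * q./2 + 2)%N); last by lia.
  by rewrite !exprD; ring.
have H : (q./2 < b.+1)%N by lia.
case: (ord2P i) => Ei; rewrite Ei.
  rewrite pick0; last by move=> p; apply/eqP; rewrite /shift /=; lia.
  rewrite (@pick1 0 1 (Ordinal H)) /=; last by rewrite /shift /=; lia.
  rewrite mulr0 add0r /other subr0.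
  rewrite [in RHS](_ : (q : nat) = 2 * q./2)%N; last by lia.
  by rewrite mulnBr.
rewrite [X in _ + _ * X]pick0 ?mulr0 ?addr0; last by move=> p; apply/eqP; rewrite /shift /=; lia.
rewrite (@pick1 1 0 (Ordinal H)) /=; last by rewrite /shift /=; lia.
rewrite /other subrr [in RHS](_ : (q : nat) = 2 * q./2)%N; last by lia.
by rewrite mulnBr.
Qed.

(** The powers of a variable in the two terms have different parities. *)
Lemma mon_fr_sep p (X : 'I_2 -> 'M[k]_(p, b.+1)) :
  (forall v : 'rV[k]_2, \sum_j v 0 j *: (X j *m mon b (fr v)) = 0) -> forall j, X j = 0.
Proof.
move=> H.
have frrv t : fr (rv t) = rv (t ^+ 2).
  by apply/rowP => i; rewrite frE !mxE; case: eqP => // _; rewrite expr1n.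
have Hp (Y : 'M[k]_(p, b.+1)) : polyn (fun r => Y *m mon b (rv r)).
  exists b.+1, (fun i => col (inord i) Y) => r; apply/colP => a; rewrite mxE summxE.
  by apply: eq_bigr => i _; rewrite mon_rv !mxE inord_val mulrC.
have E := even_odd_inj (Hp (X 1)) (Hp (X 0)).
have {}E r : X 1 *m mon b (rv r) = 0 /\ X 0 *m mon b (rv r) = 0.
  apply: E => t _; have := H (rv t); rewrite sum_ord2 frrv !mxE /= scale1r => <-.
  by rewrite addrC.
move=> j; case: (ord2P j) => ->; apply: mon_sep0 => t; first by have [] := E t.
by have [] := E t.
Qed.

Lemma Bmx_equiv (h : 'M[k]_2) i j : Bmx i j *m subst (2 * b).+2 h =
  \sum_a \sum_c (h a i * h c j) *: (subst b (fr h) *m Bmx a c).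
Proof.
apply: mon_sep => v; rewrite -mulmxA substE Bmx_mon map_mxM -substE.
rewrite mulmx_suml; under eq_bigr do rewrite mulmx_suml.
have E a c : (h a i * h c j) *: (subst b (fr h) *m Bmx a c) *m mon (2 * b).+2 v =
   ((v 0 a * h a i) * (v 0 c * h c j)) *: (subst b (fr h) *m mon b (fr v)).
  by rewrite -scalemxAl -mulmxA Bmx_mon -scalemxAr scalerA; congr (_ *: _); ring.
under eq_bigr do under eq_bigr do rewrite E.
rewrite !mxE big_distrlr scaler_suml; apply: eq_bigr => a _.
by rewrite scaler_suml.
Qed.

Lemma Amx_equiv (g : G) i j : subst (2 * b) (val g) *m Amx i j =
  \sum_a \sum_c (val g i a * val g j c) *: (Amx a c *m subst b (fr (val g))).
Proof.
set h := val g.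
suff H j' : (fun j => subst (2 * b) h *m Amx i j -
    \sum_a \sum_c (h i a * h j c) *: (Amx a c *m subst b (fr h))) j' = 0.
  by apply/eqP; rewrite -subr_eq0; apply/eqP/H.
apply: (@mon_fr_sep _ (fun j => subst (2 * b) h *m Amx i j -
    \sum_a \sum_c (h i a * h j c) *: (Amx a c *m subst b (fr h)))) => v.
under eq_bigr do rewrite mulmxBl scalerBr.
rewrite sumrB; apply/eqP; rewrite subr_eq0; apply/eqP.
transitivity (subst (2 * b) h *m (v 0 (other i) *: mon (2 * b) v)).
  rewrite -Amx_mon mulmx_sumr; apply: eq_bigr => l _.
  by rewrite -scalemxAr mulmxA.
rewrite -scalemxAr substE.
(* v = (v h) h^-1, and h^-1 is the transpose of h up to exchanging the
   coordinates on both sides. *)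
have Ev : v 0 (other i) = \sum_a h i a * (v *m h) 0 (other a).
  rewrite !sum_ord2 !mxE !sum_ord2 /other subr0 subrr.
  have D : h 0 0 * h 1 1 + h 0 1 * h 1 0 = 1 := SL2_det_char2 hk g.
  have dbl (x : k) : x + x = 0 by rewrite -mulr2n (mulrn_pchar hk).
  case: (ord2P i) => ->; rewrite ?subr0 ?subrr.
    transitivity (v 0 0 * (h 0 0 * h 0 1 + h 0 0 * h 0 1) + v 0 1 * (h 0 0 * h 1 1 + h 0 1 * h 1 0)).
      by rewrite D dbl mulr0 add0r mulr1.
    by ring.
  transitivity (v 0 0 * (h 0 0 * h 1 1 + h 0 1 * h 1 0) + v 0 1 * (h 1 0 * h 1 1 + h 1 0 * h 1 1)).
    by rewrite D dbl mulr0 addr0 mulr1.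
  by ring.
rewrite Ev scaler_suml.
under eq_bigr do rewrite -scalerA -Amx_mon scaler_sumr.
under [RHS]eq_bigr do rewrite mulmx_suml scaler_sumr.
rewrite [RHS]exchange_big; apply: eq_bigr => a _ /=.
under [RHS]eq_bigr do rewrite mulmx_suml scaler_sumr.
rewrite [RHS]exchange_big; apply: eq_bigr => c _ /=.
rewrite mxE scalerA mulr_sumr scaler_suml; apply: eq_bigr => l _.
rewrite -scalemxAl scalerA -mulmxA substE map_mxM; congr (_ *: _); ring.
Qed.

(** The composite multiplies by x_0 x_1 + x_1 x_0, which vanishes in
    characteristic 2. *)
Lemma Amx_Bmx : \sum_i \sum_j Amx i j *m Bmx i j = 0.
Proof.
apply: mon_sep => v; rewrite mul0mx mulmx_suml.
transitivity (\sum_i (v 0 i * v 0 (other i)) *: mon (2 * b) v).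
  apply: eq_bigr => i _; rewrite -scalerA -Amx_mon scaler_sumr mulmx_suml.
  by apply: eq_bigr => j _; rewrite -mulmxA Bmx_mon -scalemxAr scalerA.
rewrite sum_ord2 /other subr0 subrr [v 0 1 * _]mulrC.
exact: (scale_char2 hk).
Qed.

End Degree.
End Translation.

Section Sequences.
Variable k : closedFieldType.
Local Notation G := (SL2 k).
Hypothesis hk : 2%N \in [pchar k].
Local Notation frob := (frob hk).
Local Notation Tw := (Tw hk).
Variable b : nat.
Local Notation B := (Bmx k b).
Local Notation A := (Amx k b).
Local Notation N0 := (Nabla k b).
Local Notation D0 := (Delta k b).

Lemma linear_sum2 (U W : lmodType k) (f : 'I_2 -> 'I_2 -> U -> W) :
  (forall i j, linear (f i j)) ->
  forall a (u v : 'I_2 -> 'I_2 -> U),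
  \sum_i \sum_j f i j ((a *: u + v) i j) =
  a *: (\sum_i \sum_j f i j (u i j)) + \sum_i \sum_j f i j (v i j).
Proof.
move=> Hf a u v; rewrite scaler_sumr -big_split; apply: eq_bigr => i _ /=.
rewrite scaler_sumr -big_split; apply: eq_bigr => j _ /=.
by rewrite -Hf.
Qed.

(** ** The homomorphisms in the translation sequences *)

Definition nabB_fun (n : Tw N0) : Nabla k (2 * b).+2 :=
  \sum_i \sum_j (n i j : 'rV_b.+1) *m B i j.

Fact nabB_linear : linear nabB_fun.
Proof.
move=> a u v; apply: (linear_sum2 (f := fun i j (x : 'rV[k]_b.+1) => x *m B i j)).
by move=> i j c x y; rewrite mulmxDl scalemxAl.
Qed.

Lemma exchange4 (V : nmodType) (F : 'I_2 -> 'I_2 -> 'I_2 -> 'I_2 -> V) :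
  \sum_i \sum_j \sum_a \sum_c F i j a c = \sum_a \sum_c \sum_i \sum_j F i j a c.
Proof.
under eq_bigr do rewrite exchange_big.
rewrite exchange_big; apply: eq_bigr => a _ /=.
under eq_bigr do rewrite exchange_big.
by rewrite exchange_big.
Qed.

Fact nabB_act g n : nabB_fun (act g n) = act g (nabB_fun n).
Proof.
transitivity (\sum_i \sum_j \sum_a \sum_c (val g i a * val g j c) *:
   ((n a c : 'rV_b.+1) *m subst b (val (frob g)) *m B i j)).
  apply: eq_bigr => i _; apply: eq_bigr => j _.
  rewrite tw_actE mulmx_suml; apply: eq_bigr => a _.
  by rewrite mulmx_suml; apply: eq_bigr => c _; rewrite -scalemxAl -nab_actE.
rewrite exchange4 nab_actE mulmx_suml; apply: eq_bigr => a _.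
rewrite mulmx_suml; apply: eq_bigr => c _.
rewrite -mulmxA (Bmx_equiv hk) mulmx_sumr; apply: eq_bigr => i _.
by rewrite mulmx_sumr; apply: eq_bigr => j _; rewrite -scalemxAr mulmxA.
Qed.

Definition nabB : rational_hom (Tw N0) (Nabla k (2 * b).+2) := hom_of nabB_linear nabB_act.

Definition nabA_fun (c : Nabla k (2 * b)) : Tw N0 :=
  fun i j => (c : 'rV_(2 * b).+1) *m A i j.
Fact nabA_linear : linear nabA_fun.
Proof.
move=> a u v; apply: tw_inj => i j.
by rewrite -[RHS]/(a *: (u *m A i j) + v *m A i j) scalemxAl -mulmxDl.
Qed.
Fact nabA_act g c : nabA_fun (act g c) = act g (nabA_fun c).
Proof.
apply: tw_inj => i j; rewrite tw_actE /nabA_fun nab_actE -mulmxA (Amx_equiv hk) mulmx_sumr.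
apply: eq_bigr => a _; rewrite mulmx_sumr; apply: eq_bigr => d _.
by rewrite -scalemxAr mulmxA.
Qed.
Definition nabA : rational_hom (Nabla k (2 * b)) (Tw N0) := hom_of nabA_linear nabA_act.

Definition delB_fun (x : Delta k (2 * b).+2) : Tw D0 :=
  fun i j => B i j *m (x : 'cV_(2 * b).+3).
Fact delB_linear : linear delB_fun.
Proof.
move=> a u v; apply: tw_inj => i j.
by rewrite -[RHS]/(a *: (B i j *m u) + B i j *m v) scalemxAr -mulmxDr.
Qed.
Fact delB_act g x : delB_fun (act g x) = act g (delB_fun x).
Proof.
apply: tw_inj => i j; rewrite tw_actE /delB_fun del_actE mulmxA (Bmx_equiv hk) mulmx_suml.
apply: eq_bigr => a _; rewrite mulmx_suml; apply: eq_bigr => d _.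
by rewrite del_actE -scalemxAl mulmxA !mxE map_trmx.
Qed.
Definition delB : rational_hom (Delta k (2 * b).+2) (Tw D0) := hom_of delB_linear delB_act.

Definition delA_fun (n : Tw D0) : Delta k (2 * b) :=
  \sum_i \sum_j A i j *m (n i j : 'cV_b.+1).
Fact delA_linear : linear delA_fun.
Proof.
move=> a u v; apply: (linear_sum2 (f := fun i j (x : 'cV[k]_b.+1) => A i j *m x)).
by move=> i j c x y; rewrite mulmxDr scalemxAr.
Qed.

Fact tr_subproof (g : G) : \det (val g)^T == 1.
Proof. by rewrite det_tr (eqP (valP g)). Qed.

Fact delA_act g n : delA_fun (act g n) = act g (delA_fun n).
Proof.
pose h : G := MkSL2 (tr_subproof g).
transitivity (\sum_i \sum_j \sum_a \sum_c (val h a i * val h c j) *: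
   (A i j *m subst b (val (frob h)) *m (n a c : 'cV_b.+1))).
  apply: eq_bigr => i _; apply: eq_bigr => j _.
  rewrite tw_actE mulmx_sumr; apply: eq_bigr => a _.
  rewrite mulmx_sumr; apply: eq_bigr => c _.
  by rewrite del_actE -scalemxAr mulmxA /= !mxE map_trmx.
rewrite exchange4 del_actE mulmx_sumr; apply: eq_bigr => a _.
rewrite mulmx_sumr; apply: eq_bigr => c _.
rewrite mulmxA (Amx_equiv hk b h) mulmx_suml; apply: eq_bigr => i _.
by rewrite mulmx_suml; apply: eq_bigr => j _; rewrite -scalemxAl.
Qed.
Definition delA : rational_hom (Tw D0) (Delta k (2 * b)) := hom_of delA_linear delA_act.

(** ** Exactness of the translation sequences *)

Definition ext0 N (x : 'I_N -> k) (r : nat) : k := if insub r is Some i then x i else 0.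

Lemma ext0_ord N (x : 'I_N -> k) (i : 'I_N) : ext0 x i = x i.
Proof. by rewrite /ext0 valK. Qed.

Lemma ext0_lt N (x : 'I_N -> k) r (H : (r < N)%N) : ext0 x r = x (Ordinal H).
Proof. exact: (ext0_ord x (Ordinal H)). Qed.

Lemma ext0_ge N (x : 'I_N -> k) r : (N <= r)%N -> ext0 x r = 0.
Proof. by move=> H; rewrite /ext0 insubF // ltnNge H. Qed.

Lemma sum_ext0 N (x : 'I_N -> k) r : \sum_(q < N) x q * ((q : nat) == r)%:R = ext0 x r.
Proof.
have [H|H] := ltnP r N.
  rewrite (bigD1 (Ordinal H)) //= eqxx mulr1 big1 ?addr0 ?ext0_lt // => q Hq.
  by rewrite (_ : (_ == _) = false) ?mulr0 //; apply: contraNF Hq => /eqP E; apply/eqP/val_inj.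
rewrite ext0_ge // big1 // => q _.
by rewrite ltn_eqF ?mulr0 // (leq_trans (ltn_ord q)).
Qed.

Lemma sum_double N (x : 'I_N -> k) r e :
  \sum_(p < N) x p * (r == 2 * p + e)%N%:R =
  if (e <= r)%N && ~~ odd (r - e) then ext0 x (r - e)./2 else 0.
Proof.
case: ifP => H.
  rewrite -sum_ext0; apply: eq_bigr => p _; congr (_ * _%:R).
  by congr (nat_of_bool _); apply/eqP/eqP; lia.
rewrite big1 // => p _; rewrite (_ : (_ == _) = false) ?mulr0 //.
by apply/eqP; lia.
Qed.

(** The coefficient in degree r of the sum of the x_i x_j n_ij(x_0^2, x_1^2): the
    off-diagonal n_ij contribute to odd degrees and the diagonal ones to even
    degrees. Both exactness proofs solve for the coefficients degree by
    degree. *)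
Definition parts (n : 'I_2 -> 'I_2 -> 'I_b.+1 -> k) (r : nat) : k :=
  if odd r then ext0 (n 0 1) r./2 + ext0 (n 1 0) r./2
  else (if (1 < r)%N then ext0 (n 0 0) r./2.-1 else 0) + ext0 (n 1 1) r./2.

Lemma sum_parts (n : 'I_2 -> 'I_2 -> 'I_b.+1 -> k) r :
  \sum_i \sum_j \sum_p n i j p * (r == 2 * p + shift i j)%N%:R = parts n r.
Proof.
rewrite !sum_ord2 !sum_double /parts /shift /= !addn0 !add0n !subn0 ?leq0n.
have [or|er] := boolP (odd r).
  rewrite (_ : (1 + 1 <= r)%N && ~~ odd (r - (1 + 1)) = false); last by lia.
  rewrite (_ : (0 < r)%N && ~~ odd (r - 1) = true); last by lia.
  rewrite (_ : (r - 1)./2 = r./2); last by lia.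
  by rewrite add0r addr0.
rewrite (_ : (1 + 1 <= r)%N && ~~ odd (r - (1 + 1)) = (1 < r)%N); last by lia.
rewrite (_ : (0 < r)%N && ~~ odd (r - 1) = false); last by lia.
rewrite (_ : (r - (1 + 1))./2 = r./2.-1); last by lia.
by rewrite addr0 add0r.
Qed.

Lemma nabB_coef n q : (nabB n : 'rV_(2 * b).+3) 0 q =
  parts (fun i j p => (n i j : 'rV_b.+1) 0 p) q.
Proof.
rewrite -sum_parts -[nabB n]/(nabB_fun n) summxE; apply: eq_bigr => i _.
rewrite summxE; apply: eq_bigr => j _; rewrite mxE; apply: eq_bigr => p _.
by rewrite mxE.
Qed.

Lemma delA_coef n q : (delA n : 'cV_(2 * b).+1) q 0 =
  parts (fun i j p => (n i j : 'cV_b.+1) p 0) q.+1.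
Proof.
rewrite -sum_parts -[delA n]/(delA_fun n) summxE; apply: eq_bigr => i _.
rewrite summxE; apply: eq_bigr => j _; rewrite mxE; apply: eq_bigr => p _.
by rewrite mxE mulrC.
Qed.

Lemma nabA_coef c i j p : (nabA c i j : 'rV_b.+1) 0 p =
  if (2 * p + shift i j)%N is r.+1 then ext0 (fun q => (c : 'rV_(2 * b).+1) 0 q) r else 0.
Proof.
rewrite -[nabA c i j]/(_ *m A i j) mxE.
case E : (2 * p + shift i j)%N => [|r].
  by rewrite big1 // => q _; rewrite mxE E mulr0.
by rewrite -sum_ext0; apply: eq_bigr => q _; rewrite mxE E eqSS.
Qed.

Lemma delB_coef x i j p : (delB x i j : 'cV_b.+1) p 0 =
  ext0 (fun q => (x : 'cV_(2 * b).+3) q 0) (2 * p + shift i j)%N.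
Proof.
rewrite -[delB x i j]/(B i j *m _) mxE -sum_ext0; apply: eq_bigr => q _.
by rewrite mxE mulrC.
Qed.

Lemma eq_of_add (x y : k) : x + y = 0 -> x = y.
Proof. by move=> H; apply/eqP; rewrite -subr_eq0 (oppk_char2 hk) H. Qed.

(** In each degree [parts] is the sum of two coefficients, one of them missing
    in degrees 0 and 2b + 2. So it is onto, and a family in its kernel is determined
    by n_00 and n_01, which are the odd and even coefficients of the preimage. *)
Lemma ses_nab : ses nabA nabB.
Proof.
split.
- move=> c Hc; apply/rowP => q; rewrite [RHS]mxE.
  have H i j p : (nabA c i j : 'rV_b.+1) 0 p = 0 by rewrite Hc mxE.
  have [oq|eq] := boolP (odd q).
    have Hq : (q./2 < b.+1)%N by have := ltn_ord q; lia.
    rewrite -(H 0 0 (Ordinal Hq)) nabA_coef /shift /=.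
    rewrite (_ : (2 * q./2 + (1 + 1) = q.+1)%N); last by lia.
    by rewrite (ext0_ord (fun q => c 0 q)).
  have Hq : (q./2 < b.+1)%N by have := ltn_ord q; lia.
  rewrite -(H 0 1 (Ordinal Hq)) nabA_coef /shift /=.
  rewrite (_ : (2 * q./2 + (1 + 0) = q.+1)%N); last by lia.
  by rewrite (ext0_ord (fun q => c 0 q)).
- move=> z; pose zz := ext0 (fun q => (z : 'rV_(2 * b).+3) 0 q).
  (* The diagonal entry n_11 covers all even degrees but the last one. *)
  pose n : Tw N0 := fun i j => \row_p (if i == 0 then
     (if j == 0 then (if p == b :> nat then zz (2 * b).+2 else 0) else zz (2 * p).+1)
     else (if j == 0 then 0 else zz (2 * p)%N)).
  exists n; apply/rowP => q; rewrite nabB_coef /parts.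
  have Hq : (q <= (2 * b).+2)%N by rewrite -ltnS.
  have Ez r : r = q :> nat -> zz r = (z : 'rV_(2 * b).+3) 0 q.
    by move=> ->; exact: (ext0_ord (fun q => z 0 q)).
  have [oq|eq] := boolP (odd q).
    have H : (q./2 < b.+1)%N by lia.
    by rewrite !(ext0_lt _ H) !mxE /= addr0 Ez //=; lia.
  have [H|H] := ltnP q./2 b.+1.
    rewrite (ext0_lt _ H) mxE /= Ez /=; last by lia.
    case: ifP => H1; last by rewrite add0r.
    have H2 : (q./2.-1 < b.+1)%N by lia.
    by rewrite (ext0_lt _ H2) mxE /= (_ : (_ == b) = false) ?add0r //; lia.
  rewrite (ext0_ge _ H) addr0; have Eq : q = (2 * b).+2 :> nat by lia.
  have H2 : (q./2.-1 < b.+1)%N by lia.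
  rewrite (_ : (1 < q)%N = true) ?(ext0_lt _ H2) ?mxE /=; last by lia.
  by rewrite (_ : (_ == b) = true) ?Ez // Eq; lia.
- move=> n Hn; pose nn i j := fun p => (n i j : 'rV_b.+1) 0 p.
  have H r : (r < (2 * b).+3)%N -> parts nn r = 0.
    by move=> Hr; have := nabB_coef n (Ordinal Hr); rewrite Hn mxE.
  have n01 p : ext0 (nn 0 1) p = ext0 (nn 1 0) p.
    have [Hp|Hp] := ltnP p b.+1; last by rewrite !ext0_ge.
    have := H (2 * p).+1; rewrite /parts.
    rewrite (_ : odd _ = true); last by lia.
    rewrite (_ : (2 * p).+1./2 = p); last by lia.
    by move=> E; apply: eq_of_add; apply: E; lia.
  have n00 p : (p < b.+1)%N -> ext0 (nn 0 0) p = ext0 (nn 1 1) p.+1.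
    move=> Hp; have := H (2 * p.+1)%N; rewrite /parts.
    rewrite (_ : odd _ = false); last by lia.
    rewrite (_ : (2 * p.+1)./2 = p.+1); last by lia.
    rewrite (_ : (1 < 2 * p.+1)%N = true); last by lia.
    by move=> E; apply: eq_of_add; apply: E; lia.
  have n11 : ext0 (nn 1 1) 0 = 0 by have := H 0%N isT; rewrite /parts /= add0r.
  exists (\row_q (if odd q then ext0 (nn 0 0) q./2 else ext0 (nn 0 1) q./2)).
  apply: tw_inj => i j; apply/rowP => p; rewrite nabA_coef.
  have Ec r : ext0 (fun q : 'I_(2 * b).+1 => (\row_q (if odd q then ext0 (nn 0 0) q./2
       else ext0 (nn 0 1) q./2) : 'rV_(2 * b).+1) 0 q) r =
     if (r < (2 * b).+1)%N then (if odd r then ext0 (nn 0 0) r./2 else ext0 (nn 0 1) r./2) else 0.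
    case: ifP => Hr; first by rewrite (ext0_lt _ Hr) mxE.
    by rewrite ext0_ge // leqNgt Hr.
  have Hp : (p < b.+1)%N by [].
  have Ep u v : ext0 (nn u v) p = nn u v p by exact: ext0_ord.
  case: (ord2P i) => ->; case: (ord2P j) => ->; rewrite /shift /=.
  + rewrite (_ : (2 * p + (1 + 1) = (2 * p).+2)%N) ?Ec; last by lia.
    rewrite (_ : odd _ = true); last by lia.
    rewrite (_ : (2 * p).+1./2 = p); last by lia.
    case: ifP => Hr; first exact: (Ep 0 0).
    by rewrite -[RHS](Ep 0 0) n00 // ext0_ge //; lia.
  + rewrite (_ : (2 * p + (1 + 0) = (2 * p).+1)%N) ?Ec; last by lia.
    rewrite (_ : odd _ = false); last by lia.
    rewrite (_ : (2 * p)./2 = p); last by lia.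
    by rewrite (_ : (_ < _)%N = true) ?(Ep 0 1) //; lia.
  + rewrite (_ : (2 * p + (0 + 1) = (2 * p).+1)%N) ?Ec; last by lia.
    rewrite (_ : odd _ = false); last by lia.
    rewrite (_ : (2 * p)./2 = p); last by lia.
    by rewrite (_ : (_ < _)%N = true) ?n01 ?(Ep 1 0) //; lia.
  + rewrite -[RHS](Ep 1 1) !addn0; case: (nat_of_ord p) Hp => [|p'] Hp; first by rewrite n11.
    rewrite (_ : (2 * p'.+1 = (2 * p').+2)%N) ?Ec; last by lia.
    rewrite (_ : odd _ = true); last by lia.
    rewrite (_ : (2 * p').+1./2 = p'); last by lia.
    by rewrite (_ : (_ < _)%N = true) ?n00 //; lia.
- move=> c; rewrite -[nabB _]/(\sum_i \sum_j (c *m A i j) *m B i j).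
  under eq_bigr do under eq_bigr do rewrite -mulmxA.
  under eq_bigr do rewrite -mulmx_sumr.
  by rewrite -mulmx_sumr (Amx_Bmx hk) mulmx0.
Qed.

(** The matrices are those of [ses_nab], acting on the other side. Degrees
    0 and 2b + 2 are now not constrained, and the remaining coefficients of the
    preimage are repeated in pairs. *)
Lemma ses_del : ses delB delA.
Proof.
split.
- move=> x Hx; apply/colP => q; rewrite [RHS]mxE.
  have H i j p : (delB x i j : 'cV_b.+1) p 0 = 0 by rewrite Hx mxE.
  have Hq2 : (q <= (2 * b).+2)%N by rewrite -ltnS.
  have use i j p : (2 * p + shift i j)%N = q -> (p < b.+1)%N -> (x : 'cV_(2 * b).+3) q 0 = 0.
    move=> E Hp; rewrite -(H i j (Ordinal Hp)) delB_coef /= E.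
    by rewrite (ext0_ord (fun q => x q 0)).
  have [oq|eq] := boolP (odd q).
    by apply: (use 0 1 q./2); rewrite /shift /=; lia.
  have [Hq|Hq] := ltnP q./2 b.+1.
    by apply: (use 1 1 q./2); rewrite /shift /=; lia.
  by apply: (use 0 0 b); rewrite /shift /=; lia.
- move=> z; pose zz := ext0 (fun q => (z : 'cV_(2 * b).+1) q 0).
  pose n : Tw D0 := fun i j => \col_p (if i == 0 then
     (if j == 0 then zz (2 * p).+1 else zz (2 * p)%N) else 0).
  exists n; apply/colP => q; rewrite delA_coef /parts.
  have Hq : (q <= 2 * b)%N by rewrite -ltnS.
  have Ez r : r = q :> nat -> zz r = (z : 'cV_(2 * b).+1) q 0.
    by move=> ->; exact: (ext0_ord (fun q => z q 0)).
  have [oq|eq] := boolP (odd q.+1).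
    have H : (q.+1./2 < b.+1)%N by lia.
    by rewrite !(ext0_lt _ H) !mxE /= addr0 Ez //=; lia.
  rewrite (_ : (1 < q.+1)%N = true); last by lia.
  have H : (q.+1./2.-1 < b.+1)%N by lia.
  have H' : (q.+1./2 < b.+1)%N by lia.
  by rewrite (ext0_lt _ H) (ext0_lt _ H') !mxE /= addr0 Ez //=; lia.
- move=> n Hn; pose nn i j := fun p => (n i j : 'cV_b.+1) p 0.
  have H r : (r < (2 * b).+1)%N -> parts nn r.+1 = 0.
    by move=> Hr; have := delA_coef n (Ordinal Hr); rewrite Hn mxE.
  have n01 p : (p < b.+1)%N -> ext0 (nn 0 1) p = ext0 (nn 1 0) p.
    move=> Hp; have := H (2 * p)%N; rewrite /parts.
    rewrite (_ : odd _ = true); last by lia.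
    rewrite (_ : (2 * p).+1./2 = p); last by lia.
    by move=> E; apply: eq_of_add; apply: E; lia.
  have n00 p : (p < b)%N -> ext0 (nn 0 0) p = ext0 (nn 1 1) p.+1.
    move=> Hp; have := H (2 * p).+1; rewrite /parts.
    rewrite (_ : odd _ = false); last by lia.
    rewrite (_ : (2 * p).+2./2 = p.+1); last by lia.
    rewrite (_ : (1 < (2 * p).+2)%N = true); last by lia.
    by move=> E; apply: eq_of_add; apply: E; lia.
  pose xx r := if odd r then ext0 (nn 0 1) r./2 else
    if r == (2 * b).+2 then ext0 (nn 0 0) b else ext0 (nn 1 1) r./2.
  exists (\col_q xx q).
  apply: tw_inj => i j; apply/colP => p; rewrite delB_coef.
  have Ec r : (r < (2 * b).+3)%N -> ext0 (fun q : 'I_(2 * b).+3 => (\col_q xx q : 'cV_(2 * b).+3) q 0) r = xx r.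
    by move=> Hr; rewrite (ext0_lt _ Hr) mxE.
  have Hp : (p < b.+1)%N by [].
  have Ep u v : ext0 (nn u v) p = nn u v p by exact: ext0_ord.
  rewrite Ec; last by rewrite /shift; case: (i == 0); case: (j == 0) => /=; lia.
  case: (ord2P i) => ->; case: (ord2P j) => ->; rewrite /shift /xx /=.
  + rewrite (_ : odd _ = false); last by lia.
    rewrite (_ : (2 * p + (1 + 1))./2 = p.+1); last by lia.
    case: eqP => Hr; first by rewrite -[RHS](Ep 0 0); congr (ext0 _ _); lia.
    by rewrite -[RHS](Ep 0 0) n00 //; lia.
  + rewrite (_ : odd _ = true); last by lia.
    by rewrite (_ : (2 * p + (1 + 0))./2 = p) ?(Ep 0 1) //; lia.
  + rewrite (_ : odd _ = true); last by lia.
    by rewrite (_ : (2 * p + (0 + 1))./2 = p) ?n01 ?(Ep 1 0) //; lia.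
  + rewrite (_ : odd _ = false); last by lia.
    rewrite (_ : (2 * p + (0 + 0))./2 = p); last by lia.
    by rewrite (_ : (_ == _) = false) ?(Ep 1 1) //; lia.
- move=> x; rewrite -[delA _]/(\sum_i \sum_j A i j *m (B i j *m x)).
  under eq_bigr do under eq_bigr do rewrite mulmxA.
  under eq_bigr do rewrite -mulmx_suml.
  by rewrite -mulmx_suml (Amx_Bmx hk) mul0mx.
Qed.

End Sequences.

Section Trivial.
Variable k : closedFieldType.
Local Notation G := (SL2 k).
Local Notation ratmod := (rational_module k).
Hypothesis hk : 2%N \in [pchar k].
Local Notation frob := (frob hk).
Local Notation Tw := (Tw hk).
Local Notation tw := (tw hk).

(** * Vanishing for induced modules *)

(** For m = 2b > 0 the first translation sequence bounds the cohomology of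
    Nabla (2b) in degree n by that of Nabla b in degree n and that of
    Nabla (2b + 2) in degree n - 1. The second weight is larger than m, so the outer
    induction is on n. *)
Lemma Hle_Nabla n m : (0 < m)%N -> Hle n (Nabla k m) 0.
Proof.
have even_ex q : ~~ odd q -> exists b, q = (2 * b)%N by move=> eq; exists q./2; lia.
elim: n m => [|n IHn] m; elim/ltn_ind: m => m IHm m0; have [om|em] := boolP (odd m);
  try exact: Hle_Nabla_odd; have [b Eb] := even_ex _ em; subst m.
- by apply: (LES_inv (ses_nab hk b)); apply: Hle_tw; apply: IHm; lia.
have := LES_left (n := n) (d1 := 0) (d2 := 0) (ses_nab hk b); rewrite addn0; apply.
  by apply: (Cle_of_Hle (ses_nab hk b)); apply: IHn.
by apply: Hle_tw; apply: IHm; lia.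
Qed.

(** * The tower k -> Tw k -> Tw (Tw k) -> ... *)

Fixpoint Tr (r : nat) : ratmod := if r is s.+1 then Tw (Tr s) else Nabla k 0.
Fixpoint Cr (r : nat) : ratmod := if r is s.+1 then Tw (Cr s) else Nabla k 2.
Fixpoint step (r : nat) : rational_hom (Tr r) (Tr r.+1) :=
  if r is s.+1 then tw (step s) else nabA hk 0.
Fixpoint cstep (r : nat) : rational_hom (Tr r.+1) (Cr r) :=
  if r is s.+1 then tw (cstep s) else nabB hk 0.

Lemma ses_step r : ses (step r) (cstep r).
Proof. by elim: r => [|r IH]; [exact: (ses_nab hk 0)|exact: ses_tw]. Qed.

Lemma Hle_Cr n r : Hle n (Cr r) 0.
Proof. by elim: r => [|r IH]; [exact: Hle_Nabla|exact: Hle_tw]. Qed.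

Section Multiply.
Variables (M : ratmod) (a : rational_hom M (coMod k^o)).

(** A map from M to functions on G extends to Tw M: compose its values with Frobenius
    and multiply by an entry of each row. The rows are stable under right translations, so the
    extension is equivariant. *)
Fact mulco_subproof (n : Tw M) :
  rmap (fun x => \sum_i \sum_j val x 0 i * val x 1 j *: coval (a (n i j : M)) (frob x)).
Proof.
apply: rmap_sum => i; apply: rmap_sum => j; apply: rmapM.
  by apply: regularM; exact: regular_coord.
exact/rmap_frob/coP.
Qed.

Fact mulco_linear : linear (fun n => mkco (mulco_subproof n)).
Proof.
move=> c u v; apply/co_inj => x; rewrite co_linE !mkcoE.
pose f i j (w : M) : k^o := val x 0 i * val x 1 j *: coval (a w) (frob x).
apply: (linear_sum2 (f := f)) => i j d y z.
by rewrite /f linearP co_linE scalerDr !scalerA mulrC.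
Qed.

Fact mulco_act g n : mkco (mulco_subproof (act g n)) = act g (mkco (mulco_subproof n)).
Proof.
apply/co_inj => x; rewrite co_actE !mkcoE.
have E i j : coval (a (act g n i j : M)) (frob x) =
    \sum_b \sum_c (val g i b * val g j c) *: coval (a (n b c : M)) (frob x * frob g)%g.
  rewrite tw_actE !sum_ord2 !linearD !linearZ !hom_act.
  by [].
under [LHS]eq_bigr do under eq_bigr do rewrite E scaler_sumr.
under [LHS]eq_bigr do under eq_bigr do under eq_bigr do rewrite scaler_sumr.
rewrite exchange4; apply: eq_bigr => b _; apply: eq_bigr => c _.
rewrite frobM !SL2_valM_entry big_distrlr scaler_suml; apply: eq_bigr => i _ /=.
rewrite scaler_suml; apply: eq_bigr => j _; rewrite scalerA; congr (_ *: _); rewrite ?mulr1n ?mulr0n; ring.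
Qed.

Definition mulco : rational_hom (Tw M) (coMod k^o) := hom_of mulco_linear mulco_act.

Lemma mulcoE n x : coval (mulco n) x =
  \sum_i \sum_j val x 0 i * val x 1 j *: coval (a (n i j : M)) (frob x).
Proof. by []. Qed.

(** Row operations turn the relation with the rows (0, 1) into the relations with
    all pairs of rows; then the inverse matrix applies to both indices. *)
Lemma mulco_inj : (forall v, a v = 0 -> v = 0) -> forall n, mulco n = 0 -> n = 0.
Proof.
move=> ai n Hn.
pose A i j : G -> k^o := coval (a (n i j : M)).
have HA i j : rmap (A i j) by exact: coP.
pose q u v (x : G) : k^o := \sum_i \sum_j val x u i * val x v j *: A i j (frob x).
have H01 x : q 0 1 x = 0.
  by rewrite -[LHS](mulcoE n x) Hn.
pose P (c : 'I_2 -> 'I_2 -> k) l x (r : k) : k^o := \sum_i \sum_j c i j *: A i j (elem l r * frob x)%g.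
have HP c l x : polyn (P c l x).
  by apply: polyn_sum => i; apply: polyn_sum => j; apply: polynZ; exact: rmap_elem.
have P0 c l x : P c l x 0 = \sum_i \sum_j c i j *: A i j (frob x).
  by rewrite /P elem0 mul1g.
have el (u v : 'I_2) s x l : val (elem u s * x)%g v l = val x v l + (u == v)%:R * s * val x (other u) l.
  case: eqP => [->|/eqP uv]; first by rewrite elem_mul mul1r.
  have -> : v = other u.
    by move: uv; rewrite /other; case: (ord2P u) => ->; case: (ord2P v) => ->; rewrite ?subr0 ?subrr.
  by rewrite !mul0r addr0 elem_mul_other.
have split (c d : 'I_2 -> 'I_2 -> k) l x :
    (forall t, \sum_i \sum_j (c i j + t * d i j) *: A i j (elem l (t ^+ 2) * frob x)%g = 0) ->
    \sum_i \sum_j d i j *: A i j (frob x) = 0.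
  move=> H; have [t _|_ E] := even_odd_inj (HP c l x) (HP d l x) _ 0; last by rewrite -(P0 d l x).
  rewrite -[RHS](H t) /P scaler_sumr -big_split; apply: eq_bigr => i _ /=.
  rewrite scaler_sumr -big_split; apply: eq_bigr => j _ /=.
  by rewrite scalerDl scalerA.
have H11 x : q 1 1 x = 0.
  apply: (split (fun i j => val x 0 i * val x 1 j) _ 0) => t.
  rewrite -[RHS](H01 (elem 0 t * x)%g) /q frob_elem_mul.
  apply: eq_bigr => i _; apply: eq_bigr => j _; rewrite !el /= /other ?subr0 ?subrr; congr (_ *: _); rewrite ?mulr1n ?mulr0n; ring.
have H00 x : q 0 0 x = 0.
  apply: (split (fun i j => val x 0 i * val x 1 j) _ 1) => t.
  rewrite -[RHS](H01 (elem 1%R t * x)%g) /q frob_elem_mul.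
  apply: eq_bigr => i _; apply: eq_bigr => j _; rewrite !el /= /other ?subr0 ?subrr; congr (_ *: _); rewrite ?mulr1n ?mulr0n; ring.
have H10 x : q 1 0 x = 0.
  suff : \sum_i \sum_j (val x 0 i * val x 1 j + val x 1 i * val x 0 j) *: A i j (frob x) = 0.
    move=> E; transitivity (q 0 1 x + q 1 0 x); first by rewrite H01 add0r.
    rewrite -[RHS]E /q -big_split; apply: eq_bigr => i _ /=.
    by rewrite -big_split; apply: eq_bigr => j _ /=; rewrite scalerDl.
  have [|t _|_ E] := even_odd_inj (p := fun r => P (fun i j => val x 1 i * val x 1 j) 1 x r
      + r *: P (fun i j => val x 0 i * val x 0 j) 1 x r)
    (q := P (fun i j => val x 0 i * val x 1 j + val x 1 i * val x 0 j) 1 x) _ (HP _ _ _) _ 0.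
  - exact: (polynD (HP _ 1 x) (polynX (HP _ 1 x))).
  - rewrite -[RHS](H11 (elem 1%R t * x)%g) /q /P frob_elem_mul !scaler_sumr -!big_split.
    apply: eq_bigr => i _ /=; rewrite !scaler_sumr -!big_split; apply: eq_bigr => j _ /=.
    rewrite !scalerA -!scalerDl !el /= /other ?subr0 ?subrr; congr (_ *: _); rewrite ?mulr1n ?mulr0n; ring.
  by rewrite -(P0 _ 1 x).
apply: tw_inj => i j; apply: ai; apply/co_inj => y; have [x <-] := frob_surj hk y.
have Hq u v : q u v x = 0.
  by case: (ord2P u) => ->; case: (ord2P v) => ->.
apply: (@ivc_solve k k^o x (fun j => A i j (frob x))) => v.
apply: (@ivc_solve k k^o x (fun i => \sum_j val x v j *: A i j (frob x))) => u.
rewrite -[RHS](Hq u v); apply: eq_bigr => i' _; rewrite scaler_sumr.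
by apply: eq_bigr => j' _; rewrite scalerA.
Qed.

End Multiply.

Fact tau0_linear : linear (fun c : Nabla k 0 => mkco (rmap_cst ((c : 'rV[k]_1) 0 0 : k^o))).
Proof. by move=> a u v; apply/co_inj => x; rewrite co_linE !mkcoE !mxE. Qed.
Lemma subst0 (A : 'M[k]_2) : subst 0 A = 1%:M.
Proof. by apply/matrixP => i j; rewrite !ord1 !mxE /= mulr1 coef1. Qed.
Fact tau0_act g (c : Nabla k 0) : mkco (rmap_cst ((act g c : 'rV[k]_1) 0 0 : k^o)) =
  act g (mkco (rmap_cst ((c : 'rV[k]_1) 0 0 : k^o))).
Proof. by apply/co_inj => x; rewrite co_actE !mkcoE nab_actE subst0 mulmx1. Qed.

(** The tower, realized by functions on the group. *)
Fixpoint tau (r : nat) : rational_hom (Tr r) (coMod k^o) :=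
  if r is s.+1 then mulco (tau s) else hom_of tau0_linear tau0_act.

Lemma tau_inj r v : tau r v = 0 -> v = 0.
Proof.
elim: r v => [|r IH] v; last exact: mulco_inj.
move=> /(congr1 (fun f => coval f 1%g)) H.
by apply/rowP => i; rewrite ord1 mxE; exact: H.
Qed.

Lemma tau_step r v : tau r.+1 (step r v) = tau r v.
Proof.
elim: r v => [|r IH] v; apply/co_inj => x; last first.
  rewrite mulcoE [RHS]mulcoE; apply: eq_bigr => i _; apply: eq_bigr => j _.
  by rewrite -[tau r.+1 (_ i j)]/(tau r.+1 (step r (v i j))) IH.
rewrite mulcoE !sum_ord2.
have E i j : coval (tau 0 (step 0 v i j : Nabla k 0)) (frob x) =
    if (shift i j == 1)%N then (v : 'rV[k]_1) 0 0 else 0.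
  rewrite -[LHS]/((nabA hk 0 v i j : 'rV[k]_1) 0 0) nabA_coef.
  rewrite -[(2 * (0%R : 'I_1) + shift i j)%N]/(shift i j).
  case: (shift i j) => [|[|r]] //=; first exact: (ext0_ord _ (0 : 'I_1)).
  by rewrite ext0_ge.
rewrite !E /shift /= !scaler0 add0r addr0 -scalerDl.
rewrite -[RHS]/((v : 'rV[k]_1) 0 0) -[RHS](scale1r ((v : 'rV[k]_1) 0 0 : k^o)) -(SL2_det_char2 hk x).
by [].
Qed.

Lemma tau_step_le r d v : exists w, tau (r + d) w = tau r v.
Proof.
elim: d => [|d [w Hw]]; first by rewrite addn0; exists v.
by rewrite addnS; exists (step _ w); rewrite tau_step.
Qed.

(** ** Weights for the left action of the torus *)

(** The sums of functions of nonzero weight under left translation by the torus.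
    A weight is the difference p - q of two natural numbers, which avoids negative
    powers. *)
Inductive nz : (G -> k) -> Prop :=
| nz0 : nz (fun=> 0)
| nz_add p q h1 h2 : p != q ->
    (forall x t, t != 0 -> t ^+ q * h1 (torus t * x)%g = t ^+ p * h1 x) ->
    nz h2 -> nz (fun x => h1 x + h2 x).

Lemma nz_ext f h : nz f -> f =1 h -> nz h.
Proof. by move=> Hf /funext <-. Qed.

Lemma nzD f h : nz f -> nz h -> nz (fun x => f x + h x).
Proof.
elim=> [|p q h1 h2 pq H1 _ IH] Hh.
  by apply: (nz_ext Hh) => x; rewrite add0r.
by apply: (nz_ext (nz_add pq H1 (IH Hh))) => x; rewrite addrA.
Qed.

Lemma nzZ c f : nz f -> nz (fun x => c * f x).
Proof.
elim=> [|p q h1 h2 pq H1 _ IH].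
  by apply: (nz_ext nz0) => x; rewrite mulr0.
have H1' x t : t != 0 -> t ^+ q * (c * h1 (torus t * x)%g) = t ^+ p * (c * h1 x).
  by move=> t0; rewrite mulrCA H1 // mulrCA.
by apply: (nz_ext (nz_add pq H1' IH)) => x; rewrite mulrDr.
Qed.

Lemma nz_mulr g f : nz f -> nz (fun x => f (x * g)%g).
Proof.
elim=> [|p q h1 h2 pq H1 _ IH]; first exact: nz0.
by apply: (nz_add pq _ IH) => x t t0; rewrite -mulgA H1.
Qed.

(** Along the torus, functions of nonzero weight have no constant term; the
    factor t^N makes this a statement about polynomials. *)
Lemma nz_torus f x : nz f -> exists (N : nat) (P : {poly k}),
  P`_N = 0 /\ forall t, t != 0 -> t ^+ N * f (torus t * x)%g = P.[t].
Proof.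
elim=> [|p q h1 h2 pq H1 _ [N [P [PN EP]]]].
  by exists 0%N, 0; rewrite coef0; split=> // t _; rewrite mulr0 horner0.
exists (N + q)%N, ('X^(N + p) * (h1 x)%:P + 'X^q * P); split.
  rewrite coefD coefMC coefXn eqn_add2l eq_sym (negPf pq) mul0r add0r.
  by rewrite coefXnM addnK ltnNge leq_addl /= PN.
move=> t t0; rewrite exprD mulrDr -mulrA H1 // hornerD !hornerM !hornerXn hornerC exprD.
by rewrite mulrA [t ^+ N * _ * h2 _]mulrAC EP // [P.[t] * _]mulrC.
Qed.

Lemma nz_uniq y f : (forall x t, t != 0 -> y (torus t * x)%g = y x) -> nz f ->
  (forall x, y x + f x = 0) -> forall x : G, y x = 0.
Proof.
move=> Hy /nz_torus Hf E x; have [N [P [PN EP]]] := Hf x.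
pose Z : {poly k} := (y x)%:P * 'X^N + P.
have Z0 : Z = 0.
  apply/eqP; apply: contraT => Zn.
  have /closed_nonrootP[t] : 'X * Z != 0 by rewrite mulf_neq0 ?polyX_eq0.
  rewrite /root hornerM hornerX mulf_eq0 negb_or => /andP[t0] /eqP[].
  rewrite /Z hornerD hornerM hornerC hornerXn -EP // mulrC -mulrDr.
  by rewrite -(Hy x t) // E mulr0.
have := congr1 (fun p : {poly k} => p`_N) Z0.
by rewrite /Z coefD coefCM coefXn eqxx mulr1 PN addr0 coef0.
Qed.

Lemma tau_torus r v x t : t != 0 -> coval (tau r v) (torus t * x)%g = coval (tau r v) x.
Proof.
elim: r v x t => [|r IH] v x t t0; first by [].
rewrite !mulcoE; apply: eq_bigr => i _; apply: eq_bigr => j _.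
rewrite torus_mul0 // torus_mul1 // mulrACA divff // mul1r; congr (_ *: _).
rewrite frobM (_ : frob (torus t) = torus (t ^+ 2)) ?IH ?expf_neq0 //.
apply/val_inj/matrixP => a b; rewrite frobE /= !mxE sqrf_eq0 (negPf t0).
by case: ifP => _; case: ifP => _; rewrite ?exprVn ?expr0n.
Qed.

Definition mono (a b c d : nat) (x : G) : k :=
  val x 0 0 ^+ a * val x 0 1 ^+ b * val x 1 0 ^+ c * val x 1 1 ^+ d.

Definition in_tau r (f : G -> k) := exists v, forall x, coval (tau r v) x = f x.

Lemma in_tauD r f h : in_tau r f -> in_tau r h -> in_tau r (fun x => f x + h x).
Proof. by move=> [v Hv] [w Hw]; exists (v + w) => x; rewrite linearD -(Hv x) -(Hw x). Qed.

Lemma in_tauZ r c f : in_tau r f -> in_tau r (fun x => c * f x).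
Proof. by move=> [v Hv]; exists (c *: v) => x; rewrite linearZ -(Hv x). Qed.

Lemma in_tau_le r r' f : (r <= r')%N -> in_tau r f -> in_tau r' f.
Proof.
move=> Hr [v Hv]; have [w Hw] := tau_step_le (r' - r) v.
by rewrite subnKC // in w Hw; exists w => x; rewrite Hw.
Qed.

Lemma mono_frob a b c d x : mono a b c d (frob x) = mono (2 * a) (2 * b) (2 * c) (2 * d) x.
Proof. by rewrite /mono !frobE -!exprM. Qed.

Lemma in_tau_mul r (i j : 'I_2) f : in_tau r f ->
  in_tau r.+1 (fun x => val x 0 i * val x 1 j * f (frob x)).
Proof.
move=> [v Hv]; exists ((fun i' j' => if (i' == i) && (j' == j) then v else 0) : Tw (Tr r)) => x.
rewrite mulcoE (bigD1 i) //= (bigD1 j) //= !eqxx /= Hv.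
rewrite big1 ?addr0 => [|j' /negPf Hj]; last first.
  by rewrite Hj ?andbF linear0 scaler0.
rewrite big1 ?addr0 // => i' /negPf Hi; apply: big1 => j' _.
by rewrite Hi linear0 scaler0.
Qed.

Lemma in_tau_odd r s : (forall a b c d, a + b = s -> c + d = s -> in_tau r (mono a b c d))%N ->
  forall a b c d, (a + b = 2 * s + 1 -> c + d = 2 * s + 1 -> in_tau r.+1 (mono a b c d))%N.
Proof.
move=> H a b c d Eab Ecd.
pose i : 'I_2 := if odd a then 0 else 1; pose j : 'I_2 := if odd c then 0 else 1.
have [v Hv] := @in_tau_mul r i j _ (H a./2 b./2 c./2 d./2 ltac:(lia) ltac:(lia)).
exists v => x; rewrite Hv mono_frob /i /j /mono.
have Ha := odd_double_half a; have Hb := odd_double_half b.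
have Hc := odd_double_half c; have Hd := odd_double_half d.
rewrite -!mul2n in Ha Hb Hc Hd.
have ob : odd b = ~~ odd a by lia. have od : odd d = ~~ odd c by lia.
rewrite -[in RHS]Ha -[in RHS]Hb -[in RHS]Hc -[in RHS]Hd !exprD ob od.
by case: (odd a); case: (odd c); rewrite /= ?expr0 ?expr1 ?mul1r; ring.
Qed.

(** The monomials of weight zero are those with the same degree s in both rows.
    If s is odd, each row contributes one entry times a square, and the squares
    come from a monomial of degree (s - 1) / 2 in each row, one stage earlier, by
    composition with Frobenius. *)
Lemma in_tau_mono s : exists r, forall a b c d, (a + b = s -> c + d = s -> in_tau r (mono a b c d))%N.
Proof.
elim/ltn_ind: s => s IH.
have [->|s0] := posnP s.
  exists 0%N => a b c d; case: a => //; case: b => // _; case: c => //; case: d => // _.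
  by exists (1%:M : 'rV[k]_1) => x; rewrite /mono !expr0 !mulr1; exact: (mxE _ _ 0 0).
have [r Hr] : exists r, forall a b c d,
    (a + b = 2 * s./2 + 1 -> c + d = 2 * s./2 + 1 -> in_tau r (mono a b c d))%N.
  have [r Hr] := IH s./2 ltac:(lia); exists r.+1; exact: in_tau_odd.
exists r => a b c d Eab Ecd; have [os|es] := boolP (odd s).
  by apply: Hr; lia.
(* Multiply by the determinant to make the degrees odd. *)
have [||v Hv] := @in_tauD r (mono a.+1 b c d.+1) (mono a b.+1 c.+1 d); try (apply: Hr; lia).
exists v => x; rewrite Hv -[RHS]mulr1 -[X in _ = _ * X](SL2_det_char2 hk x).
by rewrite /mono !exprS; ring.
Qed.

(** The invariant component is required to lie in the tower. Once this is
    shown for all regular functions, the union of the tower is known to contain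
    all the functions invariant under the torus. *)
Definition good (f : G -> k) := exists r y h, [/\ in_tau r y, nz h & forall x, f x = y x + h x].

Lemma goodD f h : good f -> good h -> good (fun x => f x + h x).
Proof.
move=> [r [y [n [Hy Hn E]]]] [r' [y' [n' [Hy' Hn' E']]]].
exists (r + r')%N, (fun x => y x + y' x), (fun x => n x + n' x); split.
- by apply: in_tauD; [apply: in_tau_le Hy|apply: in_tau_le Hy']; rewrite ?leq_addr ?leq_addl.
- exact: nzD.
by move=> x; rewrite E E' addrACA.
Qed.

Lemma goodZ c f : good f -> good (fun x => c * f x).
Proof.
move=> [r [y [n [Hy Hn E]]]]; exists r, (fun x => c * y x), (fun x => c * n x).
by split; [exact: in_tauZ|exact: nzZ|move=> x; rewrite E mulrDr].
Qed.

Lemma in_tau0 r : in_tau r (fun=> 0).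
Proof. by exists 0 => x; rewrite linear0. Qed.

Lemma good_mono a b c d : good (mono a b c d).
Proof.
have [E|E] := eqVneq (a + b)%N (c + d)%N.
  have [r Hr] := in_tau_mono (a + b).
  exists r, (mono a b c d), (fun=> 0).
  by split; [exact: Hr|exact: nz0|move=> x; rewrite addr0].
exists 0%N, (fun=> 0), (mono a b c d); split; [exact: in_tau0| |by move=> x; rewrite add0r].
apply: (nz_ext (@nz_add _ _ (mono a b c d) (fun=> 0) E _ nz0)) => [x t t0|x]; last by rewrite addr0.
rewrite /mono !torus_mul0 // !torus_mul1 // !exprMn !exprVn !exprD.
have tc : t ^+ c != 0 by rewrite expf_neq0.
have td : t ^+ d != 0 by rewrite expf_neq0.
by field; rewrite tc td.
Qed.

Lemma good_regular f : regular f -> good f.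
Proof.
move=> [P HP].
have {HP}-> : f = fun x : G => meval (mxvec (val x) 0) P by apply/funext.
elim/mpolyind: P => [|c m p _ _ IH].
  exists 0%N, (fun=> 0), (fun=> 0); split; [exact: in_tau0|exact: nz0|].
  by move=> x; rewrite meval0 addr0.
have H := goodD (goodZ c (good_mono (m (mxvec_index 0 0)) (m (mxvec_index 0 1))
   (m (mxvec_index 1 0)) (m (mxvec_index 1 1)))) IH.
rewrite (_ : (fun=> _) = fun x : G => c * mono (m (mxvec_index 0 0)) (m (mxvec_index 0 1))
   (m (mxvec_index 1 0)) (m (mxvec_index 1 1)) x + meval (mxvec (val x) 0) p) //.
apply/funext => x; rewrite mevalD mevalZ mevalX; congr (_ * _ + _).
rewrite (reindex (uncurry (@mxvec_index 2 2))) /=; last first.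
  have [h H1 H2] := curry_mxvec_bij 2 2; by exists h => y _; rewrite ?H1 ?H2.
transitivity (\prod_i \prod_j (mxvec (val x) 0 (mxvec_index i j)) ^+ m (mxvec_index i j)).
  by rewrite pair_bigA; apply: eq_bigr => -[].
have prod2 (h : 'I_2 -> k) : \prod_i h i = h 0 * h 1.
  by rewrite big_ord_recl big_ord1; congr (h _ * h _); apply/val_inj.
by rewrite !prod2 !mxvecE /mono mulrA.
Qed.

(** The union of the tower is a direct summand of the coordinate ring: left
    translation by the torus commutes with the action, so the projection to weight
    zero is equivariant. *)
Lemma weight0_ex : exists p : rational_hom (coMod k^o) (coMod k^o),
  (forall r v, p (tau r v) = tau r v) /\ forall f, exists r v, p f = tau r v.
Proof.
pose R (f y : coMod k^o) := (exists r v, y = tau r v) /\ nz (fun x => coval f x - coval y x).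
have Rl c u v y z : R u y -> R v z -> R (c *: u + v) (c *: y + z).
  move=> [[r [w ->]] Hu] [[r' [w' ->]] Hv]; split.
    have [a Ha] := tau_step_le r' w; have [a' Ha'] := tau_step_le r w'.
    rewrite addnC in a' Ha'; exists (r + r')%N, (c *: a + a').
    by rewrite linearP Ha Ha'.
  apply: (nz_ext (nzD (nzZ c Hu) Hv)) => x; rewrite !co_linE.
  by rewrite mulrBr opprD addrACA.
have R0 y : R 0 y -> y = 0.
  move=> [[r [v ->]] Hn]; apply/co_inj => x.
  apply: (nz_uniq (@tau_torus r v) Hn) => z.
  by rewrite [X in _ + (X - _)](_ : _ = 0) // sub0r subrr.
have [||||p Hp] := @rel_hom _ _ _ R.
- move=> f; have Hf : regular (coval f).
    have [n [h [w [Hh E]]]] := coP f.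
    rewrite (_ : coval f = fun x => \sum_i h i x * w i); last by apply/funext.
    by apply: regular_sum => i; apply: regularM => //; exact: regular_cst.
  have [r [y [h [[v Hv] Hh E]]]] := good_regular Hf.
  exists (tau r v); split; first by exists r, v.
  by apply: (nz_ext Hh) => x; rewrite E Hv addrC addKr.
- exact: Rl.
- exact: R0.
- move=> g f y [[r [v ->]] Hn]; split; first by exists r, (act g v); rewrite hom_act.
  exact: (nz_mulr g Hn).
exists p; split; last by move=> f; have [[r [v E]] _] := Hp f; exists r, v.
move=> r v; apply: (rel_uniq Rl R0 (Hp _)); split; first by exists r, v.
by apply: (nz_ext nz0) => x; rewrite subrr.
Qed.

(** * The trivial module is acyclic *)

Lemma qn_inj n (M N : ratmod) (a : rational_hom M N) :
  (forall v, a v = 0 -> v = 0) -> forall z, qn n a z = 0 -> z = 0.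
Proof.
move=> ai; elim: n => [|n IH] z; first exact: ai.
by move=> E; apply/q_inj => x; apply: IH; rewrite -[LHS]/(qval (qn n.+1 a z) x) E.
Qed.

Lemma qn_tau_le n r d (w : Qn n (Tr r)) : exists w', qn n (tau (r + d)) w' = qn n (tau r) w.
Proof.
elim: d => [|d [w' Hw]]; first by rewrite addn0; exists w.
rewrite addnS; exists (qn n (step _) w').
by rewrite -Hw -(qn_comp (c := tau (r + d))) // => v; rewrite tau_step.
Qed.

(** A cochain has finitely many coefficients, so that it lives at a finite
    stage of the tower once its values are in the union. *)
Lemma qn_tau_union n (p : rational_hom (coMod k^o) (coMod k^o)) :
  (forall f, exists r v, p f = tau r v) ->
  forall w, exists r w', qn n p w = qn n (tau r) w'.
Proof.
move=> Hp; elim: n => [|n IH] w; first exact: Hp.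
have [m [h [v [Hh E]]]] := qP w.
have [r Hr] := choice (fun i => IH (v i)).
pose R := \sum_i r i.
have H i : exists u, qn n p (v i) = qn n (tau R) u.
  have [u Hu] := Hr i; have [u' Hu'] := qn_tau_le (R - r i) u.
  have rR : (r i <= R)%N by rewrite /R (bigD1 i) //= leq_addr.
  by rewrite subnKC // in u' Hu'; exists u'; rewrite Hu Hu'.
have [u Hu] := choice H.
have [w' Hw'] : exists w', qn n.+1 (tau R) w' = qn n.+1 p w.
  apply: (@qmap_lift k _ _ (qn n (tau R)) (qn n.+1 p w) m h u Hh) => x.
  rewrite -[LHS]/(qn n p (qval w x)) E linear_sum; apply: eq_bigr => i _.
  by rewrite (linearZ_LR (hom_fun (qn n p))) Hu.
by exists R, w'.
Qed.

Fixpoint tower (r : nat) : rational_hom (Tr 0) (Tr r) :=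
  if r is s.+1 then hom_comp (step s) (tower s) else hom_id (Tr 0).

Lemma tau_tower r v : tau r (tower r v) = tau 0 v.
Proof. by elim: r => [|r IH] //; rewrite -[tower r.+1 v]/(step r (tower r v)) tau_step. Qed.

Lemma cob_tower n r (z : Qn n.+1 (Tr 0)) : inv z -> cob (qn n.+1 (tower r) z) -> cob z.
Proof.
move=> zi; elim: r => [|r IH]; first by rewrite qn_id.
rewrite (qn_comp (c := tower r.+1) (b := step r) (a := tower r)) // => H.
apply: IH; apply: (LES_cob (ses_step r) (Hle_Cr n r)) => //.
exact: inv_hom.
Qed.

(** A class of the trivial module dies in the coordinate ring, hence in the
    torus-invariant functions, hence at a finite stage of the tower. But the
    tower is injective on cohomology, since its successive cokernels are
    acyclic. *)
Lemma Hle_trivial n : Hle n.+1 (Nabla k 0) 0.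
Proof.
apply/Hle0P => z zi.
have [w Hw] := (proj1 (Hle0P _ _) (relinj_acyclic n (relinj_co k^o))) _
  (inv_hom (qn n.+1 (tau 0)) zi).
have [p [p1 p2]] := weight0_ex.
have [r [w' Hw']] := qn_tau_union p2 w.
apply: (@cob_tower n r) => //; exists w'.
apply: (hom_inj (@qn_inj n.+1 _ _ _ (@tau_inj r))).
rewrite -(qn_comp (c := tau 0)) => [|v]; last by rewrite tau_tower.
rewrite [RHS]qmap_delta -Hw' -qmap_delta -Hw -[RHS]/(qn n.+1 p _).
by rewrite -(qn_comp (c := tau 0)) // => v; rewrite p1.
Qed.

End Trivial.

(** * Partitions into powers of 2 *)

Section Counting.
Local Open Scope nat_scope.

(** The number of partitions of c into n + 1 powers of 2, for c > 0: remove a part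
    1 or halve all parts. The argument f only bounds the recursion depth; any
    f >= c gives the same value. *)
Fixpoint bp_rec (f n c : nat) : nat :=
  if f is g.+1 then
    if c <= 1 then (n == 0 : nat)
    else (if n is m.+1 then bp_rec g m c.-1 else 0) + (if odd c then 0 else bp_rec g n c./2)
  else 0.

Definition bp n c := bp_rec c n c.

Lemma bp_fuel f f' n c : 0 < c -> c <= f -> c <= f' -> bp_rec f n c = bp_rec f' n c.
Proof.
elim: f f' n c => [|f IH] [|f'] n c //=; try lia.
move=> c0 Hf Hf'; case: ifP => // c1; congr (_ + _).
  by case: n => // n; apply: IH; lia.
by case: ifP => // oc; apply: IH; lia.
Qed.

Lemma bp_recE n c : 1 < c -> bp n c =
  (if n is m.+1 then bp_rec c.-1 m c.-1 else 0) + (if odd c then 0 else bp_rec c.-1 n c./2).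
Proof. by case: c => [|[|c]]. Qed.

Lemma bp_odd0 c : 1 < c -> odd c -> bp 0 c = 0.
Proof. by move=> c1 oc; rewrite bp_recE // oc. Qed.

Lemma bp_even0 c : 0 < c -> bp 0 (2 * c) = bp 0 c.
Proof.
move=> c0; rewrite bp_recE; last lia.
rewrite (_ : odd (2 * c) = false); last lia.
rewrite (_ : (2 * c)./2 = c) ?add0n; last lia.
by apply: bp_fuel; lia.
Qed.

Lemma bp_oddS n c : 0 < c -> odd c.+1 -> bp n.+1 c.+1 = bp n c.
Proof. by move=> c0 oc; rewrite bp_recE // oc addn0. Qed.

Lemma bp_evenS n c : 0 < c -> bp n.+1 (2 * c) = bp n (2 * c).-1 + bp n.+1 c.
Proof.
move=> c0; rewrite bp_recE; last lia.
rewrite (_ : odd (2 * c) = false); last lia.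
rewrite (_ : (2 * c)./2 = c); last lia.
by congr (_ + _); apply: bp_fuel; lia.
Qed.

Lemma bp_mono n c : 0 < c -> bp n c <= bp n.+1 c.+1.
Proof.
move=> c0; have [oc|ec] := boolP (odd c.+1); first by rewrite bp_oddS.
have [d Ed] : exists d, c.+1 = 2 * d by exists c.+1./2; lia.
by rewrite Ed bp_evenS ?leq_addr //; [rewrite -Ed leq_addr|lia].
Qed.

Lemma bp0_le1 c : 0 < c -> bp 0 c <= 1.
Proof.
elim/ltn_ind: c => c IH c0; have [oc|ec] := boolP (odd c).
  have [c1|c1] := ltnP 1 c; first by rewrite bp_odd0.
  by rewrite (_ : c = 1) //; lia.
have [d Ed] : exists d, c = 2 * d by exists c./2; lia.
by rewrite Ed bp_even0; [apply: IH|]; lia.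
Qed.

Lemma bp1_le1 c : 0 < c -> bp 1 c <= 1.
Proof.
elim/ltn_ind: c => c IH c0; have [oc|ec] := boolP (odd c).
  have [c1|c1] := ltnP 1 c; last by rewrite (_ : c = 1) //; lia.
  rewrite -[c]prednK // bp_oddS; [apply: bp0_le1| |]; try lia.
have [d Ed] : exists d, c = 2 * d by exists c./2; lia.
have [d1|d1] := ltnP 1 d; last by rewrite Ed (_ : d = 1) //; lia.
by rewrite Ed bp_evenS 1?bp_odd0 ?add0n; [apply: IH|..]; lia.
Qed.

Lemma bp_two n : bp n.+2 2 = 0. Proof. by []. Qed.

Lemma bp_double n d : 1 < d -> bp n.+2 (2 * d) = bp n (2 * d.-1) + bp n.+2 d.
Proof.
move=> d1; rewrite bp_evenS; last lia.
rewrite (_ : (2 * d).-1 = (2 * d.-1).+1); last lia.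
by rewrite bp_oddS; lia.
Qed.

(** Splitting off the ones, two at a time. *)
Lemma bp_unroll n d : 0 < n -> 1 < d ->
  bp n (2 * d) <= bp n d + \sum_(1 <= m < n) bp m.-1 d.-1.
Proof.
elim/ltn_ind: n d => -[|[|n]] IH d // _ d1.
  by rewrite bp_evenS 1?bp_odd0 ?add0n ?leq_addr; lia.
rewrite bp_double // addnC leq_add2l.
rewrite big_nat_recr //= addnC.
have [d2|d2] := ltnP 2 d; last first.
  have -> : d = 2 by lia.
  rewrite -[2 * 2.-1]/2; case: n {IH} => [|[|n]]; first by rewrite leq_addr.
    by rewrite big_nat1.
  by rewrite bp_two.
case: n IH => [|n] IH.
  by rewrite big_nil addn0 bp_even0; lia.
apply: leq_trans (IH n.+1 _ d.-1 _ _) _; try lia.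
rewrite leq_add2l [X in _ <= X]big_ltn // [X in _ <= _ + X]big_add1 /=.
apply: leq_trans (leq_addl _ _); rewrite !(@big_nat _ _ _ 1); apply: leq_sum => m /andP[m0 _].
rewrite -[X in _ <= bp X _]prednK // -[X in _ <= bp _ X]prednK; last lia.
by apply: bp_mono; lia.
Qed.

Lemma fib_even_sum n : \sum_(1 <= m < n.+1) fib (2 * m) < fib (2 * n).+1.
Proof.
elim: n => [|n IH]; first by rewrite big_geq.
rewrite big_nat_recr // (_ : 2 * n.+1 = (2 * n).+2); last lia.
rewrite -[fib (2 * n).+3]/(fib (2 * n).+2 + fib (2 * n).+1) [X in _ < X]addnC ltn_add2r.
exact: IH.
Qed.

(** For even c = 2d and n > 1, unrolling the recursion down to the odd part of d
    bounds the count by F(2n - 2) plus the sum of the [bp m d] for 0 < m < n. By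
    induction the latter are at most F(2m), and these numbers sum to less than
    F(2n - 1). *)
Lemma bp_le_fib n c : 0 < n -> 0 < c -> bp n c <= fib (2 * n).
Proof.
elim/ltn_ind: n c => -[|[|n]] IHn c // _ c0; first exact: bp1_le1.
have Efib : fib (2 * n.+2) = fib (2 * n.+1).+1 + fib (2 * n.+1).
  by rewrite (_ : 2 * n.+2 = (2 * n.+1).+2); last lia.
have bp_odd d : 1 < d -> odd d -> bp n.+2 d <= fib (2 * n.+1).
  by move=> d1 od; rewrite -[d]prednK ?bp_oddS ?prednK //; try apply: IHn; lia.
have J d : 0 < d -> bp n.+2 (2 * d) <= fib (2 * n.+1) + \sum_(1 <= m < n.+2) bp m d.
  elim/ltn_ind: d => d IH d0; have [d1|d1] := ltnP 1 d; last first.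
    by have -> : d = 1 by lia.
  apply: leq_trans (bp_unroll _ _) _ => //.
  have [od|ed] := boolP (odd d).
    apply: leq_add; first exact: bp_odd.
    rewrite !(@big_nat _ _ _ 1); apply: leq_sum => m /andP[m0 _].
    rewrite -[X in _ <= bp X _]prednK // -[X in _ <= bp _ X]prednK; last lia.
    by apply: bp_mono; lia.
  have [e Ee] : exists e, d = 2 * e by exists d./2; lia.
  have {}IH : bp n.+2 d <= fib (2 * n.+1) + \sum_(1 <= m < n.+2) bp m e.
    by rewrite Ee; apply: IH; lia.
  apply: leq_trans (leq_add IH (leqnn _)) _; rewrite -addnA leq_add2l -big_split /=.
  rewrite !(@big_nat _ _ _ 1); apply: leq_sum => -[|m] // _.
  by rewrite addnC [in X in _ <= X]Ee bp_evenS /= ?Ee //; lia.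
have [oc|ec] := boolP (odd c).
  have [c1|c1] := ltnP 1 c; last by rewrite (_ : c = 1) //; lia.
  by apply: leq_trans (bp_odd _ c1 oc) _; rewrite Efib leq_addl.
have [d Ed] : exists d, c = 2 * d by exists c./2; lia.
have d0 : 0 < d by lia.
rewrite Ed Efib addnC; apply: leq_trans (J d d0) _; rewrite leq_add2l.
apply: leq_trans (ltnW (fib_even_sum n.+1)).
by rewrite !(@big_nat _ _ _ 1); apply: leq_sum => m /andP[m0 mn]; apply: IHn.
Qed.

End Counting.

(** * The cohomology of the modules Delta *)

Section Weyl.
Variable k : closedFieldType.
Local Notation G := (SL2 k).

Section Bound.
Hypothesis hk : 2%N \in [pchar k].

Lemma Hle_Delta0 n : Hle n (Delta k 0) (n == 0%N).
Proof.
case: n => [|n].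
  exists (fun=> const_mx 1); split.
    by move=> i g; rewrite del_actE subst0 mul1mx.
  move=> z _; exists (fun=> (z : 'cV_1) 0 0).
  apply/eqP; rewrite big_ord1 subr_eq0; apply/eqP/colP => i.
  by rewrite !mxE mulr1 !ord1.
have Hl : linear (fun x : Delta k 0 => (x : 'cV_1)^T : Nabla k 0).
  by move=> a u v; rewrite linearP.
have Hl' : linear (fun x : Nabla k 0 => (x : 'rV_1)^T : Delta k 0).
  by move=> a u v; rewrite linearP.
have Ha g (x : Delta k 0) : (act g x : 'cV_1)^T = act g ((x : 'cV_1)^T : Nabla k 0).
  by rewrite del_actE nab_actE !subst0 mul1mx mulmx1.
have Ha' g (x : Nabla k 0) : (act g x : 'rV_1)^T = act g ((x : 'rV_1)^T : Delta k 0).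
  by rewrite del_actE nab_actE !subst0 mul1mx mulmx1.
apply: (Hle_retract (a := hom_of Hl Ha) (b := hom_of Hl' Ha')) (Hle_trivial hk n) => v.
exact: trmxK.
Qed.

(** The long exact sequence of [ses_del] reproduces the recursion of [bp]: the
    cohomology of Delta (2b) one degree lower corresponds to removing a part 1, and
    that of Delta b to halving. For odd b the latter vanishes, as does the second
    term of the recursion at b + 2. *)
Lemma Hle_Delta_even n c : Hle n (Delta k (2 * c)) (bp n c.+1).
Proof.
elim/ltn_ind: c n => -[|b] IH n; first exact: Hle_Delta0.
have Hb m : Hle m (Tw hk (Delta k b)) (if odd b then 0 else bp m (b./2).+1)%N.
  apply: Hle_tw; case: ifP => [ob|eb]; first exact: Hle_Delta_odd.
  have [c Ec] : exists c, b = (2 * c)%N by exists b./2; lia.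
  by rewrite Ec (_ : (2 * c)./2 = c); [apply: IH|]; lia.
rewrite (_ : (2 * b.+1)%N = (2 * b).+2); last by lia.
have S := ses_del hk b.
case: n => [|n].
  apply: Hle_le (LES_inv S (Hb 0%N)).
  case: ifP => // eb; have [c Ec] : exists c, b = (2 * c)%N by exists b./2; lia.
  have E : b.+2 = (2 * c.+1)%N by lia.
  by rewrite E (_ : b./2 = c) ?bp_even0 //; lia.
have HC : Cle n (delA hk b) (bp n b.+1) by apply: (Cle_of_Hle S); apply: IH.
apply: Hle_le (LES_left S HC (Hb n.+1)).
case: ifP => [ob|eb]; first by rewrite addn0; exact: bp_mono.
have [c Ec] : exists c, b = (2 * c)%N by exists b./2; lia.
have E : b.+2 = (2 * c.+1)%N by lia.
have E' : b./2 = c by lia.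
have E'' : (2 * c.+1).-1 = b.+1 by lia.
by rewrite E bp_evenS // E' E''.
Qed.

Lemma Hle_Delta n m : (0 < n)%N -> Hle n (Delta k m) (fib (2 * n)).
Proof.
move=> n0; have [om|em] := boolP (odd m); first exact: Hle_le (Hle_Delta_odd k n om).
have [c ->] : exists c, m = (2 * c)%N by exists m./2; lia.
exact: Hle_le (bp_le_fib n0 (ltn0Sn c)) (Hle_Delta_even n c).
Qed.

End Bound.

(** * Identification of the Weyl module *)

(** The second column is unchanged, up to a scalar, by right translation by the
    Borel subgroup of lower triangular matrices. *)
Definition col1 (x : G) : 'rV[k]_2 := \row_j val x j 1.

Lemma col1M g x : col1 (g * x)%g = col1 x *m (val g)^T.
Proof.
apply/rowP => i; rewrite !mxE; apply: eq_bigr => j _.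
by rewrite !mxE mulrC.
Qed.

Lemma col1_elem t : col1 (elem 0 t) = rv t.
Proof.
apply/rowP => i; rewrite mxE [RHS]mxE /= !mxE.
by case: (ord2P i) => ->; rewrite /= ?mulr1 ?mulr0 ?addr0 ?add0r.
Qed.

Lemma other0 : other 0 = 1. Proof. exact/val_inj. Qed.
Lemma other1 : other 1 = 0. Proof. exact/val_inj. Qed.
Lemma elem00 s (x : G) l : val (elem 0 s * x)%g 0 l = val x 0 l + s * val x 1 l.
Proof. by rewrite elem_mul other0. Qed.
Lemma elem01 s (x : G) l : val (elem 0 s * x)%g 1 l = val x 1 l.
Proof. by have := elem_mul_other 0 s x l; rewrite other0. Qed.
Lemma elem10 s (x : G) l : val (elem 1%R s * x)%g 0 l = val x 0 l.
Proof. by have := elem_mul_other 1 s x l; rewrite other1. Qed.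
Lemma elem11 s (x : G) l : val (elem 1%R s * x)%g 1 l = val x 1 l + s * val x 0 l.
Proof. by rewrite elem_mul other1. Qed.

Lemma regular_exp (f : G -> k) n : regular f -> regular (fun x => f x ^+ n).
Proof.
move=> Hf; elim: n => [|n IH]; first exact: (regular_cst 1).
rewrite (_ : (fun=> _) = fun x => f x * f x ^+ n); first exact: regularM.
by apply/funext => x; rewrite exprS.
Qed.

Lemma monZ m c (v : 'rV[k]_2) : mon m (c *: v) = c ^+ m *: mon m v.
Proof.
apply/colP => i; rewrite !mxE !exprMn mulrACA -exprD subnKC //.
by rewrite -ltnS.
Qed.

Lemma in_ind_form m (r : 'rV[k]_m.+1) : in_ind m (fun x => (r *m mon m (col1 x)) 0 0).
Proof.
split.
  rewrite (_ : (fun=> _) = fun x : G => \sum_j r 0 j * (val x 0 1 ^+ j * val x 1 1 ^+ (m - j))).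
    apply: regular_sum => j; apply: regularM; first exact: regular_cst.
    by apply: regularM; apply: regular_exp; exact: regular_coord.
  by apply/funext => x; rewrite mxE; apply: eq_bigr => j _; rewrite !mxE.
move=> g b b01.
have D := SL2_det b; rewrite b01 mul0r subr0 in D.
have b0 : val b 0 0 != 0.
  by apply/eqP => E; move: D; rewrite E mul0r => /eqP; rewrite eq_sym oner_eq0.
have E1 : val b 1 1 = (val b 0 0)^-1 by rewrite -[RHS]mulr1 -[X in _ = _ * X]D mulKf.
have -> : col1 (g * b)%g = (val b 0 0)^-1 *: col1 g.
  by apply/rowP => i; rewrite mxE SL2_valM_entry sum_ord2 b01 mulr0 add0r E1 !mxE mulrC.
by rewrite monZ -scalemxAr [LHS]mxE exprVn.
Qed.

(** Global sections of the line bundle of degree m on the projective line. In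
    each of the two charts, where an entry of the second column is nonzero, f is a
    power of that entry times a polynomial in the quotient of the two; comparing
    them on the overlap bounds the degree by m. *)
Lemma in_ind_poly m (f : G -> k) : in_ind m f ->
  exists r : 'rV[k]_m.+1, forall x, f x = (r *m mon m (col1 x)) 0 0.
Proof.
move=> [Hf Hb].
have [q Hq] := regular_elem 0 1%g Hf.
have w0P : (0 : k) * 0 - 1 * -1 = 1 by rewrite mul0r mul1r sub0r opprK.
(* The Weyl group exchanges the two charts. *)
pose w0 : G := sl2 w0P.
have [q' Hq'] := regular_elem 1 w0 Hf.
have F1 (x : G) : val x 1 1 != 0 -> f x = val x 1 1 ^+ m * q.[val x 0 1 / val x 1 1].
  move=> x11; have bP : (val x 1 1)^-1 * val x 1 1 - 0 * val x 1 0 = 1.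
    by rewrite mul0r subr0 mulVf.
  have Ex : x = (elem 0 (val x 0 1 / val x 1 1)%R * sl2 bP)%g.
    apply/val_inj/matrixP => i j; have D := SL2_det x.
    case: (ord2P i) => ->; last by rewrite elem01 mxE /=; case: (ord2P j) => ->.
    rewrite elem00 !mxE /=; case: (ord2P j) => -> /=; last by field.
    apply: (mulIf x11); transitivity (1 + val x 0 1 * val x 1 0); last by field.
    by rewrite -[X in X + _]D; ring.
  by rewrite {1}Ex Hb ?mxE //= -[elem 0 _]mulg1 Hq exprVn invrK.
have F0 (x : G) : val x 0 1 != 0 -> f x = val x 0 1 ^+ m * q'.[val x 1 1 / val x 0 1].
  move=> x01; have bP : (val x 0 1)^-1 * val x 0 1 - 0 * val x 0 0 = 1.
    by rewrite mul0r subr0 mulVf.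
  have Ex : x = (elem 1%R (val x 1 1 / val x 0 1)%R * w0 * sl2 bP)%g.
    apply/val_inj/matrixP => i j; have D := SL2_det x.
    rewrite -mulgA; case: (ord2P i) => ->.
      rewrite elem10 SL2_valM_entry sum_ord2 !mxE /=.
      by case: (ord2P j) => -> /=; ring.
    rewrite elem11 !SL2_valM_entry !sum_ord2 !mxE /=; case: (ord2P j) => -> /=; last first.
      by field.
    apply: (mulIf x01).
    transitivity (val x 0 0 * val x 1 1 - 1); last by field.
    by rewrite -[X in _ - X]D; ring.
  by rewrite {1}Ex Hb ?mxE //= Hq' exprVn invrK.
(* The reversed polynomial clears the denominators on the overlap. *)
pose N := size q'.
pose rev : {poly k} := \poly_(i < N.+1) q'`_(N - i).
have revE s : s != 0 -> rev.[s] = s ^+ N * q'.[s^-1].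
  move=> s0; rewrite horner_poly (horner_coef_wide _ (leqnSn N)) mulr_sumr.
  rewrite (reindex_inj rev_ord_inj); apply: eq_bigr => i _.
  have iN : (i <= N)%N by rewrite -ltnS.
  rewrite /= subSS subKn // mulrCA exprVn; congr (_ * _).
  by rewrite -[X in _ = s ^+ X * _](subnK iN) exprD mulfK // expf_neq0.
have EP : 'X^N * q = 'X^m * rev.
  apply/eqP; rewrite -subr_eq0; apply: contraT => Zn.
  have /closed_nonrootP[s] : 'X * ('X^N * q - 'X^m * rev) != 0.
    by rewrite mulf_neq0 ?polyX_eq0.
  rewrite /root hornerM hornerX mulf_eq0 negb_or => /andP[s0] /eqP[].
  rewrite hornerD hornerN !hornerM !hornerXn revE //.
  pose x : G := elem 0 s.
  have x01 : val x 0 1 = s by rewrite /x -[elem 0 s]mulg1 elem00 !mxE /= mulr1 add0r.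
  have x11 : val x 1 1 = 1 by rewrite /x -[elem 0 s]mulg1 elem01 !mxE.
  have := F1 x; rewrite x01 x11 expr1n mul1r divr1 => E1.
  have := F0 x; rewrite x01 x11 div1r => E0.
  by rewrite -E1 ?oner_neq0 // E0 // mulrCA subrr.
have qm i : (m < i)%N -> q`_i = 0.
  move=> mi; have := congr1 (fun p : {poly k} => p`_(N + i)) EP.
  rewrite !coefXnM ltnNge leq_addr addKn /= => ->; case: ifP => // _.
  by rewrite coef_poly; case: ltnP => // h; exfalso; lia.
have qm' : q`_m = q'`_0.
  have := congr1 (fun p : {poly k} => p`_(N + m)) EP.
  rewrite !coefXnM [in X in X = _]ltnNge leq_addr [in X in _ = X]ltnNge leq_addl /= addKn addnK => ->.
  by rewrite coef_poly ltnSn subnn.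
have sq : (size q <= m.+1)%N by apply/leq_sizeP => i; exact: qm.
exists (\row_j q`_j) => x; rewrite mxE.
have [x11|x11] := eqVneq (val x 1 1) 0; last first.
  rewrite F1 // (horner_coef_wide _ sq) mulr_sumr; apply: eq_bigr => j _.
  have jm : (j <= m)%N by rewrite -ltnS.
  rewrite !mxE mulrCA; congr (_ * _).
  rewrite -[X in val x 1 1 ^+ X * _](subnK jm) exprD exprMn -mulrA mulrC; congr (_ * _).
  by rewrite mulrCA -exprMn divff // expr1n mulr1.
have x01 : val x 0 1 != 0.
  by apply/eqP => E; have /eqP := SL2_det x; rewrite x11 E mulr0 mul0r subrr eq_sym oner_eq0.
rewrite F0 // x11 mul0r horner_coef0 -qm' big_ord_recr /= big1 ?add0r => [|j _]; last first.
  by rewrite !mxE x11 expr0n subn_eq0 leqNgt /= ltn_ord !mulr0.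
by rewrite !mxE x11 subnn expr0 mulr1 mulrC.
Qed.

(** The space H dual to V consists of the binary forms in the second column of x.
    Pairing v with the monomials gives the coordinates of an isomorphism from V
    to [Delta k m]. *)
Lemma Hle_weyl m (V : rational_module k) n d : is_weyl_module m V -> Hle n (Delta k m) d -> Hle n V d.
Proof.
move=> [H [iota [iotaL iotaA iota0 iotaP]] [beta [betaL betaA beta0 betaP]]].
pose form (r : 'rV[k]_m.+1) (x : G) := (r *m mon m (col1 x)) 0 0.
have /choice[b Hb] r : exists h, forall x, form r x = iota h x.
  by apply/iotaP; exact: in_ind_form.
have iota_inj u v : (forall x, iota u x = iota v x) -> u = v.
  move=> E; apply/eqP; rewrite -subr_eq0; apply/eqP/iota0 => x.
  by rewrite -[- v]scaleN1r [u + _]addrC iotaL E mulN1r addNr.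
have formP h : exists r, h = b r.
  have [|r Hr] := @in_ind_poly m (iota h); first by apply/iotaP; exists h.
  by exists r; apply: iota_inj => x; rewrite -Hb.
have form_inj r r' : (forall x, form r x = form r' x) -> r = r'.
  move=> E; apply/eqP; rewrite -subr_eq0; apply/eqP/(@mon_sep0 k) => t.
  apply/matrixP => i j; rewrite !ord1 mulmxBl.
  by have := E (elem 0 t); rewrite /form col1_elem !mxE => ->; rewrite subrr.
have bL : linear b.
  move=> a r r'; apply: iota_inj => x.
  by rewrite iotaL -!Hb /form mulmxDl -scalemxAl !mxE.
have bA g r : act g (b r) = b (r *m subst m (val g^-1%g)^T).
  by apply: iota_inj => x; rewrite iotaA -!Hb /form -mulmxA substE -col1M.
pose bl := lin_of bL.
pose L v : Delta k m := \col_i beta v (bl (delta_mx 0 i)).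
have LE v r : (r *m L v) 0 0 = beta v (b r).
  rewrite mxE -[b r]/(bl r) {2}(row_sum_delta r) !linear_sum; apply: eq_bigr => i _.
  by rewrite mxE !linearZ.
have L_sep (x y : 'cV[k]_m.+1) : (forall r : 'rV_m.+1, (r *m x) 0 0 = (r *m y) 0 0) -> x = y.
  by move=> E; apply/colP => i; have := E (delta_mx 0 i); rewrite -!rowE !mxE.
have LL : linear L by move=> a u v; apply/colP => i; rewrite !mxE betaL.
have LA g v : L (act g v) = act g (L v).
  apply: L_sep => r.
  by rewrite LE betaA bA del_actE mulmxA LE invgK.
have [||c [Hc _]] := rel_inverse (a := hom_of LL LA).
- move=> v Ev; apply: beta0 => h; have [r ->] := formP h.
  by rewrite -LE -[L v]/(hom_of LL LA v) Ev mulmx0 mxE.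
- move=> z.
  have [|||phi Hphi] := @rel_lin k H k^o (fun h y => exists2 r, h = b r & y = (r *m z) 0 0).
  + by move=> h; have [r ->] := formP h; exists ((r *m z) 0 0), r.
  + move=> a u v y y' [r -> ->] [r' -> ->]; exists (a *: r + r'); first by rewrite bL.
    by rewrite mulmxDl -scalemxAl !mxE.
  + move=> y [r E ->]; rewrite (_ : r = 0) ?mul0mx ?mxE //.
    by apply: form_inj => x; rewrite !Hb -E -[b 0]/(bl 0) linear0.
  have phil : linear_for *%R phi by move=> a u v; rewrite linearP.
  pose phis : {scalar H} := HB.pack (phi : H -> k) (GRing.isLinear.Build k H k *%R phi phil).
  have [v Hv] := betaP phis; exists v; apply: L_sep => r.
  rewrite LE -Hv; have [r' E ->] := Hphi (b r).
  by rewrite (form_inj r r') // => x; rewrite !Hb E.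
exact: Hle_retract Hc.
Qed.

End Weyl.

Theorem corollary3p4 (k : closedFieldType) (hk : 2%N \in [pchar k])
    (m n : nat) (hn : (1 <= n)%N)
    (V : rational_module k) (hV : is_weyl_module m V) :
  H_dim_le n V (fib (2 * n)).
Proof.
case: n hn => // n hn.
by apply: Ext_of_Hle; apply: Hle_weyl hV _; exact: Hle_Delta hk _ _ hn.
Qed.
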